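(* Let $G$ be a countably infinite amenable group with a Følner sequence $F=(F_N)_{N\in\mathbb{N}}$, and let $e$ be the identity of $G$. A set $H\subseteq G\setminus\{e\}$ is $F$-vdC in $G$ if and only if for every measure preserving system $(X,\mathcal{B},\mu,(T_g)_{g\in G})$ and every (complex valued) function $f\in L^\infty(\mu)$, $$\int_{X}f(T_hx)\cdot\overline{f(x)}\,d\mu(x)=0\text{ for all }h\in H\quad\text{implies}\quad\int_{X}f\,d\mu=0.$$
   Context: A (left) Følner sequence in a countable group $G$ is a sequence $F=(F_N)_{N\in\mathbb{N}}$ of (nonempty) finite subsets of $G$ such that $\lim_{N\to\infty}\frac{|gF_N\Delta F_N|}{|F_N|}=0$ for all $g\in G$; $G$ is (left) amenable if it has a Følner sequence. A measure preserving system $(X,\mathcal{B},\mu,(T_g)_{g\in G})$ is a probability space $(X,\mathcal{B},\mu)$ together with an action $(T_g)_{g\in G}$ of $G$ on $X$ by measure preserving maps (so $T_g\circ T_h=T_{gh}$). Let $\mathbb{T}=\mathbb{R}/\mathbb{Z}$ with Lebesgue (Haar) probability measure $m$. A sequence $(x_g)_{g\in G}$ in $\mathbb{T}$ is $F$-u.d. mod $1$ if for every continuous $\varphi:\mathbb{T}\to\mathbb{C}$ one has $\lim_{N\to\infty}\frac{1}{|F_N|}\sum_{g\in F_N}\varphi(x_g)=\int_{\mathbb{T}}\varphi\,dm$. A subset $H\subseteq G\setminus\{e\}$ is $F$-vdC if every sequence $(x_g)_{g\in G}$ in $\mathbb{T}$ such that $(x_{hg}-x_g)_{g\in G}$ is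 $F$-u.d. mod $1$ for all $h\in H$ is itself $F$-u.d. mod $1$. *)

(* Defs.v *)
From HB Require Import structures.
From mathcomp Require Import all_boot all_order all_algebra finmap.
From mathcomp Require Import all_classical all_reals all_analysis.
From mathcomp Require Import measurable_realfun complex.

Set Implicit Arguments.
Unset Strict Implicit.
Unset Printing Implicit Defensive.

Import Order.TTheory GRing.Theory Num.Theory.
Import numFieldNormedType.Exports.

Local Open Scope classical_set_scope.
Local Open Scope ring_scope.

(* [R[i]] packed as a structure: the topology given by the modulus is attached
   to the sorts of number field structures, not to [complex R] itself. *)
Definition Cplx (R : realType) : numClosedFieldType := R[i].

Definition cintegral (R : realType) (d : measure_display)
    (X : measurableType d) (mu : {measure set X -> \bar R})
    (f : X -> Cplx R) : Cplx R :=
  (Rintegral mu setT (fun x => complex.Re (f x)) +i*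
   Rintegral mu setT (fun x => complex.Im (f x)))%C.

(* Complex-valued functions in L^oo (representatives, defined everywhere).
   For real [M], [`|z| <= M%:C] compares the modulus of [z] with [M]. *)
Definition Linfty (R : realType) (d : measure_display)
    (X : measurableType d) (mu : {measure set X -> \bar R})
    (f : X -> Cplx R) : Prop :=
  [/\ measurable_fun setT (fun x => complex.Re (f x)),
      measurable_fun setT (fun x => complex.Im (f x)) &
      exists M : R, {ae mu, forall x, `|f x| <= (M%:C)%C}].

Definition intgroup (R : realType) : zmodClosed R :=
  GRing.ZmodClosed.clone R (@Num.int_num_subdef R) _.

Lemma intgroupE (R : realType) (x : R) :
  (x \in intgroup R) = (x \is a Num.int).
Proof. by []. Qed.

(* R/Z with the quotient topology, the quotient group law and the Borel
   sigma-algebra. *)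
Definition torus (R : realType) : Type :=
  quotient_topology {ideal_quot (intgroup R)}.

Section Torus.
Variable R : realType.
Local Notation quotZ := {ideal_quot (intgroup R)}.

HB.instance Definition _ :=
  PointedTopological.copy (torus R) (quotient_topology quotZ).
HB.instance Definition _ :=
  Quotient.copy (torus R) (quotient_topology quotZ).
HB.instance Definition _ := GRing.isZmodule.Build (torus R)
  (@Quotient.addqA R (intgroup R)) (@Quotient.addqC R (intgroup R))
  (@Quotient.add0q R (intgroup R)) (@Quotient.addNq R (intgroup R)).

Definition torus_open : set (set (torus R)) := fun A => open A.

HB.instance Definition _ :=
  @isMeasurable.Build (sigma_display torus_open) (torus R)
    <<s torus_open >> (@sigma_algebra0 _ setT torus_open)
    (@sigma_algebraC _ torus_open) (@sigma_algebra_bigcup _ setT torus_open).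

Definition torus_pi (x : measurableTypeR R) : torus R :=
  (\pi_(torus R) (x : R))%qT.

Lemma torus_pi_eq (x y : R) :
  torus_pi x = torus_pi y <-> x - y \is a Num.int.
Proof.
rewrite -intgroupE Quotient.idealrBE.
exact: (rwP (@eqP quotZ _ _)).
Qed.

Lemma torus_piB (x y : R) : torus_pi (x - y) = torus_pi x - torus_pi y.
Proof.
rewrite /torus_pi -[LHS]/(\pi_quotZ (x - y)%R)%qT Quotient.pi_add.
by rewrite Quotient.pi_opp.
Qed.

Lemma measurable_torus_pi : measurable_fun setT torus_pi.
Proof.
apply: (@measurability _ _ _ _ _ _ torus_open) => // _ [A oA <-].
by rewrite setTI; apply: open_measurable; exact: oA.
Qed.

HB.instance Definition _ :=
  isMeasurableFun.Build _ _ _ _ torus_pi measurable_torus_pi.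

(* [uniform_prob ltr01] is Lebesgue measure on the unit interval. *)
Definition haar : probability (torus R) R :=
  distribution (uniform_prob (@ltr01 R)) torus_pi.

End Torus.

Section Folner.
Local Open Scope fset_scope.

Definition folner (R : realType) (G : groupType) (F : nat -> {fset G}) : Prop :=
  (forall N, F N != fset0) /\
  forall g : G,
    (fun N => let gF := [fset (g * x)%g | x in F N] in
       (#|` (gF `\` F N) `|` (F N `\` gF)|%:R / #|` F N|%:R)%R : R) @ \oo
      --> (0 : R).

End Folner.

Definition ud_mod1 (R : realType) (G : groupType) (F : nat -> {fset G})
    (x : G -> torus R) : Prop :=
  forall phi : torus R -> Cplx R, continuous phi ->
    (fun N => (#|` F N|%:R)^-1 * \sum_(g <- F N) phi (x g)) @ \oo
      --> cintegral (haar R) phi.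

Definition vdC (R : realType) (G : groupType) (F : nat -> {fset G})
    (H : set G) : Prop :=
  forall x : G -> torus R,
    (forall h, H h -> ud_mod1 F (fun g => x (h * g)%g - x g)) ->
    ud_mod1 F x.

Definition mp_action (R : realType) (G : groupType) (d : measure_display)
    (X : measurableType d) (mu : probability X R) (T : G -> X -> X) : Prop :=
  [/\ forall x, T 1%g x = x,
      forall g h x, T g (T h x) = T (g * h)%g x,
      forall g, measurable_fun setT (T g) &
      forall g (A : set X), measurable A -> mu (T g @^-1` A) = mu A].

(* Main.v *)
(** By Weyl's criterion a sequence is u.d. mod 1 iff the averages of all
    nontrivial characters along it tend to 0.

    If the dynamical property holds and [x] has u.d. differences along [H], let
    [mu] be the measure on the ultrafilters of [G] induced by an ultralimit of
    the averages over [F N]; left translation preserves it.  The function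
    [f U = lim_U e(k x_g)] has [f(T_h U) * conj (f U) = lim_U e(k (x_hg - x_g))],
    whose integral is 0 for [h] in [H], so [f] has mean 0, i.e. the averages of
    [e(k x_g)] vanish along the ultrafilter.

    Conversely, let [f] be a bounded function on a system with vanishing
    correlations along [H] and nonzero mean.  Choose random centres in [G], sparse
    enough that a fixed proportion of the sites [u] lies near exactly one of them,
    say [u = k c], and give [u] the value [z_u = f(T_k w_c)] with independent
    points [w_c] (and [z_u = 0] at the other sites).  Given [z], choose the [x_u]
    independently with density [1 + Re (conj z_u * e(x))].  For [h] in [H] all
    characters of [x_hu - x_u] then have small mean and those of [x_u] do not.  As the
    sets [F N] are arbitrary (their sizes may grow arbitrarily slowly), random
    choice does not give convergence along [F]; instead [x] is taken as a ground
    state of the sum of the squared local averages of the deviations.  Comparing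
    it with a random sample inside [F N] shows that its energy per site is small,
    and by Cauchy-Schwarz so are the deviations of the averages over [F N].
    The scales of the local averages and of the samples grow slowly through [G]. *)

From HB Require Import structures.
Require Import Defs.
From mathcomp Require Import all_boot all_order all_algebra finmap.
From mathcomp Require Import all_classical all_reals all_analysis.
From mathcomp Require Import measurable_realfun complex.
From mathcomp Require Import ring lra zify.

Set Implicit Arguments.
Unset Strict Implicit.
Unset Printing Implicit Defensive.

Import Order.TTheory GRing.Theory Num.Theory.
Import numFieldNormedType.Exports.

Local Open Scope classical_set_scope.
Local Open Scope ring_scope.

(** * Expectations over finitely many independent coordinates *)

(** The energy has two kinds of targets. Correlations along [H] should vanish, but characters of
    single sites should have mean [density * C b / 2]; without the second kind an equidistributed
    configuration would do as well. Since [density] stays above 1/4 at every scale, the second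
    target survives in the averages.

    One tile [K] cannot serve infinitely many shifts, frequencies and accuracies, so every site gets
    a level and every level its own tile, sample law and root of unity order. Different levels must
    not interact: a site near a change of level gets the value 0, hence a uniform law, and the
    levels grow so fast that such sites are rare in suitable sets [F N].

    All randomness is finite. Samples have finitely supported laws, site values are roots of unity,
    and only coordinates in a finite set are integrated. Finite alphabets also let near minimizers
    converge coordinatewise. The price of each comparison is a bounded additive slack, harmless
    because [F N] grows. *)

Section Expectation.
Variables (R : realType) (I : eqType) (B : Type) (law : I -> seq (R * B)).

Definition upd (t : I -> B) (c : I) (b : B) : I -> B :=
  fun i => if i == c then b else t i.

Definition expect1 (c : I) (phi : (I -> B) -> R) : (I -> B) -> R :=
  fun t => \sum_(wb <- law c) wb.1 * phi (upd t c wb.2).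

(** The coordinates in [s] are integrated one after another, the others stay frozen at their values
    in [t]. Finite sums thus replace an infinite product measure. *)
Fixpoint expect (s : seq I) (phi : (I -> B) -> R) : (I -> B) -> R :=
  if s is c :: s' then expect1 c (expect s' phi) else phi.

Definition indep (phi : (I -> B) -> R) (c : I) :=
  forall t b, phi (upd t c b) = phi t.

Definition depends (phi : (I -> B) -> R) (P : I -> Prop) :=
  forall t t', (forall i, P i -> t i = t' i) -> phi t = phi t'.

Lemma depends_indep phi (P : I -> Prop) c : depends phi P -> ~ P c -> indep phi c.
Proof.
move=> dphi Pc t b; apply: dphi => i Pi; rewrite /upd.
by case: eqP => // ic; case: Pc; rewrite -ic.
Qed.

Lemma upd_id t c b b' : upd (upd t c b) c b' = upd t c b'.
Proof. by apply/funext => i; rewrite /upd; case: eqP. Qed.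

Lemma upd_comm t c b c' b' : c != c' ->
  upd (upd t c b) c' b' = upd (upd t c' b') c b.
Proof.
move=> cc'; apply/funext => i; rewrite /upd.
by case: eqP => // ->; rewrite eq_sym (negbTE cc').
Qed.

Lemma expect1_indep_self c phi : indep (expect1 c phi) c.
Proof. by move=> t b; apply: eq_bigr => wb _; rewrite upd_id. Qed.

Lemma expect1_indep c c' phi : indep phi c -> indep (expect1 c' phi) c.
Proof.
move=> iphi t b; have [<-|cc'] := eqVneq c c'; first exact: expect1_indep_self.
by apply: eq_bigr => wb _; rewrite upd_comm// iphi.
Qed.

Lemma expect_indep c s phi : indep phi c -> indep (expect s phi) c.
Proof. by elim: s => //= c' s IHs iphi; exact/expect1_indep/IHs. Qed.

Lemma expectZ s a phi : expect s (fun t => a * phi t) = fun t => a * expect s phi t.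
Proof.
elim: s => //= c s ->; apply/funext => t.
by rewrite /expect1 mulr_sumr; apply: eq_bigr => wb _; rewrite mulrCA.
Qed.

Lemma expect_sum (J : Type) (r : seq J) s (phi : J -> (I -> B) -> R) :
  expect s (fun t => \sum_(j <- r) phi j t) =
  fun t => \sum_(j <- r) expect s (phi j) t.
Proof.
elim: s => //= c s ->; apply/funext => t; rewrite /expect1 exchange_big/=.
by apply: eq_bigr => wb _; rewrite mulr_sumr.
Qed.

Lemma expectD s phi psi : expect s (fun t => phi t + psi t) =
  fun t => expect s phi t + expect s psi t.
Proof.
elim: s => //= c s ->; apply/funext => t; rewrite /expect1 -big_split/=.
by apply: eq_bigr => wb _; rewrite mulrDr.
Qed.

Lemma expectN s phi : expect s (fun t => - phi t) = fun t => - expect s phi t.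
Proof.
by under eq_fun do rewrite -mulN1r; rewrite expectZ; apply/funext => t; rewrite mulN1r.
Qed.

Hypothesis law_ge0 : forall c wb, List.In wb (law c) -> 0 <= wb.1.
Hypothesis law_sum1 : forall c, \sum_(wb <- law c) wb.1 = 1.

(** [List.In] is used because the values live in a bare [Type], without decidable equality. *)
Lemma ler_sum_In (T : Type) (r : seq T) (f g : T -> R) :
  (forall x, List.In x r -> f x <= g x) -> \sum_(x <- r) f x <= \sum_(x <- r) g x.
Proof.
elim: r => [|x r IHr] fg; first by rewrite !big_nil.
rewrite !big_cons; apply: lerD; first by apply: fg; left.
by apply: IHr => y yr; apply: fg; right.
Qed.

Lemma expect1_id c phi : indep phi c -> expect1 c phi = phi.
Proof.
move=> iphi; apply/funext => t; rewrite /expect1.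
under eq_bigr do rewrite iphi.
by rewrite -mulr_suml law_sum1 mul1r.
Qed.

Lemma expect_id s phi : (forall c, c \in s -> indep phi c) -> expect s phi = phi.
Proof.
elim: s => //= c s IHs iphi; rewrite IHs.
  by rewrite expect1_id//; apply: iphi; rewrite mem_head.
by move=> c' c's; apply: iphi; rewrite in_cons c's orbT.
Qed.

Lemma expect_cst s a : expect s (fun=> a) = fun=> a.
Proof. by rewrite expect_id. Qed.

Lemma ler_expect s phi psi t : (forall t', phi t' <= psi t') ->
  expect s phi t <= expect s psi t.
Proof.
move=> pp; elim: s t => //= c s IHs t.
by apply: ler_sum_In => wb /law_ge0 w0; rewrite ler_wpM2l.
Qed.

Lemma ler_norm_expect s phi t :
  `|expect s phi t| <= expect s (fun t => `|phi t|) t.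
Proof.
rewrite ler_norml -lerNl -(congr1 (@^~ t) (expectN s phi)) /=.
by apply/andP; split; apply: ler_expect => t'; [rewrite -normrN|]; exact: ler_norm.
Qed.

(** Independence: each coordinate of [s] is ignored by one of the factors, so the integral over it
    passes through that factor. *)
Lemma expectM s phi psi :
  (forall c, c \in s -> indep phi c \/ indep psi c) ->
  expect s (fun t => phi t * psi t) = fun t => expect s phi t * expect s psi t.
Proof.
elim: s => //= c s IHs h; rewrite {}IHs; last first.
  by move=> c' c's; apply: h; rewrite in_cons c's orbT.
apply/funext => t; case: (h c (mem_head _ _)) => [ip|ip].
  rewrite (expect1_id (expect_indep _ ip)) /expect1 mulr_sumr.
  by apply: eq_bigr => wb _; rewrite (expect_indep _ ip) mulrCA.
rewrite (expect1_id (expect_indep s ip)) /expect1 mulr_suml.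
by apply: eq_bigr => wb _; rewrite (expect_indep _ ip) mulrA.
Qed.

Lemma expect_single s phi c : c \in s -> (forall c', c' != c -> indep phi c') ->
  expect s phi = expect1 c phi.
Proof.
move=> + iphi; elim: s => //= c' s IHs; rewrite in_cons.
have [cs _|cs] := boolP (c \in s).
  rewrite IHs//; have [->|cc'] := eqVneq c' c.
    by rewrite expect1_id//; exact: expect1_indep_self.
  by rewrite expect1_id//; apply: expect1_indep; exact: iphi.
rewrite orbF => /eqP <-; rewrite expect_id// => c'' c''s; apply: iphi.
by apply: contra cs => /eqP <-.
Qed.

(** Serves in contrapositive form: a bound on a mean yields one configuration obeying it, with
    values among the atoms of the laws. *)
Lemma expect_ge s phi t C :
  (forall t', (forall i, i \notin s -> t' i = t i) ->
     (forall i, i \in s -> exists w, List.In (w, t' i) (law i)) -> C <= phi t') ->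
  C <= expect s phi t.
Proof.
elim: s t => [|c s IHs] t h /=; first by apply: h.
rewrite /expect1 -[C]mul1r -(law_sum1 c) mulr_suml; apply: ler_sum_In => -[w b] wb.
apply: ler_wpM2l; first exact: law_ge0 wb.
apply: IHs => t' t't t's; apply: h => i; rewrite in_cons.
  by rewrite negb_or => /andP[ic /t't]; rewrite /upd (negbTE ic).
have [/t's//|nis] := boolP (i \in s); rewrite orbF => /eqP ic.
by exists w; rewrite (t't _ nis) /upd ic eqxx.
Qed.

End Expectation.

(** * Ground states of local energies *)

Section GroundState.
Variables (R : realType) (I J : choiceType) (B : eqType).
Variables (V : nat -> {fset I}) (A : I -> seq B) (a0 : I -> B).
Variables (Psi : J -> (I -> B) -> R) (W : J -> {fset I}).
Hypothesis V_exhaust : forall i, exists n0, forall n, (n0 <= n)%N -> i \in V n.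
Hypothesis a0A : forall i, a0 i \in A i.
Hypothesis Psi_ge0 : forall j t, 0 <= Psi j t.
Hypothesis Psi_dep : forall j t t',
  (forall i, i \in W j -> t i = t' i) -> Psi j t = Psi j t'.
Hypothesis W_locfin : forall X : {fset I}, exists U : {fset J},
  forall j i, i \in W j -> i \in X -> j \in U.

(** The infimum is only approached, up to 1; this slack stays the same however large [U] is. *)
Lemma near_minimizer (U : {fset J}) : exists t, (forall i, t i \in A i) /\
  forall t', (forall i, t' i \in A i) ->
    \sum_(j <- U) Psi j t <= \sum_(j <- U) Psi j t' + 1.
Proof.
pose E : set R := [set e | exists2 t : I -> B, (forall i, t i \in A i) &
  e = \sum_(j <- U) Psi j t].
have lbE : has_lbound E.
  by exists 0 => _ [t _ ->]; apply: sumr_ge0 => j _; exact: Psi_ge0.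
have infE : has_inf E by split => //; exists (\sum_(j <- U) Psi j a0); exists a0.
have [_ [t tA ->] tinf] := inf_adherent ltr01 infE.
exists t; split => // t' t'A; apply: (le_trans (ltW tinf)).
by rewrite lerD2r; apply: ge_inf => //; exists t'.
Qed.

Lemma ultra_pigeonhole (T : Type) (F : set_system T) (f : T -> B) (s : seq B) :
  UltraFilter F -> F [set x | f x \in s] -> exists2 b, b \in s & F [set x | f x = b].
Proof.
move=> FU; elim: s => [|b s IHs] Fs.
  by have [x] := filter_ex Fs.
have [Fb|Fb] := in_ultra_setVsetC [set x | f x = b] FU.
  by exists b => //; rewrite mem_head.
have [|b' b's Fb'] := IHs; last by exists b' => //; rewrite in_cons b's orbT.
apply: filterS (filterI Fs Fb) => x /= [].
by rewrite in_cons => /orP[/eqP|].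
Qed.

Lemma filter_forall_seq (T : Type) (F : set_system T) (K : eqType) (s : seq K)
    (P : K -> set T) : Filter F -> (forall k, k \in s -> F (P k)) ->
  F [set x | forall k, k \in s -> P k x].
Proof.
move=> FF; elim: s => [|k s IHs] FP; first by apply: filterS filterT => x _ k.
have FPk : F (P k) by apply: FP; rewrite mem_head.
have {}IHs : F [set x | forall k, k \in s -> P k x].
  by apply: IHs => k' k's; apply: FP; rewrite in_cons k's orbT.
apply: filterS (filterI FPk IHs) => x /= [Pk Ps] k'.
by rewrite in_cons => /orP[/eqP->//|]; exact: Ps.
Qed.

(* An ultralimit of near minimizers over an exhaustion; the slack [1] disappears
   after division by the size of a Følner set. *)
Lemma ground_state : exists t, (forall i, t i \in A i) /\
  forall (X : {fset I}) (U : {fset J}) (t' : I -> B),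
    (forall j i, i \in W j -> i \in X -> j \in U) ->
    (forall i, i \notin X -> t' i = t i) -> (forall i, i \in X -> t' i \in A i) ->
    \sum_(j <- U) Psi j t <= \sum_(j <- U) Psi j t' + 1.
Proof.
have [Un UnP] := choice (fun n => W_locfin (V n)).
have [tn tnP] := choice (fun n => near_minimizer (Un n)).
have [F [FU Foo]] := ultraFilterLemma (eventually_filter).
have FP := @ultra_proper _ _ FU; have FF : Filter F by exact: filter_filter.
(* Each coordinate takes values in the finite list [A i], so it is constant on a set of the
   ultrafilter. *)
have /choice[t tP] : forall i, exists b, b \in A i /\ F [set n | tn n i = b].
  move=> i; have [|b bA Fb] := @ultra_pigeonhole _ F (tn^~ i) (A i) FU.
    by apply: filterS filterT => n _ /=; exact: (tnP n).1.
  by exists b.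
exists t; split => [i|X U t' XU t'X t'A]; first exact: (tP i).1.
have F1 : F [set n | forall j, j \in (U : seq J) -> forall i, i \in (W j : seq I) -> tn n i = t i].
  apply: filter_forall_seq => j _; apply: filter_forall_seq => i _; exact: (tP i).2.
have F2 : F [set n | forall i, i \in (X : seq I) -> i \in V n].
  apply: filter_forall_seq => i _; have [n0 n0P] := V_exhaust i.
  by apply: Foo; exists n0 => // n /= /n0P.
have [n /= [tnt XV]] := filter_ex (filterI F1 F2).
(* [t'] is spliced into a near minimizer [tn n] that agrees with [t] on all windows of [U] and whose
   region [V n] contains [X]. *)
pose s i := if i \in X then t' i else tn n i.
have sA i : s i \in A i by rewrite /s; case: ifPn => [/t'A//|_]; exact: (tnP n).1.
have := (tnP n).2 _ sA; rewrite -lerBlDl -sumrB => le1.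
rewrite -lerBlDl -sumrB.
pose touch j := has (fun i => i \in X) (W j).
pose d j := Psi j (tn n) - Psi j s.
have d0 j : ~~ touch j -> d j = 0.
  move=> tj; rewrite /d (@Psi_dep _ _ s) ?subrr// => i iW; rewrite /s ifN//.
  by apply: contra tj => iX; apply/hasP; exists i.
have dE j : j \in U -> Psi j t - Psi j t' = d j.
  move=> jU; congr (_ - _); apply: Psi_dep => i iW; first by rewrite (tnt _ jU).
  by rewrite /s; case: ifPn => // /t'X ->; rewrite (tnt _ jU).
have {}le1 : \sum_(j <- Un n) d j <= 1 by [].
have touchE (Y : {fset J}) : \sum_(j <- Y) d j = \sum_(j <- Y | touch j) d j.
  by rewrite (bigID touch)/= [X in _ + X]big1 ?addr0// => j /d0.
rewrite (eq_big_seq d) => [|j jU]; last exact: dE.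
apply: le_trans le1; rewrite !touchE.
(* Only windows meeting [X] matter, and since [X] lies in [V n], both [U] and [Un n] contain all of
   them. *)
have -> : \sum_(j <- U | touch j) d j = \sum_(j <- Un n | touch j) d j; last exact: lexx.
rewrite -big_filter -[RHS]big_filter; apply: perm_big.
apply: uniq_perm; [exact: filter_uniq (fset_uniq _)..|].
move=> j; rewrite !mem_filter; have [/hasP[i iW iX]|//] := boolP (touch j).
by rewrite (XU _ _ iW iX) (UnP _ _ _ iW (XV _ iX)).
Qed.

End GroundState.

(** * Characters of the torus *)

Section Characters.
Variable R : realType.
Implicit Types (k : nat) (x y : torus R) (r : R).

Definition ang k r : R := (pi *+ 2) * (k%:R * r).

Definition tcos k x : R := cos (ang k (repr x)).
Definition tsin k x : R := sin (ang k (repr x)).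
Definition trig (b : bool) k x : R := if b then tcos k x else tsin k x.

Lemma cosD_int (a : R) (m : int) : cos (a + pi *+ 2 * m%:~R) = cos a.
Proof.
case: m => n; first by rewrite -pmulrn mulr_natr; exact: (periodicn (@cosD2pi R)).
rewrite NegzE mulrNz mulrN -pmulrn mulr_natr.
by rewrite -{2}(subrK (pi *+ 2 *+ n.+1) a) (periodicn (@cosD2pi R)).
Qed.

Lemma sinD_int (a : R) (m : int) : sin (a + pi *+ 2 * m%:~R) = sin a.
Proof. by rewrite -!cosBpihalf addrAC cosD_int. Qed.

Lemma ang_repr k r : exists m : int,
  ang k (repr (torus_pi r)) = ang k r + pi *+ 2 * m%:~R.
Proof.
have /torus_pi_eq/intrP[m mE] : torus_pi (repr (torus_pi r)) = torus_pi r.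
  by rewrite /torus_pi reprK.
exists (k%:Z * m); rewrite /ang -mulrDr intrM -mE -pmulrn; congr (_ * _).
by rewrite -mulrDr addrC subrK.
Qed.

Lemma tcosE k r : tcos k (torus_pi r) = cos (ang k r).
Proof. by rewrite /tcos; have [m ->] := ang_repr k r; rewrite cosD_int. Qed.

Lemma tsinE k r : tsin k (torus_pi r) = sin (ang k r).
Proof. by rewrite /tsin; have [m ->] := ang_repr k r; rewrite sinD_int. Qed.

Lemma torus_piK x : torus_pi (repr x) = x.
Proof. by rewrite /torus_pi reprK. Qed.

Lemma angB k r s : ang k (r - s) = ang k r - ang k s.
Proof. by rewrite /ang !mulrBr. Qed.

Lemma tcosB k x y : tcos k (x - y) = tcos k x * tcos k y + tsin k x * tsin k y.
Proof.
by rewrite -(torus_piK x) -(torus_piK y) -torus_piB !tcosE !tsinE angB cosB.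
Qed.

Lemma tsinB k x y : tsin k (x - y) = tsin k x * tcos k y - tcos k x * tsin k y.
Proof.
by rewrite -(torus_piK x) -(torus_piK y) -torus_piB !tcosE !tsinE angB sinB.
Qed.

Lemma trig_max b k x : `|trig b k x| <= 1.
Proof. by case: b; [exact: cos_max|exact: sin_max]. Qed.

Lemma tcos2Dtsin2 k x : tcos k x ^+ 2 + tsin k x ^+ 2 = 1.
Proof. exact: cos2Dsin2. Qed.

Lemma cos_lt1 (a : R) : 0 < a < pi *+ 2 -> cos a < 1.
Proof.
move=> /andP[a0 a2].
have sp : 0 < sin (a / 2) by apply: sin_gt0_pi; lra.
have -> : a = (a / 2) *+ 2 by rewrite -mulr_natr divfK.
rewrite cos_mulr2n cos2sin2; nra.
Qed.

(** Shifting the index permutes the terms and rotates the vector [(C, S)] by the angle [a]. The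
    rotation minus the identity has determinant [(1 - cos a) ^+ 2 + sin a ^+ 2 > 0], so the fixed
    vector is 0. *)
Lemma sum_cos_sin0 (m Q : nat) : (0 < m < Q)%N ->
  \sum_(0 <= q < Q) cos (ang m (q%:R / Q%:R)) = 0 /\
  \sum_(0 <= q < Q) sin (ang m (q%:R / Q%:R)) = 0.
Proof.
move=> /andP[m0 mQ]; have Q0 : (0 < Q)%N by exact: ltn_trans mQ.
have Qn0 : (Q%:R : R) != 0 by rewrite pnatr_eq0 -lt0n.
set a := ang m (1 / Q%:R).
have angS q : ang m (q.+1%:R / Q%:R) = ang m (q%:R / Q%:R) + a.
  by rewrite /a /ang -mulrDr -mulrDr -mulrDl natr1.
have angQ : ang m (Q%:R / Q%:R) = pi *+ 2 * (m%:Z)%:~R :> R.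
  by rewrite /ang divff// mulr1.
have ang0 : ang m (0%:R / Q%:R) = 0 by rewrite /ang !mul0r !mulr0.
set C := \sum_(0 <= q < Q) cos _; set S := \sum_(0 <= q < Q) sin _.
have shift (f : R -> R) : f (ang m (Q%:R / Q%:R)) = f (ang m (0%:R / Q%:R)) ->
    \sum_(0 <= q < Q) f (ang m (q.+1%:R / Q%:R)) =
    \sum_(0 <= q < Q) f (ang m (q%:R / Q%:R)).
  move=> fQ0; apply: (@addrI _ (f (ang m (0%:R / Q%:R)))).
  by rewrite -(@big_nat_recl _ _ _ _ 0 (fun q => f (ang m (q%:R / Q%:R))))// big_nat_recr//= fQ0 addrC.
have shiftC : \sum_(0 <= q < Q) cos (ang m (q.+1%:R / Q%:R)) = C.
  by apply: (shift cos); rewrite ang0 angQ -[_ * _]add0r cosD_int.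
have shiftS : \sum_(0 <= q < Q) sin (ang m (q.+1%:R / Q%:R)) = S.
  by apply: (shift sin); rewrite ang0 angQ -[_ * _]add0r sinD_int.
have eC : C = C * cos a - S * sin a.
  rewrite -{1}shiftC /C /S !mulr_suml -sumrB.
  by apply: eq_bigr => q _; rewrite angS cosD.
have eS : S = S * cos a + C * sin a.
  rewrite -{1}shiftS /C /S !mulr_suml -big_split/=.
  by apply: eq_bigr => q _; rewrite angS sinD.
have dC : C * ((1 - cos a) ^+ 2 + sin a ^+ 2) = 0.
  have e1 : C * (1 - cos a) = - (S * sin a) by rewrite mulrBr mulr1 {1}eC; ring.
  have e2 : S * (1 - cos a) = C * sin a by rewrite mulrBr mulr1 {1}eS; ring.
  have -> : C * ((1 - cos a) ^+ 2 + sin a ^+ 2) =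
            (C * (1 - cos a)) * (1 - cos a) + (C * sin a) * sin a by ring.
  by rewrite e1 -e2; ring.
have dS : S * ((1 - cos a) ^+ 2 + sin a ^+ 2) = 0.
  have e1 : C * (1 - cos a) = - (S * sin a) by rewrite mulrBr mulr1 {1}eC; ring.
  have e2 : S * (1 - cos a) = C * sin a by rewrite mulrBr mulr1 {1}eS; ring.
  have -> : S * ((1 - cos a) ^+ 2 + sin a ^+ 2) =
            (S * (1 - cos a)) * (1 - cos a) + (S * sin a) * sin a by ring.
  by rewrite e2 -[S * sin a]opprK -e1; ring.
have pi2 : 0 < pi *+ 2 :> R by have := pi_gt0 R; lra.
have ca : cos a < 1.
  have m'0 : 0 < m%:R / Q%:R :> R by rewrite divr_gt0 ?ltr0n.
  have m'1 : m%:R / Q%:R < 1 :> R by rewrite ltr_pdivrMr ?ltr0n// mul1r ltr_nat.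
  by apply: cos_lt1; rewrite /a /ang div1r; apply/andP; split; nra.
have d0 : (1 - cos a) ^+ 2 + sin a ^+ 2 != 0.
  have : 0 < (1 - cos a) ^+ 2 by apply: exprn_gt0; rewrite subr_gt0.
  by move=> h; rewrite gt_eqF//; apply: ltr_wpDr => //; exact: sqr_ge0.
by split; apply/eqP; [move/eqP: dC|move/eqP: dS]; rewrite mulf_eq0 (negbTE d0) orbF.
Qed.

(* The law on the [Q]-th roots of unity with Fourier coefficient [(a + bi)/2] at
   frequency 1 and all other low-frequency coefficients zero. *)
Definition site_law (Q : nat) (z : R * R) : seq (R * torus R) :=
  [seq ((1 + z.1 * cos (ang 1 (q%:R / Q%:R)) + z.2 * sin (ang 1 (q%:R / Q%:R))) / Q%:R,
        torus_pi (q%:R / Q%:R)) | q <- index_iota 0 Q].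

Lemma site_law_moment (Q : nat) (z : R * R) (phi : R -> R) (psi : torus R -> R) :
  (forall r, psi (torus_pi r) = phi r) ->
  \sum_(wb <- site_law Q z) wb.1 * psi wb.2 =
  (\sum_(0 <= q < Q) phi (q%:R / Q%:R)
   + z.1 * \sum_(0 <= q < Q) cos (ang 1 (q%:R / Q%:R)) * phi (q%:R / Q%:R)
   + z.2 * \sum_(0 <= q < Q) sin (ang 1 (q%:R / Q%:R)) * phi (q%:R / Q%:R)) / Q%:R.
Proof.
move=> psiE; rewrite big_map !mulr_sumr -!big_split/= mulr_suml.
by apply: eq_bigr => q _; rewrite psiE; ring.
Qed.

Lemma angD (k l : nat) r : ang (k + l) r = ang k r + ang l r.
Proof. by rewrite /ang -mulrDr -mulrDl -natrD. Qed.

Lemma site_law_sum1 Q z : (1 < Q)%N -> \sum_(wb <- site_law Q z) wb.1 = 1.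
Proof.
move=> Q1; have [c0 s0] := @sum_cos_sin0 1 Q Q1.
have := @site_law_moment Q z (fun=> 1) (fun=> 1) (fun=> erefl).
under eq_bigr do rewrite mulr1.
move=> ->; under [X in _ + z.1 * X]eq_bigr do rewrite mulr1.
under [X in _ + z.2 * X]eq_bigr do rewrite mulr1.
rewrite c0 s0 !mulr0 !addr0 sumr_const_nat subn0 divff// pnatr_eq0 -lt0n.
exact: ltnW.
Qed.

(** For a unit vector [e] and [|z| <= 1], expanding [|z + e|^2 >= 0] gives [1 + <z, e> >= 0]. *)
Lemma site_law_ge0 Q z wb : z.1 ^+ 2 + z.2 ^+ 2 <= 1 ->
  List.In wb (site_law Q z) -> 0 <= wb.1.
Proof.
move=> z1; rewrite /site_law; elim: (index_iota 0 Q) => //= q s IHs [<-|]//=.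
apply: divr_ge0 => //.
have := cos2Dsin2 (ang 1 (q%:R / Q%:R)); set c := cos _; set s' := sin _ => cs.
have h1 := sqr_ge0 (z.1 + c); have h2 := sqr_ge0 (z.2 + s').
rewrite !sqrrD in h1 h2; lra.
Qed.

Lemma prod_cos (a b : R) : cos a * cos b = (cos (a - b) + cos (a + b)) / 2.
Proof. rewrite cosB cosD; lra. Qed.
Lemma prod_sin (a b : R) : sin a * sin b = (cos (a - b) - cos (a + b)) / 2.
Proof. rewrite cosB cosD; lra. Qed.
Lemma prod_sin_cos (a b : R) : sin a * cos b = (sin (a + b) + sin (a - b)) / 2.
Proof. rewrite sinB sinD; lra. Qed.

(** The product formulas leave the frequencies [k - 1] and [k + 1]. Both are below [Q], so there is
    no aliasing and only frequency 0 survives, for [k = 1]. *)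
Lemma sum_prod (k Q : nat) : (0 < k)%N -> (k.+1 < Q)%N ->
  [/\ \sum_(0 <= q < Q) cos (ang 1 (q%:R / Q%:R)) * cos (ang k (q%:R / Q%:R)) = (k == 1%N)%:R * Q%:R / 2 :> R,
      \sum_(0 <= q < Q) sin (ang 1 (q%:R / Q%:R)) * sin (ang k (q%:R / Q%:R)) = (k == 1%N)%:R * Q%:R / 2 :> R,
      \sum_(0 <= q < Q) sin (ang 1 (q%:R / Q%:R)) * cos (ang k (q%:R / Q%:R)) = 0 :> R &
      \sum_(0 <= q < Q) cos (ang 1 (q%:R / Q%:R)) * sin (ang k (q%:R / Q%:R)) = 0 :> R].
Proof.
case: k => // k _ kQ.
have [c2 s2] := @sum_cos_sin0 k.+2 Q kQ.
have [c0 s0] : \sum_(0 <= q < Q) cos (ang k (q%:R / Q%:R)) = (k == 0%N)%:R * Q%:R :> R /\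
               \sum_(0 <= q < Q) sin (ang k (q%:R / Q%:R)) = 0 :> R.
  case: k kQ c2 s2 => [kQ _ _|k kQ _ _].
    have a0 (r : R) : ang 0 r = 0 by rewrite /ang mul0r mulr0.
    under eq_bigr do rewrite a0 cos0; under [X in _ /\ X = _]eq_bigr do rewrite a0 sin0.
    by rewrite sumr_const_nat big1// subn0 mul1r.
  have [|-> ->] := @sum_cos_sin0 k.+1 Q; first by rewrite /= (ltn_trans _ kQ)// ltnS leqnSn.
  by rewrite mul0r.
have S2 (r : R) : ang 1 r + ang k.+1 r = ang k.+2 r by rewrite -angD.
have S0 (r : R) : ang 1 r - ang k.+1 r = - ang k r.
  by rewrite -[k.+1]addn1 angD opprD addrC subrK.
split.
- under eq_bigr do rewrite prod_cos S0 S2 cosN.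
  by rewrite -mulr_suml big_split/= c2 c0 addr0.
- under eq_bigr do rewrite prod_sin S0 S2 cosN.
  by rewrite -mulr_suml sumrB/= c2 c0 subr0.
- under eq_bigr do rewrite prod_sin_cos S0 S2 sinN.
  by rewrite -mulr_suml big_split/= sumrN s2 s0 oppr0 addr0 mul0r.
- under eq_bigr do rewrite mulrC prod_sin_cos [ang k.+1 _ + _]addrC S2 -[_ - ang 1 _]opprB S0 opprK.
  by rewrite -mulr_suml big_split/= s2 s0 addr0 mul0r.
Qed.

Lemma site_law_tcos k Q z : (0 < k)%N -> (k.+1 < Q)%N ->
  \sum_(wb <- site_law Q z) wb.1 * tcos k wb.2 = (k == 1%N)%:R * (z.1 / 2).
Proof.
move=> k0 kQ; rewrite (site_law_moment Q z (tcosE k)).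
have [cc _ sc _] := sum_prod k0 kQ.
have [|c0 _] := @sum_cos_sin0 k Q; first by rewrite k0/=; exact: ltnW.
rewrite cc sc c0; field; rewrite pnatr_eq0; lia.
Qed.

Lemma site_law_tsin k Q z : (0 < k)%N -> (k.+1 < Q)%N ->
  \sum_(wb <- site_law Q z) wb.1 * tsin k wb.2 = (k == 1%N)%:R * (z.2 / 2).
Proof.
move=> k0 kQ; rewrite (site_law_moment Q z (tsinE k)).
have [_ ss _ cs] := sum_prod k0 kQ.
have [|_ s0] := @sum_cos_sin0 k Q; first by rewrite k0/=; exact: ltnW.
rewrite ss cs s0; field; rewrite pnatr_eq0; lia.
Qed.

End Characters.

Lemma uniq_filter_singleton (T : eqType) (C : seq T) (a : pred T) (c : T) :
  uniq C -> ([seq x <- C | a x] = [:: c]) <->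
  [/\ c \in C, a c & forall c', c' \in C -> a c' -> c' = c].
Proof.
move=> uC; split=> [fE|[cC ac h]].
  have : c \in [seq x <- C | a x] by rewrite fE mem_head.
  rewrite mem_filter => /andP[ac cC]; split=> // c' c'C ac'.
  by apply/eqP; rewrite -(mem_seq1 c' c) -fE mem_filter ac'.
apply: perm_small_eq => //; apply: uniq_perm; rewrite ?filter_uniq// => c'.
rewrite mem_filter inE; apply/andP/eqP => [[ac' c'C]|->//]; exact: h.
Qed.

(** * Random placement of samples *)

Section ActiveCenters.
Variables (R : realType) (I : eqType) (Z : Type).
(* Each centre is inactive ([None]), or active and carries a sample [Some zeta]. *)
Implicit Types (y : I -> option Z) (C s : seq I).

Definition center_law (p : R) (lam : seq (R * Z)) : seq (R * option Z) :=
  (1 - p, None) :: [seq (p * w.1, Some w.2) | w <- lam].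

Definition active y c := isSome (y c).

Definition unique_sample (V : Type) C (v : I -> Z -> V) (d : V) y : V :=
  if [seq x <- C | active y x] is [:: c] then oapp (v c) d (y c) else d.

Definition inactive_off C c y : R := \prod_(c' <- C | c' != c) (~~ active y c')%:R.

(** At most one summand is nonzero, since two active centres kill each other through [inactive_off].
    In this linear form the expectation can be taken term by term. *)
Lemma unique_sample_sum C (v : I -> Z -> R) y : uniq C ->
  unique_sample C v 0 y =
  \sum_(c <- C) inactive_off C c y * oapp (v c) 0 (y c).
Proof.
move=> uC.
have zero c : c \in C -> [seq x <- C | active y x] <> [:: c] ->
    inactive_off C c y * oapp (v c) 0 (y c) = 0.
  move=> cC /(uniq_filter_singleton _ _ uC) h.
  have [yc|] := boolP (active y c); last first.
    by rewrite /active; case: (y c) => //=; rewrite mulr0.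
  have [c' c'C /andP[ac' c'c]] : exists2 c', c' \in C & active y c' && (c' != c).
    apply: contrapT => n; apply: h; split=> // c' c'C ac'.
    by apply/eqP/negP => /negP cc'; apply: n; exists c' => //; rewrite ac'.
  suff -> : inactive_off C c y = 0 by rewrite mul0r.
  by apply/eqP; rewrite prodf_seq_eq0; apply/hasP; exists c'; rewrite ?c'c ?ac'/=.
rewrite /unique_sample.
case E: [seq _ <- _ | _] => [|c [|c' l]].
- by rewrite big_seq big1// => c cC; apply: zero; rewrite ?E.
- have [cC ac cu] := (uniq_filter_singleton (active y) c uC).1 E.
  rewrite (bigD1_seq c)//= [X in _ + X]big_seq_cond [X in _ + X]big1 ?addr0.
    rewrite /inactive_off big_seq_cond big1 ?mul1r// => c' /andP[c'C c'c].
    by case: (boolP (active y c')) => // /(cu _ c'C) cc'; rewrite cc' eqxx in c'c.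
  move=> c' /andP[c'C c'c]; apply: zero => //; rewrite E => -[cc'].
  by rewrite cc' eqxx in c'c.
- by rewrite big_seq big1// => c'' cC; apply: zero; rewrite ?E.
Qed.

Variables (law : I -> seq (R * option Z)).
Hypothesis law_sum1 : forall c, \sum_(wb <- law c) wb.1 = 1.

Lemma expect_prod s (r : seq I) (phi : I -> (I -> option Z) -> R) y : uniq r ->
  (forall c, c \in r -> forall c', c' != c -> indep (phi c) c') ->
  expect law s (fun y => \prod_(c <- r) phi c y) y =
  \prod_(c <- r) expect law s (phi c) y.
Proof.
elim: r => [|c r IHr]/= => [_ _|/andP[cr ur] iphi].
  by under eq_fun do rewrite big_nil; rewrite big_nil expect_cst.
under eq_fun do rewrite big_cons.
rewrite big_cons expectM//; last first.
  move=> c' _; have [->|c'c] := eqVneq c' c; last first.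
    by left; apply: iphi; rewrite ?mem_head.
  right => t b; rewrite big_seq [RHS]big_seq; apply: eq_bigr => d dr.
  apply: iphi; first by rewrite in_cons dr orbT.
  by apply: contraNneq cr => ->.
by rewrite IHr// => c' c'r; apply: iphi; rewrite in_cons c'r orbT.
Qed.

Variables (p : R) (lam : seq (R * Z)).

Lemma expect1_active c y : \sum_(w <- lam) w.1 = 1 ->
  law c = center_law p lam ->
  expect1 law c (fun y => (active y c)%:R) y = p.
Proof.
move=> lam1 lawc; rewrite /expect1 lawc big_cons big_map/= /active /upd eqxx/=.
by rewrite mulr0 add0r; under eq_bigr do rewrite mulr1; rewrite -mulr_sumr lam1 mulr1.
Qed.

Lemma indep_coord (phi : option Z -> R) c c' : c' != c ->
  indep (fun y : I -> option Z => phi (y c)) c'.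
Proof. by move=> c'c t b; rewrite /upd eq_sym (negbTE c'c). Qed.

Lemma expect_active s c y : c \in s -> \sum_(w <- lam) w.1 = 1 ->
  law c = center_law p lam ->
  expect law s (fun y => (active y c)%:R) y = p.
Proof.
move=> cs lam1 lawc; rewrite (expect_single law_sum1 cs) ?expect1_active//.
by move=> c' c'c; apply: (@indep_coord (fun o => (isSome o)%:R)).
Qed.

(** The activity of the other centres and the sample at [c] are different coordinates, so each term
    splits into the chance that the others are silent, the rate [p], and a mean over [lam]. *)
Lemma expect_unique_sample s C (v : I -> Z -> R) y : uniq C -> {subset C <= s} ->
  \sum_(w <- lam) w.1 = 1 ->
  (forall c, c \in C -> law c = center_law p lam) ->
  expect law s (unique_sample C v 0) y =
  (1 - p) ^+ (size C).-1 * p * \sum_(c <- C) \sum_(w <- lam) w.1 * v c w.2.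
Proof.
move=> uC Cs lam1 lawC.
rewrite (_ : unique_sample C v 0 = fun y =>
    \sum_(c <- C) inactive_off C c y * oapp (v c) 0 (y c)); last first.
  by apply/funext => y'; exact: unique_sample_sum.
rewrite expect_sum mulr_sumr big_seq [RHS]big_seq; apply: eq_bigr => c cC.
have iact c' (b : bool) : c' != c -> indep (fun y : I -> option Z => oapp (v c) 0 (y c)) c'.
  by move=> c'c; exact: (@indep_coord (fun o => oapp (v c) 0 o)).
rewrite (expectM law_sum1); last first.
  move=> c' _; have [->|c'c] := eqVneq c' c; last by right; exact: (iact _ true).
  left => t b; apply: eq_bigr => d dc.
  by rewrite /active /upd (negbTE dc).
rewrite -mulrA; congr (_ * _).
  rewrite /inactive_off.
  have -> : (fun t : I -> option Z => \prod_(c' <- C | c' != c) (~~ active t c')%:R : R) =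
     (fun t => \prod_(c' <- rem c C) (~~ active t c')%:R).
    by apply/funext => t; rewrite rem_filter// big_filter.
  rewrite expect_prod ?rem_uniq//; last first.
    by move=> c1 _ c2 c21; apply: (@indep_coord (fun o => (~~ isSome o)%:R)).
  rewrite -(size_rem cC) big_seq (eq_bigr (fun=> 1 - p)); last first.
    move=> c' /mem_rem c'C.
    have -> : (fun t : I -> option Z => (~~ active t c')%:R : R) =
              (fun t => 1 + - (active t c')%:R).
      by apply/funext => t; case: (active t c'); rewrite ?subrr ?subr0.
    by rewrite expectD expectN expect_cst// expect_active ?Cs ?lawC.
  by rewrite -big_seq big_const_seq count_predT iter_mulr_1.
rewrite (expect_single law_sum1 (Cs _ cC)) => [|c' c'c]; last exact: (iact _ true).
rewrite /expect1 lawC// big_cons big_map/= /upd eqxx/= mulr0 add0r mulr_sumr.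
by apply: eq_bigr => w _; rewrite mulrA.
Qed.

End ActiveCenters.

(** * Tiling by random translates of a finite set *)

Section LocalSample.
Variables (R : realType) (G : groupType).

Definition disc : Type := {z : R * R | z.1 ^+ 2 + z.2 ^+ 2 <= 1}.

Lemma disc0_subproof : (0 : R, 0 : R).1 ^+ 2 + (0 : R, 0 : R).2 ^+ 2 <= 1.
Proof. by rewrite /= expr0n/= addr0 ler01. Qed.

Definition disc0 : disc := exist _ (0, 0) disc0_subproof.

Definition centers (K : {fset G}) (u : G) : seq G := [seq (k^-1 * u)%g | k <- K].

Lemma mem_centers K u c : (c \in centers K u) = ((u * c^-1)%g \in K).
Proof.
apply/mapP/idP => [[k kK ->]|ucK]; first by rewrite invgM invgK mulgA mulgV mul1g.
by exists (u * c^-1)%g => //; rewrite invgM invgK -mulgA mulVg mulg1.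
Qed.

Lemma centers_uniq K u : uniq (centers K u).
Proof.
rewrite map_inj_uniq ?fset_uniq// => k k' /(congr1 (fun x => x * u^-1)%g).
by rewrite -!mulgA mulgV !mulg1 => /invg_inj.
Qed.

Lemma size_centers K u : size (centers K u) = #|` K|.
Proof. by rewrite size_map. Qed.

(* Sites sharing their unique active centre [c] see one and the same sample, so
   that the site [k c] reads its value at [k]. *)
Definition zloc (K : {fset G}) (u : G) (y : G -> option (G -> disc)) : disc :=
  unique_sample (centers K u) (fun c zeta => zeta (u * c^-1)%g) disc0 y.

Lemma zloc_comp (l : disc -> R) K u y : l disc0 = 0 ->
  l (zloc K u y) =
  unique_sample (centers K u) (fun c zeta => l (zeta (u * c^-1)%g)) 0 y.
Proof.
move=> l0; rewrite /zloc /unique_sample.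
by case: [seq _ <- _ | _] => [|c []]//=; case: (y c).
Qed.

Lemma zloc_dep K u y y' : (forall c, (u * c^-1)%g \in K -> y c = y' c) ->
  zloc K u y = zloc K u y'.
Proof.
move=> yy'; rewrite /zloc /unique_sample.
have -> : [seq c <- centers K u | active y c] = [seq c <- centers K u | active y' c].
  by apply: eq_in_filter => c; rewrite mem_centers /active => /yy' ->.
case E : [seq c <- centers K u | active y' c] => [|c [|]]//.
rewrite yy'// -mem_centers.
have : c \in [seq c <- centers K u | active y' c] by rewrite E mem_head.
by rewrite mem_filter => /andP[].
Qed.

Variables (law : G -> seq (R * option (G -> disc))).
Hypothesis law_ge0 : forall c wb, List.In wb (law c) -> 0 <= wb.1.
Hypothesis law_sum1 : forall c, \sum_(wb <- law c) wb.1 = 1.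
Variables (K : {fset G}) (lam : seq (R * (G -> disc))).
Hypothesis K0 : (0 < #|` K|)%N.
Hypothesis lam_ge0 : forall w, List.In w lam -> 0 <= w.1.
Hypothesis lam_sum1 : \sum_(w <- lam) w.1 = 1.

(* With this rate exactly one of [#|K|] centres is active with probability
   [density], which stays above 1/4. *)
Definition rate : R := (#|` K|.*2%:R)^-1.

Let n := #|` K|.

Lemma rate_gt0 : 0 < rate. Proof. by rewrite invr_gt0 ltr0n double_gt0. Qed.

Lemma rateK : rate * n%:R = 2^-1.
Proof.
rewrite /rate -muln2 natrM invfM mulrAC mulVf ?mul1r//.
by rewrite pnatr_eq0 -lt0n.
Qed.

Lemma rate_le1 : rate <= 1.
Proof. by rewrite invf_le1 ?ltr0n ?double_gt0// ler1n double_gt0. Qed.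

Lemma pow_rate_le1 m : 0 <= (1 - rate) ^+ m <= 1.
Proof.
have r1 := rate_le1; have r0 := rate_gt0; rewrite exprn_ge0 ?subr_ge0//=.
by apply: exprn_ile1; lra.
Qed.

(** Bernoulli's inequality together with [rate * n = 1/2]. *)
Lemma pow_rate_ge m : (m <= n)%N -> 2^-1 <= (1 - rate) ^+ m.
Proof.
move=> mn; have r1 := rate_le1; have r0 := rate_gt0.
suff h : 1 - m%:R * rate <= (1 - rate) ^+ m.
  apply: le_trans h; have : m%:R * rate <= n%:R * rate.
    by rewrite ler_wpM2r ?ler_nat// ltW.
  rewrite [n%:R * _]mulrC rateK; lra.
elim: m {mn} => [|m IHm]; first by rewrite mul0r subr0 expr0.
rewrite exprS; have : (1 - rate) * (1 - m%:R * rate) <= (1 - rate) * (1 - rate) ^+ m.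
  by rewrite ler_wpM2l// subr_ge0.
apply: le_trans; rewrite -natr1 mulrDl mul1r.
have : 0 <= m%:R * rate * rate by rewrite !mulr_ge0// ltW.
nra.
Qed.

Definition density : R := (1 - rate) ^+ n.-1 / 2.

Lemma density_ge : 4^-1 <= density.
Proof. have := pow_rate_ge (leq_pred n); rewrite /density; lra. Qed.

(** As [c] runs over the centres of [u], [u * c^-1] runs once through [K]. The weights add up to
    [n * rate * (1 - rate) ^+ n.-1 = density], so closeness to [L] on [K] suffices. *)
Lemma expect_zloc s u (l : disc -> R) (L delta : R) y : l disc0 = 0 ->
  {subset centers K u <= s} ->
  (forall c, c \in centers K u -> law c = center_law rate lam) ->
  (forall k, k \in K -> `|\sum_(w <- lam) w.1 * l (w.2 k) - L| <= delta) ->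
  `|expect law s (fun y => l (zloc K u y)) y - density * L| <= delta.
Proof.
move=> l0 us lawC lamL.
under eq_fun do rewrite zloc_comp//.
rewrite (expect_unique_sample law_sum1 _ _ (centers_uniq K u) us lam_sum1 lawC).
rewrite size_centers -/n /density big_map.
have -> : \sum_(j <- K) \sum_(w <- lam) w.1 * l (w.2 (u * (j^-1 * u)^-1)%g) =
   \sum_(k <- K) \sum_(w <- lam) w.1 * l (w.2 k).
  by apply: eq_bigr => k _; rewrite invgM invgK mulgA mulgV mul1g.
set P := (1 - rate) ^+ _.
have -> : P / 2 * L = P * rate * \sum_(k <- K) L.
  rewrite big_const_seq count_predT iter_addr_0 -(mulr_natr L) -rateK /n; ring.
rewrite -mulrBr -sumrB normrM ger0_norm; last first.
  by rewrite mulr_ge0 ?(ltW rate_gt0)//; case/andP: (pow_rate_le1 n.-1).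
have /andP[P0 P1] := pow_rate_le1 n.-1.
have S : `|\sum_(k <- K) (\sum_(w <- lam) w.1 * l (w.2 k) - L)| <= n%:R * delta.
  apply: (le_trans (ler_norm_sum _ _ _)).
  apply: (@le_trans _ _ (\sum_(k <- K) delta)).
    by rewrite big_seq [leRHS]big_seq; apply: ler_sum => k /lamL.
  by rewrite big_const_seq count_predT iter_addr_0 -(mulr_natl delta).
apply: (@le_trans _ _ (P * rate * (n%:R * delta))).
  by rewrite ler_wpM2l// mulr_ge0 ?(ltW rate_gt0).
have d0 : 0 <= delta.
  have : (0 < size K)%N by []; case E : (enum_fset K) => [//|k l'] _.
  by apply: le_trans (lamL k _); rewrite ?normr_ge0//; change (k \in enum_fset K); rewrite E mem_head.
have -> : P * rate * (n%:R * delta) = (rate * n%:R) * (P * delta) by ring.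
have : P * delta <= delta by rewrite ler_piMl.
have : 0 <= P * delta by rewrite mulr_ge0.
rewrite rateK; lra.
Qed.

Variable q : disc -> disc -> R.
Hypothesis q_le1 : forall z z', `|q z z'| <= 1.
Hypothesis q0 : q disc0 disc0 = 0.

Definition escape (h : G) : nat := count (fun k => (h * k)%g \notin K) K.

Let vpair (w u : G) (c : G) (zeta : G -> disc) : R :=
  if (c \in centers K w) && (c \in centers K u)
  then q (zeta (w * c^-1)%g) (zeta (u * c^-1)%g) else 0.

(** The two values can differ only if some active centre serves exactly one of the sites, and then
    by at most 2. *)
Lemma zloc_pair_approx w u y :
  `|q (zloc K w y) (zloc K u y)
    - unique_sample (undup (centers K w ++ centers K u)) (vpair w u) 0 y|
  <= \sum_(c <- undup (centers K w ++ centers K u))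
       ((c \in centers K w) (+) (c \in centers K u))%:R * (2 * (active y c)%:R).
Proof.
set C := undup _; have uC : uniq C by exact: undup_uniq.
have v1 c zeta : `|vpair w u c zeta| <= 1.
  by rewrite /vpair; case: ifP => // _; rewrite normr0.
have us1 : `|unique_sample C (vpair w u) 0 y| <= 1.
  rewrite /unique_sample; case: [seq _ <- _ | _] => [|c []]; rewrite ?normr0//.
  by case: (y c) => [zeta|]/=; rewrite ?normr0.
have term0 c : 0 <= ((c \in centers K w) (+) (c \in centers K u))%:R * (2 * (active y c)%:R) :> R.
  by rewrite !mulr_ge0.
have [/hasP[c cC /andP[cx ac]]|] := boolP (has (fun c =>
    ((c \in centers K w) (+) (c \in centers K u)) && active y c) C).
  rewrite (bigD1_seq c)//= cx ac mulr1 mul1r.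
  rewrite -[leLHS]addr0; apply: lerD; last by apply: sumr_ge0.
  apply: (le_trans (ler_normB _ _)); have := q_le1 (zloc K w y) (zloc K u y).
  by move: us1; lra.
move=> /hasPn h; apply: (le_trans _ (sumr_ge0 _ (fun c _ => term0 c))).
suff -> : q (zloc K w y) (zloc K u y) = unique_sample C (vpair w u) 0 y.
  by rewrite subrr normr0.
have memC c : c \in C = (c \in centers K w) || (c \in centers K u).
  by rewrite mem_undup mem_cat.
have both c : active y c -> (c \in centers K w) = (c \in centers K u).
  move=> ac; have := h c; rewrite memC ac andbT.
  by case: (c \in _); case: (c \in _) => //= /(_ isT).
have filt v : (v == w) || (v == u) -> [seq c <- C | active y c] =i
    [seq c <- centers K v | active y c].
  move=> vwu c; rewrite !mem_filter memC.
  have [ac|//] := boolP (active y c); rewrite (both _ ac) orbb.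
  by case/orP: vwu => /eqP ->; rewrite ?both.
have perm v : (v == w) || (v == u) ->
    perm_eq [seq c <- C | active y c] [seq c <- centers K v | active y c].
  move=> /filt vE; apply: uniq_perm => //; apply: filter_uniq => //.
  exact: centers_uniq.
have pw := perm w; have pu := perm u; move: pw pu; rewrite !eqxx orbT.
move=> /(_ isT) pw /(_ isT) pu.
rewrite /zloc /unique_sample.
case E : [seq c <- C | active y c] => [|c [|c' l]].
- move: pw pu; rewrite E => /perm_size/esym/size0nil -> /perm_size/esym/size0nil ->.
  exact: q0.
- move: pw pu; rewrite E; rewrite perm_sym => /perm_small_eq -> //.
  rewrite perm_sym => /perm_small_eq -> //.
  have : c \in [seq c <- C | active y c] by rewrite E mem_head.
  rewrite mem_filter => /andP[ac]; rewrite memC (both _ ac) orbb => cu.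
  have cw : c \in centers K w by rewrite both.
  move: ac; rewrite /active; case: (y c) => //= zeta _.
  by rewrite /vpair cu cw.
- move: (perm_size pw) (perm_size pu); rewrite E.
  case: [seq c <- centers K w | active y c] => [|? []]//.
  by case: [seq c <- centers K u | active y c] => [|? []].
Qed.

Lemma count_centers_notin h u :
  count (fun c => c \notin centers K (h * u)) (centers K u) = escape h.
Proof.
rewrite /escape count_map; apply: eq_count => k /=.
by rewrite mem_centers invgM invgK -!mulgA (mulgA u) mulgV mul1g.
Qed.

Lemma sum_mem_count (T : eqType) (C A : seq T) (P : pred T) :
  uniq C -> uniq A -> {subset A <= C} ->
  \sum_(c <- C) ((c \in A) && P c)%:R = (count P A)%:R :> R.
Proof.
move=> uC uA AC; rewrite -sum1_count natr_sum (bigID (mem A))/= addrC.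
rewrite big1 ?add0r; last by move=> c /negbTE ->.
rewrite -big_filter (perm_big A); last first.
  apply: uniq_perm; rewrite ?filter_uniq// => c; rewrite mem_filter/=.
  by have [/AC|] := boolP (c \in A).
rewrite [RHS]big_mkcond/= big_seq [RHS]big_seq; apply: eq_bigr => c ->.
by case: (P c).
Qed.

Lemma sum_symdiff h u :
  \sum_(c <- undup (centers K (h * u) ++ centers K u))
     ((c \in centers K (h * u)) (+) (c \in centers K u))%:R
  = (escape h + escape h^-1)%:R :> R.
Proof.
set A := centers K _; set B := centers K u.
have eB : escape h = count (fun c => c \notin A) B by rewrite count_centers_notin.
have eA : escape h^-1 = count (fun c => c \notin B) A.
  by rewrite -(count_centers_notin h^-1 (h * u)) mulgA mulVg mul1g.
have sub D : D = A \/ D = B -> {subset D <= undup (A ++ B)}.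
  by move=> DAB c cD; rewrite mem_undup mem_cat; case: DAB => <-; rewrite cD ?orbT.
rewrite eA eB natrD -(@sum_mem_count _ (undup (A ++ B)) B) ?undup_uniq ?centers_uniq//; last first.
  by apply: sub; right.
rewrite -(@sum_mem_count _ (undup (A ++ B)) A) ?undup_uniq ?centers_uniq//; last first.
  by apply: sub; left.
rewrite -big_split/=; apply: eq_bigr => c _.
by case: (c \in A); case: (c \in B); rewrite /= ?addr0 ?add0r.
Qed.

(** If the unique active centre serves both sites, they read one sample at [h k] and [k], which
    costs at most [delta]. The centres serving a single site are counted by [escape], and each is
    active with probability [rate]; this costs [2 * rate * beta * n = beta]. *)
Lemma expect_zloc_pair s h u (delta beta : R) y :
  {subset centers K (h * u)%g <= s} -> {subset centers K u <= s} ->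
  (forall c, c \in centers K (h * u)%g \/ c \in centers K u ->
     law c = center_law rate lam) ->
  (forall k, k \in K -> (h * k)%g \in K ->
     `|\sum_(w <- lam) w.1 * q (w.2 (h * k)%g) (w.2 k)| <= delta) ->
  0 <= delta -> (escape h + escape h^-1)%:R <= beta * n%:R ->
  `|expect law s (fun y => q (zloc K (h * u) y) (zloc K u y)) y| <= delta + beta.
Proof.
move=> ws us lawC lamq d0 esc; set w := (h * u)%g in ws lawC *.
set C := undup (centers K w ++ centers K u).
have CE c : c \in C -> c \in centers K w \/ c \in centers K u.
  by rewrite mem_undup mem_cat => /orP.
have Cs : {subset C <= s} by move=> c /CE[/ws|/us].
have r0 := rate_gt0.
pose e y := q (zloc K w y) (zloc K u y) - unique_sample C (vpair w u) 0 y.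
have -> : (fun y => q (zloc K w y) (zloc K u y)) =
    (fun y => unique_sample C (vpair w u) 0 y + e y).
  by apply/funext => y'; rewrite /e addrC subrK.
rewrite expectD; apply: (le_trans (ler_normD _ _)); apply: lerD.
  rewrite (@expect_unique_sample _ _ _ _ law_sum1 rate lam s C _ y) ?undup_uniq//; last first.
    by move=> c /CE; exact: lawC.
  have /andP[P0 P1] := pow_rate_le1 (size C).-1.
  rewrite !normrM (ger0_norm P0) (gtr0_norm r0) -mulrA.
  suff S : `|\sum_(c <- C) \sum_(w0 <- lam) w0.1 * vpair w u c w0.2| <= n%:R * delta.
    have S' : rate * `|\sum_(c <- C) \sum_(w0 <- lam) w0.1 * vpair w u c w0.2| <= delta.
      apply: (le_trans (ler_wpM2l (ltW r0) S)); rewrite mulrA rateK; lra.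
    by apply: le_trans S'; rewrite ler_piMl// mulr_ge0// ltW.
  apply: (le_trans (ler_norm_sum _ _ _)).
  apply: (@le_trans _ _ (\sum_(c <- C) ((c \in centers K u) && true)%:R * delta)).
    rewrite big_seq [leRHS]big_seq; apply: ler_sum => c cC; rewrite andbT /vpair.
    have [cu|_] := boolP (c \in centers K u); last first.
      by rewrite andbF; under eq_bigr do rewrite mulr0; rewrite big1_eq normr0 mul0r.
    rewrite andbT mul1r; have [cw|ncw] := boolP (c \in centers K w); last first.
      by under eq_bigr do rewrite mulr0; rewrite big1_eq normr0.
    have := lamq (u * c^-1)%g; rewrite mulgA -/w -!mem_centers; exact.
  rewrite -mulr_suml (@sum_mem_count _ C (centers K u) predT) ?undup_uniq ?centers_uniq//.
    by rewrite count_predT size_centers.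
  by move=> c cu; rewrite mem_undup mem_cat cu orbT.
apply: (le_trans (ler_norm_expect law_ge0 _ _ _)).
apply: (le_trans (ler_expect law_ge0 _ _ (fun y' => zloc_pair_approx w u y'))).
rewrite expect_sum big_seq (eq_bigr (fun c => ((c \in centers K w) (+) (c \in centers K u))%:R * (2 * rate))).
  rewrite -big_seq -mulr_suml sum_symdiff.
  have r2 : 0 <= 2 * rate by lra.
  apply: (le_trans (ler_wpM2r r2 esc)).
  have -> : beta * n%:R * (2 * rate) = beta * (2 * (rate * n%:R)) by ring.
  rewrite rateK; lra.
move=> c cC; rewrite (expectZ _ _ _ (fun y' => 2 * (active y' c)%:R)) expectZ.
by rewrite (expect_active law_sum1 _ (Cs _ cC) lam_sum1 (lawC _ (CE _ cC))).
Qed.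

End LocalSample.

(** * Observables of a torus-valued configuration *)

Section SiteField.
Variables (R : realType) (G : groupType) (e : nat -> G) (H : set G).
Hypothesis H1 : ~ H 1%g.

(** [inl b] stands for the first character at a site, [inr (j, k, b)] for the [k]-th character of
    the difference along the shift [e j]; [b] selects cosine or sine. Countability lets the energy
    at scale [i] take the first [i] codes. *)
Definition Obs : countType := (bool + nat * nat * bool)%type.

Implicit Types (a : Obs) (u w : G) (x : G -> torus R) (z : G -> disc R).

Definition part (b : bool) (d : disc R) : R := if b then (sval d).1 else (sval d).2.

(** Real and imaginary part of [d * conj d']. *)
Definition corr (b : bool) (d d' : disc R) : R :=
  if b then part true d * part true d' + part false d * part false d'
  else part false d * part true d' - part true d * part false d'.

Definition obs_val a u x : R :=
  match a with
  | inl b => trig b 1 (x u)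
  | inr (j, k, b) =>
    if `[< H (e j) >] && (0 < k)%N then trig b k (x (e j * u)%g - x u) else 0
  end.

(** The mean of [obs_val] given the field [z]. [site_law] has Fourier coefficient [z / 2], whence
    1/2 for one site and 1/4 for the product over two; other low frequencies have mean 0. *)
Definition obs_mean a u z : R :=
  match a with
  | inl b => part b (z u) / 2
  | inr (j, k, b) =>
    if `[< H (e j) >] && (k == 1%N) then corr b (z (e j * u)%g) (z u) / 4 else 0
  end.

Definition obs_sites a u : seq G :=
  match a with inl _ => [:: u] | inr (j, _, _) => [:: (e j * u)%g; u] end.

Definition obs_freq a : nat := match a with inl _ => 1 | inr (_, k, _) => k end.

Lemma obs_val_max a u x : `|obs_val a u x| <= 1.
Proof.
by case: a => [b|[[j k] b]] /=; [|case: ifP => _; rewrite ?normr0//]; exact: trig_max.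
Qed.

Lemma obs_val_dep a u : depends (obs_val a u) (fun v => v \in obs_sites a u).
Proof.
move=> x x'; case: a => [b|[[j k] b]]/= xx'; first by rewrite xx'// mem_head.
by rewrite !xx' ?mem_head// !inE eqxx orbT.
Qed.

Variables (Q : G -> nat).
Hypothesis Q1 : forall u, (1 < Q u)%N.

Definition site_field z u : seq (R * torus R) := site_law (Q u) (sval (z u)).

Lemma site_field_ge0 z u wb : List.In wb (site_field z u) -> 0 <= wb.1.
Proof. exact: site_law_ge0 (svalP (z u)). Qed.

Lemma site_field_sum1 z u : \sum_(wb <- site_field z u) wb.1 = 1.
Proof. exact: site_law_sum1. Qed.

Lemma expect_trig z s u b k x : u \in s -> (0 < k)%N -> (k.+1 < Q u)%N ->
  expect (site_field z) s (fun x => trig b k (x u)) x =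
  (k == 1%N)%:R * (part b (z u) / 2).
Proof.
move=> us k0 kQ; rewrite (expect_single (site_field_sum1 z) us); last first.
  by move=> u' u'u t c; rewrite /upd eq_sym (negbTE u'u).
rewrite /expect1; under eq_bigr do rewrite /upd eqxx.
by case: b; rewrite /trig/= ?site_law_tcos ?site_law_tsin.
Qed.

Lemma expect_obs z s a u x : {subset obs_sites a u <= s} ->
  (forall v, v \in obs_sites a u -> ((obs_freq a).+1 < Q v)%N) ->
  expect (site_field z) s (obs_val a u) x = obs_mean a u z.
Proof.
case: a => [b|[[j k] b]]/= sub frq.
  by rewrite (expect_trig _ b) ?mul1r ?sub ?frq ?mem_head.
rewrite (_ : obs_val (inr (j, k, b)) u = fun x =>
  if `[< H (e j) >] && (0 < k)%N then trig b k (x (e j * u)%g - x u) else 0)//.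
have [Hj|nHj] := boolP `[< H (e j) >]; last by rewrite expect_cst//; exact: site_field_sum1.
have [k0|] := boolP (0 < k)%N; last first.
  by rewrite -eqn0Ngt => /eqP ->; rewrite expect_cst//; exact: site_field_sum1.
set w := (e j * u)%g in sub frq *.
(* Since the identity is not in [H], the two sites differ and their values are independent. *)
have wu : w != u.
  apply: contra_notN H1 => /eqP wu; move/asboolP: Hj.
  by rewrite -(mulgK u (e j)) -/w wu mulgV.
have ws : w \in s by apply: sub; rewrite mem_head.
have us : u \in s by apply: sub; rewrite !inE eqxx orbT.
have kw : (k.+1 < Q w)%N by apply: frq; rewrite mem_head.
have ku : (k.+1 < Q u)%N by apply: frq; rewrite !inE eqxx orbT.
have prod b1 b2 : expect (site_field z) s (fun x => trig b1 k (x w) * trig b2 k (x u)) x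
    = (k == 1%N)%:R * (part b1 (z w) * part b2 (z u) / 4).
  rewrite (expectM (site_field_sum1 z)).
    by rewrite !expect_trig//; case: (k == 1%N); rewrite ?mul0r// !mul1r; field.
  move=> c _; have [->|cw] := eqVneq c w.
    by right => t d; rewrite /upd eq_sym (negbTE wu).
  by left => t d; rewrite /upd eq_sym (negbTE cw).
rewrite /=; case: b.
  under eq_fun do rewrite [trig _ _ _]tcosB.
  rewrite expectD (prod true true) (prod false false) /corr.
  by case: (k == 1%N); rewrite /= ?mul0r ?mul1r ?addr0//; field.
under eq_fun do rewrite [trig _ _ _]tsinB.
rewrite expectD expectN (prod false true) (prod true false) /corr.
by case: (k == 1%N); rewrite /= ?mul0r ?mul1r ?oppr0 ?addr0//; field.
Qed.

Lemma expect_obs_pair z s a u a' u' (c c' : R) x :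
  {subset obs_sites a u <= s} -> {subset obs_sites a' u' <= s} ->
  (forall v, v \in obs_sites a u -> ((obs_freq a).+1 < Q v)%N) ->
  (forall v, v \in obs_sites a' u' -> ((obs_freq a').+1 < Q v)%N) ->
  (forall v, v \in obs_sites a u -> v \notin obs_sites a' u') ->
  expect (site_field z) s
    (fun x => (obs_val a u x - c) * (obs_val a' u' x - c')) x =
  (obs_mean a u z - c) * (obs_mean a' u' z - c').
Proof.
move=> sub sub' frq frq' dis.
have ind b v d : v \notin obs_sites b d ->
    forall r, indep (fun x => obs_val b d x - r) v.
  move=> vn r t q; congr (_ - _); apply: obs_val_dep => i ib.
  by rewrite /upd; case: eqP => // iv; rewrite -iv ib in vn.
rewrite (expectM (site_field_sum1 z)); last first.
  move=> v _; have [/dis v'|vn] := boolP (v \in obs_sites a u); last by left; exact: ind.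
  by right; exact: ind.
by rewrite !(expectD, expectN) !expect_cst ?expect_obs//; exact: site_field_sum1.
Qed.

End SiteField.

(** * The multiscale random field *)

Section FsetProduct.
Variable G : groupType.
Implicit Types A B : {fset G}.

Definition fmul A B : {fset G} := [fset (x * y)%g | x in A, y in B]%fset.
Definition finv A : {fset G} := [fset x^-1%g | x in A]%fset.

Lemma mem_fmul A B x y : x \in A -> y \in B -> (x * y)%g \in fmul A B.
Proof. by move=> xA yB; apply/imfset2P; exists x => //; exists y. Qed.

Lemma fmulP A B z : reflect (exists x y, [/\ x \in A, y \in B & z = (x * y)%g]) (z \in fmul A B).
Proof.
apply: (iffP idP) => [/imfset2P[x xA [y yB ->]]|[x [y [xA yB ->]]]].
  by exists x, y.
exact: mem_fmul.
Qed.

Lemma mem_finv A x : (x \in finv A) = (x^-1%g \in A).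
Proof.
apply/imfsetP/idP => [[y yA ->]|xA]; first by rewrite invgK.
by exists x^-1%g => //; rewrite invgK.
Qed.
End FsetProduct.

Definition upto i (a : Obs) : Prop := exists2 n, (n < i)%N & choice.unpickle n = Some a.

Section MultiscaleField.
Variables (R : realType) (G : groupType) (e : nat -> G) (H : set G).
Variables (K S L : nat -> {fset G}) (lam : nat -> seq (R * (G -> disc R))).
Variables (Qn : nat -> nat) (C : bool -> R) (delta beta : nat -> R) (lev : G -> nat).
Hypothesis H1 : ~ H 1%g.
Hypothesis K_gt0 : forall i, (0 < #|` K i|)%N.
Hypothesis S1 : forall i, 1%g \in S i.
Hypothesis S_mono : forall i j, (i <= j)%N -> (S i `<=` S j)%fset.
Hypothesis S_K : forall i k, k \in K i -> k^-1%g \in S i.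
Hypothesis S_obs : forall i a u v, upto i.+1 a -> v \in obs_sites e a u ->
  (v * u^-1)%g \in S i.
Hypothesis S_L : forall i s l, s \in S i -> l \in L i -> (s * l)^-1%g \in S i.+1.
Hypothesis Qn_gt1 : forall i, (1 < Qn i)%N.
Hypothesis Qn_obs : forall i a, upto i.+1 a -> ((obs_freq a).+1 < Qn i)%N.
Hypothesis C_max : forall b, `|C b| <= 1.
Hypothesis delta_ge0 : forall i, 0 <= delta i.
Hypothesis beta_ge0 : forall i, 0 <= beta i.
Hypothesis delta_beta : forall i, delta i + beta i <= i.+1%:R^-1.
Hypothesis lam_ge0 : forall i w, List.In w (lam i) -> 0 <= w.1.
Hypothesis lam_sum1 : forall i, \sum_(w <- lam i) w.1 = 1.
Hypothesis lam_mean : forall i b k, k \in K i ->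
  `|\sum_(w <- lam i) w.1 * part b (w.2 k) - C b| <= delta i.
Hypothesis lam_corr : forall i h b k, H h -> k \in K i -> (h * k)%g \in K i ->
  `|\sum_(w <- lam i) w.1 * corr b (w.2 (h * k)%g) (w.2 k)| <= delta i.
Hypothesis K_escape : forall i j k b, upto i.+1 (inr (j, k, b)) -> H (e j) ->
  (escape (K i) (e j) + escape (K i) (e j)^-1)%:R <= beta i * #|` K i|%:R.

(** [SS i] contains the displacements from [l g] to every centre its observables depend on, [W i] is
    the window of the averaged energy, and points [l g], [l' g] with [l * l'^-1] outside [NN i] see
    disjoint [SS i]-neighbourhoods. *)
Definition SS i := fmul (S i) (S i).
Definition W i := fmul (SS i) (L i).
Definition NN i := fmul (finv (SS i)) (SS i).
Hypothesis L_near : forall i, (4 * i.+1 ^ 2 * #|` NN i| <= #|` L i|)%N.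

(* [deep u]: a whole neighbourhood of [u] lives on the same scale as [u]. *)
Definition deep (u : G) : bool := all (fun s => lev (s * u)%g == lev u) (S (lev u)).

(** The value 0 near a change of level makes the site uniform, so that no correlation arises between
    sites of different levels. *)
Definition zfield (y : G -> option (G -> disc R)) (u : G) : disc R :=
  if deep u then zloc (K (lev u)) u y else disc0 R.

Definition center_field c := center_law (rate R (K (lev c))) (lam (lev c)).

Definition Qs u := Qn (lev u).

(** [density] is the probability of reading a sample at all, [C b] the mean of a sample, and 1/2 the
    Fourier coefficient of [site_law]. *)
Definition target (a : Obs) (u : G) : R :=
  match a with
  | inl b => if deep u then density R (K (lev u)) * C b / 2 else 0
  | inr _ => 0
  end.

Definition obs_dev a u x : R := obs_val e H a u x - target a u.

Definition obs_avg i a g x : R := (\sum_(l <- L i) obs_dev a (l * g)%g x) / #|` L i|%:R.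

Definition obs_energy i g x : R :=
  \sum_(n < i) if choice.unpickle n is Some a then obs_avg i a g x ^+ 2 else 0.

(** Sites [s l g] of level above [i] are not deep ([deep_site]), so the field vanishes there and
    only the scales [i.-1] and [i] act on the observables. *)
Definition on_scale i g : Prop :=
  (lev g <= i)%N /\ forall w, w \in W i -> (i.-1 <= lev (w * g)%g)%N.

Lemma deepP u s : deep u -> s \in S (lev u) -> lev (s * u)%g = lev u.
Proof. by move=> /allP du /du /eqP. Qed.

Lemma SSl i s : s \in S i -> s \in SS i.
Proof. by move=> sS; rewrite -(mulg1 s) mem_fmul. Qed.

Lemma center_field_ge0 c wb : List.In wb (center_field c) -> 0 <= wb.1.
Proof.
have r0 := rate_gt0 R (K_gt0 (lev c)); have r1 := rate_le1 R (K_gt0 (lev c)).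
rewrite /center_field /center_law => -[<-|]/=; first by rewrite subr_ge0.
have := @lam_ge0 (lev c); elim: (lam _) => //= w l IHl lw [<-|/IHl]/=.
  by rewrite mulr_ge0 ?(ltW r0)//; apply: lw; left.
by apply => w' w'l; apply: lw; right.
Qed.

Lemma center_field_sum1 c : \sum_(wb <- center_field c) wb.1 = 1.
Proof.
by rewrite /center_field /center_law big_cons big_map/= -mulr_sumr lam_sum1 mulr1 subrK.
Qed.

Lemma target_max a u : `|target a u| <= 1.
Proof.
case: a => [b|a]/=; rewrite ?normr0//; case: ifP => _; rewrite ?normr0//.
have /andP[p0 p1] := pow_rate_le1 R (K_gt0 (lev u)) (#|` K (lev u)|).-1.
have d0 : 0 <= density R (K (lev u)) by rewrite /density divr_ge0.
have d1 : density R (K (lev u)) <= 1 by rewrite /density; lra.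
set d := density _ _ in d0 d1 *.
rewrite normrM normrM (ger0_norm d0) [X in _ * X]gtr0_norm ?invr_gt0//.
have : d * `|C b| <= 1 by rewrite mulr_ile1.
have : 0 <= d * `|C b| by rewrite mulr_ge0.
lra.
Qed.

Lemma obs_dev_max a u x : `|obs_dev a u x| <= 2.
Proof.
apply: (le_trans (ler_normB _ _)).
have := obs_val_max e H a u x; have := target_max a u; lra.
Qed.

Section Window.
Variables (i : nat) (g : G).
Hypothesis good_g : on_scale i g.

Lemma lev_site s l : s \in S i -> l \in L i -> (i.-1 <= lev (s * (l * g))%g)%N.
Proof.
by move=> sS lL; rewrite mulgA; apply: good_g.2; apply: mem_fmul => //; exact: SSl.
Qed.

(* The next scale is [S_(i+1)]-separated from the points of level at most [i]. *)
Lemma deep_site s l : s \in S i -> l \in L i -> deep (s * (l * g))%g ->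
  (lev (s * (l * g)) <= i)%N.
Proof.
move=> sS lL dw; rewrite leqNgt; apply/negP => ilw.
have := deepP dw (fsubsetP (S_mono ilw) _ (S_L sS lL)).
rewrite [X in (_ * X)%g]mulgA mulKg => lg.
by have := good_g.1; rewrite lg leqNgt ilw.
Qed.

Variable a : Obs.
Hypothesis a_upto : upto i a.

Lemma obs_site_shift u v : v \in obs_sites e a u ->
  exists2 s, s \in S i & v = (s * u)%g.
Proof.
move=> vu; exists (v * u^-1)%g; last by rewrite -mulgA mulVg mulg1.
by apply: S_obs vu; case: a_upto => n ni na; exists n => //; exact: ltnW.
Qed.

Lemma upto_lev b : (i.-1 <= b)%N -> upto b.+1 a.
Proof. by move=> ib; have [n ni na] := a_upto; exists n => //; lia. Qed.

Lemma zfield_dep s l y y' : s \in S i -> l \in L i ->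
  (forall c, (c * (l * g)^-1)%g \in SS i -> y c = y' c) ->
  zfield y (s * (l * g))%g = zfield y' (s * (l * g))%g.
Proof.
move=> sS lL yy'; rewrite /zfield; case: ifP => // dw.
apply: zloc_dep => c cK; apply: yy'.
have -> : (c * (l * g)^-1 = (s * (l * g) * c^-1)^-1 * s)%g.
  by rewrite !invgM !invgK -!mulgA mulVg mulg1.
apply: mem_fmul => //; apply: (fsubsetP (S_mono (deep_site sS lL dw))).
exact: S_K.
Qed.

Lemma obs_mean_dep l y y' : l \in L i ->
  (forall c, (c * (l * g)^-1)%g \in SS i -> y c = y' c) ->
  obs_mean e H a (l * g)%g (zfield y) = obs_mean e H a (l * g)%g (zfield y').
Proof.
move=> lL yy'.
have zE v : v \in obs_sites e a (l * g)%g -> zfield y v = zfield y' v.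
  by move=> /obs_site_shift[s sS ->]; exact: zfield_dep.
move: zE; case: a => [b|[[j k] b]] zE /=; first by rewrite zE// mem_head.
by rewrite !zE// !inE eqxx ?orbT.
Qed.

End Window.

Lemma corr_le1 b (d d' : disc R) : `|corr b d d'| <= 1.
Proof.
case: d d' => [[x y] /= xy] [[x' y'] /= xy']; rewrite /corr /part/= ler_norml.
have h1 := sqr_ge0 (x + x'); have h2 := sqr_ge0 (x - x').
have h3 := sqr_ge0 (y + y'); have h4 := sqr_ge0 (y - y').
have h5 := sqr_ge0 (x + y'); have h6 := sqr_ge0 (x - y').
have h7 := sqr_ge0 (y + x'); have h8 := sqr_ge0 (y - x').
by case: b; apply/andP; split; nra.
Qed.

Lemma corr0l b d : corr b (disc0 R) d = 0.
Proof. by rewrite /corr /part/=; case: b; rewrite !mul0r ?subrr ?addr0. Qed.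

Lemma corr0r b d : corr b d (disc0 R) = 0.
Proof. by rewrite /corr /part/=; case: b; rewrite !mulr0 ?subrr ?addr0. Qed.

(** Hence all centres seen by a deep site follow one and the same law. *)
Lemma deep_center u c : deep u -> c \in centers (K (lev u)) u -> lev c = lev u.
Proof.
move=> du; rewrite mem_centers => /S_K; rewrite invgM invgK => /(deepP du).
by rewrite -mulgA mulVg mulg1.
Qed.

(** At a site that is not deep, both the field and the target vanish. For a correlation of two deep
    sites the shift lies in [S], so they have one level and share tile and sample law. *)
Lemma expect_mean i g a l s y : on_scale i g -> upto i a -> l \in L i ->
  (forall c, (c * (l * g)^-1)%g \in SS i -> c \in s) ->
  `|expect center_field s (fun y => obs_mean e H a (l * g)%g (zfield y)) y
    - target a (l * g)%g| <= i%:R^-1.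
Proof.
move=> gg ua lL cs; have i0 : (0 < i)%N by case: ua => n; case: (i).
(* Every level in the window is at least [i.-1], where the error is at most [1 / i]. *)
have epsi j : (i.-1 <= j)%N -> delta j + beta j <= i%:R^-1.
  move=> ij; apply: (le_trans (delta_beta j)).
  by rewrite lef_pV2 ?posrE ?ltr0n// ler_nat; lia.
have cent v : v \in obs_sites e a (l * g)%g -> deep v ->
    {subset centers (K (lev v)) v <= s}.
  move=> /(obs_site_shift ua)[t tS vE] dv c; rewrite mem_centers => cK; apply: cs.
  have -> : (c * (l * g)^-1 = (v * c^-1)^-1 * t)%g.
    by rewrite vE !invgM !invgK -!mulgA mulVg mulg1.
  apply: mem_fmul => //; apply: (fsubsetP (S_mono _)) (S_K cK).
  by rewrite vE deep_site// -vE.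
have levv v : v \in obs_sites e a (l * g)%g -> (i.-1 <= lev v)%N.
  by move=> /(obs_site_shift ua)[t tS ->]; exact: lev_site.
set u := (l * g)%g in cs cent levv *.
have law v : deep v -> forall c, c \in centers (K (lev v)) v ->
    center_field c = center_law (rate R (K (lev v))) (lam (lev v)).
  by move=> dv c cv; rewrite /center_field (deep_center dv cv).
case: a ua cent levv => [b|[[j k] b]]/= ua cent levv.
  rewrite /zfield; have [du|du] := boolP (deep u); last first.
    have -> : (fun y : G -> option (G -> disc R) => part b (disc0 R) / 2) = fun=> 0.
      by apply/funext => _; case: b {ua}; rewrite /part/= mul0r.
    by rewrite expect_cst ?subr0 ?normr0 ?invr_ge0//; exact: center_field_sum1.
  under eq_fun do rewrite mulrC.
  rewrite expectZ mulrC -mulrBl normrM [X in _ * X]gtr0_norm ?invr_gt0//.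
  have ul : u \in [:: u] by rewrite mem_head.
  have := @expect_zloc _ _ _ center_field_sum1 _ _ (K_gt0 (lev u)) (lam_sum1 (lev u))
    s u (part b) (C b) (delta (lev u)) y.
  move=> /(_ _ (cent _ ul du) (law _ du) (fun k kK => lam_mean b kK)) h.
  have {}h := h (_ : part b (disc0 R) = 0).
  have {}h := h ltac:(by case: (b)).
  have := epsi _ (levv _ ul); have := beta_ge0 (lev u); have := delta_ge0 (lev u); lra.
rewrite subr0; set w := (e j * u)%g in cent levv *.
have iV : 0 <= i%:R^-1 :> R by rewrite invr_ge0.
have [Hj|_] := boolP `[< H (e j) >]; last first.
  by rewrite expect_cst ?normr0//; exact: center_field_sum1.
have [k1|_] := boolP (k == 1%N); last first.
  by rewrite expect_cst ?normr0//; exact: center_field_sum1.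
rewrite /zfield/=.
have [du|du] := boolP (deep u); last first.
  under eq_fun do rewrite corr0r mul0r.
  by rewrite expect_cst ?normr0//; exact: center_field_sum1.
have [dw|dw] := boolP (deep w); last first.
  under eq_fun do rewrite corr0l mul0r.
  by rewrite expect_cst ?normr0//; exact: center_field_sum1.
have wl : w \in [:: w; u] by rewrite mem_head.
have ul : u \in [:: w; u] by rewrite !inE eqxx orbT.
have eS : e j \in S (lev u).
  have := @S_obs (lev u) (inr (j, k, b)) u w (upto_lev ua (levv _ ul)) wl.
  by rewrite /w -mulgA mulgV mulg1.
have lw : lev w = lev u by exact: deepP.
rewrite lw; under eq_fun do rewrite mulrC.
rewrite expectZ normrM gtr0_norm ?invr_gt0//.
have cw := cent _ wl dw; have law_w := law _ dw; rewrite lw in cw law_w.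
have := @expect_zloc_pair _ _ _ center_field_ge0 center_field_sum1 _ _ (K_gt0 (lev u))
   (lam_sum1 (lev u)) (corr b) (corr_le1 b) _ s (e j) u (delta (lev u)) (beta (lev u)) y
   cw (cent _ ul du).
move=> /(_ (corr0l b _)) h.
have {}h := h _ _ (delta_ge0 _) (K_escape (upto_lev ua (levv _ ul)) _).
have {}h := h (fun c cc => match cc with or_introl c1 => law_w _ c1 | or_intror c2 => law _ du _ c2 end).
have {}h := h (fun k kK hkK => lam_corr b (asboolW Hj) kK hkK) (asboolW Hj).
have := epsi _ (levv _ ul); have := beta_ge0 (lev u); have := delta_ge0 (lev u).
have := normr_ge0 (expect center_field s (fun y => corr b (zloc (K (lev u)) w y) (zloc (K (lev u)) u y)) y).
move: h; rewrite -/w; lra.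
Qed.

Section RandomSite.
Variables (X : {fset G}) (x0 : G -> torus R).

Let y0 : G -> option (G -> disc R) := fun=> None.

(** Two stages: the samples at the centres, then the site values given the samples. Outside [X]
    centres are inactive and sites keep the values of [x0]. *)
Definition field_expect (phi : (G -> torus R) -> R) : R :=
  expect center_field X
    (fun y => expect (site_field Qs (zfield y)) X phi x0) y0.

Lemma field_expect_sum (J : Type) (r : seq J) (phi : J -> (G -> torus R) -> R) :
  field_expect (fun x => \sum_(j <- r) phi j x) = \sum_(j <- r) field_expect (phi j).
Proof.
rewrite /field_expect -(congr1 (@^~ y0) (expect_sum _ _ _ _)) /=.
by congr (expect _ _ _ _); apply/funext => y; rewrite expect_sum.
Qed.

Lemma field_expectZ c phi : field_expect (fun x => c * phi x) = c * field_expect phi.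
Proof.
rewrite /field_expect -(congr1 (@^~ y0) (expectZ _ _ _ _)) /=.
by congr (expect _ _ _ _); apply/funext => y; rewrite expectZ.
Qed.

Lemma field_expect_le c phi : (forall x, phi x <= c) -> field_expect phi <= c.
Proof.
move=> pc; rewrite -[leRHS](congr1 (@^~ y0) (expect_cst center_field_sum1 X c)).
apply: (ler_expect center_field_ge0) => y.
have s1 := site_field_sum1 (fun u => Qn_gt1 (lev u)) (zfield y).
rewrite -[leRHS](congr1 (@^~ x0) (expect_cst s1 X c)).
apply: ler_expect => //; exact: site_field_ge0.
Qed.

(** The field changes only the weights of [site_law], never its atoms; the list for [(0, 0)] is
    therefore an alphabet independent of the samples. *)
Lemma field_expect_ge c phi :
  (forall x, (forall v, v \notin X -> x v = x0 v) ->
     (forall v, v \in X -> x v \in [seq wb.2 | wb <- site_law (Qs v) (0, 0)]) ->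
     c <= phi x) -> c <= field_expect phi.
Proof.
move=> pc; apply: (expect_ge center_field_ge0 center_field_sum1) => y _ _.
apply: (expect_ge (@site_field_ge0 _ _ _ _) (site_field_sum1 _ _)) => [u|x xX xA].
  exact: Qn_gt1.
apply: pc => // v vX; have [w] := xA v vX.
rewrite /site_field /site_law; elim: (index_iota _ _) => //= q r IHr [[_ <-]|/IHr].
  by rewrite mem_head.
by rewrite in_cons orbC => ->.
Qed.

Variables (i : nat) (g : G).
Hypothesis good_g : on_scale i g.
Hypothesis WX : forall w, w \in W i -> (w * g)%g \in X.

Lemma SSX s l : s \in SS i -> l \in L i -> (s * (l * g))%g \in X.
Proof. by move=> sS lL; rewrite mulgA; apply/WX/mem_fmul. Qed.

(** Given the field, the two observables live on disjoint sites and are independent; their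
    conditional means depend on disjoint sets of centres. So the expectation is a product of two
    biases, each at most [1 / i]. *)
Lemma dev_cov a l l' : upto i a -> l \in L i -> l' \in L i ->
  (l * l'^-1)%g \notin NN i ->
  field_expect (fun x => obs_dev a (l * g)%g x * obs_dev a (l' * g)%g x) <= i%:R^-1 ^+ 2.
Proof.
move=> ua lL l'L far.
have siteX k : k \in L i -> {subset obs_sites e a (k * g)%g <= X}.
  by move=> kL v /(obs_site_shift ua)[s sS ->]; apply: SSX => //; exact: SSl.
have frq k v : k \in L i -> v \in obs_sites e a (k * g)%g -> ((obs_freq a).+1 < Qs v)%N.
  move=> kL /(obs_site_shift ua)[s sS ->]; apply: Qn_obs.
  exact: (upto_lev ua (lev_site good_g sS kL)).
have farS s s' : s \in SS i -> s' \in SS i -> (s * (l * g) != s' * (l' * g))%g.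
  move=> sS s'S; apply: contra far => /eqP ss'.
  have -> : (l * l'^-1 = s^-1 * s')%g.
    have : (s * l = s' * l')%g.
      by apply: (can_inj (mulgK g)); rewrite -!mulgA.
    move=> /(congr1 (fun x => s^-1 * x * l'^-1)%g).
    by rewrite mulKg => ->; rewrite -!mulgA mulgV mulg1.
  by apply: mem_fmul => //; rewrite mem_finv invgK.
rewrite /field_expect /obs_dev.
have dis v : v \in obs_sites e a (l * g)%g -> v \notin obs_sites e a (l' * g)%g.
  move=> /(obs_site_shift ua)[s sS vE]; apply/negP => /(obs_site_shift ua)[s' s'S].
  by rewrite vE => /eqP; apply/negP/farS; exact: SSl.
under eq_fun do rewrite (expect_obs_pair H1 (fun u => Qn_gt1 (lev u)) _ _ _ _ (siteX _ lL)
  (siteX _ l'L) (fun v => frq _ v lL) (fun v => frq _ v l'L) dis).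
have dp k : k \in L i -> depends
   (fun y => obs_mean e H a (k * g)%g (zfield y) - target a (k * g)%g)
   (fun c => (c * (k * g)^-1)%g \in SS i).
  by move=> kL y y' yy'; congr (_ - _); apply: (obs_mean_dep good_g ua kL).
rewrite (expectM center_field_sum1); last first.
  move=> c _; have [cl|cl] := boolP ((c * (l * g)^-1)%g \in SS i); last first.
    by left; apply: (depends_indep (dp _ lL)); exact/negP.
  right; apply: (depends_indep (dp _ l'L)) => cl'.
  have := farS _ _ cl cl'; rewrite -!mulgA.
  by rewrite !mulVg !mulg1 eqxx.
rewrite !expectD !expect_cst; [|exact: center_field_sum1..].
apply: (le_trans (ler_norm _)); rewrite normrM expr2.
have cX k c : k \in L i -> (c * (k * g)^-1)%g \in SS i -> c \in X.
  by move=> kL cS; have := SSX cS kL; rewrite -mulgA mulVg mulg1.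
by apply: ler_pM => //; apply: (expect_mean _ good_g ua) => // c; exact: cX.
Qed.

Lemma count_near (l' : G) : (count (fun l => (l * l'^-1)%g \in NN i) (L i) <= #|` NN i|)%N.
Proof.
rewrite -size_filter -(size_map (fun l => l * l'^-1)%g); apply: uniq_leq_size.
  rewrite map_inj_uniq ?filter_uniq ?fset_uniq// => x y; exact: (can_inj (mulgK _)).
by move=> x /mapP[l]; rewrite mem_filter => /andP[lN _] ->.
Qed.

(** Second moment bound. By [L_near], pairs within [NN i] form at most a proportion [1 / (4 i^2)]
    and count at most 4 each; the other pairs obey [dev_cov]. Each kind contributes [1 / i^2]. *)
Lemma field_expect_avg a : upto i a ->
  field_expect (fun x => obs_avg i a g x ^+ 2) <= 2 * i%:R^-1 ^+ 2.
Proof.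
move=> ua; set n : R := #|` L i|%:R.
have i0 : (0 < i)%N by case: ua => m mi _; exact: leq_ltn_trans mi.
have Ln : (0 < #|` L i|)%N.
  apply: leq_trans (L_near i); rewrite muln_gt0; apply/andP; split=> //.
  rewrite cardfs_gt0.
  apply/fset0Pn; exists (1^-1 * 1)%g; apply: mem_fmul; rewrite ?mem_finv ?invgK.
    exact: SSl.
  exact: SSl.
have n0 : 0 < n by rewrite ltr0n.
have -> : (fun x => obs_avg i a g x ^+ 2) = (fun x => n ^- 2 *
    \sum_(l <- L i) \sum_(l' <- L i) (obs_dev a (l' * g)%g x * obs_dev a (l * g)%g x)).
  apply/funext => x; rewrite /obs_avg expr_div_n mulrC; congr (_ * _); rewrite expr2 mulr_sumr.
  by apply: eq_bigr => l _; rewrite mulr_suml.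
rewrite field_expectZ ler_pdivrMl ?exprn_gt0// field_expect_sum.
apply: (@le_trans _ _ (\sum_(l <- L i) (4 * #|` NN i|%:R + n * i%:R^-1 ^+ 2))).
  rewrite big_seq [leRHS]big_seq; apply: ler_sum => l lL.
  rewrite field_expect_sum.
  apply: (@le_trans _ _ (\sum_(l' <- L i) (4 * ((l' * l^-1)%g \in NN i)%:R + i%:R^-1 ^+ 2))).
    rewrite big_seq [leRHS]big_seq; apply: ler_sum => l' l'L.
    have [nr|fr] := boolP ((l' * l^-1)%g \in NN i); last first.
      by rewrite mulr0 add0r; exact: dev_cov.
    rewrite mulr1; apply: (@le_trans _ _ 4); last by rewrite lerDl exprn_ge0.
    apply: field_expect_le => x; apply: (le_trans (ler_norm _)); rewrite normrM.
    have -> : (4 : R) = 2 * 2 by ring.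
    by apply: ler_pM => //; exact: obs_dev_max.
  rewrite big_split/= -mulr_sumr; apply: lerD.
    rewrite ler_wpM2l// -natr_sum ler_nat; apply: leq_trans (count_near l).
    by rewrite -sum1_count [leqRHS]big_mkcond/=; apply: leq_sum => l' _; case: (_ \in _).
  by rewrite big_const_seq count_predT iter_addr_0 -(mulr_natl (i%:R^-1 ^+ 2)).
rewrite big_const_seq count_predT iter_addr_0 -(mulr_natl _ #|` L i|) -/n.
have near : 4 * i%:R ^+ 2 * #|` NN i|%:R <= n :> R.
  rewrite -natrX -!natrM ler_nat; apply: leq_trans (L_near i).
  by rewrite leq_mul2r leq_mul2l leq_exp2r// leqnSn !orbT.
have i0' : 0 < i%:R :> R by rewrite ltr0n.
have : 4 * #|` NN i|%:R <= n * i%:R^-1 ^+ 2.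
  by rewrite exprVn ler_pdivlMr ?exprn_gt0// mulrAC.
move=> h; rewrite expr2 -mulrA ler_pM2l//; lra.
Qed.

(** At most [i] observables contribute [2 / i^2] each; at [i = 0] both sides are 0 because
    [0^-1 = 0]. *)
Lemma field_expect_energy : field_expect (obs_energy i g) <= 2 * i%:R^-1.
Proof.
rewrite /obs_energy field_expect_sum.
apply: (@le_trans _ _ (\sum_(n < i) 2 * i%:R^-1 ^+ 2)).
  apply: ler_sum => n _; case E : (choice.unpickle _) => [a|].
    by apply: field_expect_avg; exists n.
  by apply: field_expect_le => _; rewrite mulr_ge0// exprn_ge0.
rewrite big_const_ord iter_addr_0 -(mulr_natl (2 * i%:R^-1 ^+ 2)).
have [->|i0] := posnP i; first by rewrite mul0r invr0 mulr0.
rewrite le_eqVlt; apply/orP; left; apply/eqP; field.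
by rewrite pnatr_eq0 -lt0n.
Qed.

End RandomSite.

Lemma obs_energy_dep i g x x' : (forall w, w \in W i -> x (w * g)%g = x' (w * g)%g) ->
  obs_energy i g x = obs_energy i g x'.
Proof.
move=> xx'; apply: eq_bigr => n _; case E : (choice.unpickle _) => [a|]//.
have ua : upto i a by exists n.
congr ((_ / _) ^+ 2); rewrite big_seq [RHS]big_seq; apply: eq_bigr => l lL.
congr (_ - _); apply: obs_val_dep => v /(obs_site_shift ua)[s sS ->].
by rewrite mulgA xx'//; apply: mem_fmul => //; exact: SSl.
Qed.

(** First moment method: if every configuration exceeded the bound, so would the mean. The extra 1
    makes the contradiction strict. *)
Lemma exists_low_energy (X : {fset G}) (x0 : G -> torus R) (P : seq (nat * G)) :
  (forall p, p \in P -> on_scale p.1 p.2 /\ forall w, w \in W p.1 -> (w * p.2)%g \in X) ->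
  exists x, [/\ forall v, v \notin X -> x v = x0 v,
    forall v, v \in X -> x v \in [seq wb.2 | wb <- site_law (Qs v) (0, 0)] &
    \sum_(p <- P) obs_energy p.1 p.2 x <= \sum_(p <- P) 2 * p.1%:R^-1 + 1].
Proof.
move=> PX; apply: contrapT => h.
have : \sum_(p <- P) 2 * p.1%:R^-1 + 1 <= field_expect X x0
    (fun x => \sum_(p <- P) obs_energy p.1 p.2 x).
  apply: field_expect_ge => x xX xA; rewrite leNgt; apply/negP => lt.
  by apply: h; exists x; split=> //; exact: ltW.
rewrite field_expect_sum leNgt => /negP; apply.
apply: (@le_lt_trans _ _ (\sum_(p <- P) 2 * p.1%:R^-1)); last by rewrite ltrDl.
rewrite big_seq [leRHS]big_seq; apply: ler_sum => p /PX[gp pX].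
exact: field_expect_energy.
Qed.

End MultiscaleField.

(** * Følner sequences and scales *)

Section FolnerFacts.
Variables (R : realType) (G : groupType) (F : nat -> {fset G}).
Hypothesis G_infinite : infinite_set [set: G].
Hypothesis F_folner : folner R F.

Lemma folner_gt0 N : (0 < #|` F N|)%N.
Proof. by rewrite cardfs_gt0; exact: F_folner.1. Qed.

Lemma escape_le (A : {fset G}) g :
  (escape A g <= #|` ([fset (g * x)%g | x in A] `\` A)%fset|)%N.
Proof.
rewrite /escape -size_filter -(size_map (fun x => g * x)%g); apply: uniq_leq_size.
  by rewrite map_inj_uniq ?filter_uniq ?fset_uniq//; exact: mulgI.
move=> y /mapP[x]; rewrite mem_filter => /andP[gx xA] ->.
change ((g * x)%g \in ([fset (g * x)%g | x in A] `\` A)%fset).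
by rewrite inE gx/=; apply/imfsetP; exists x.
Qed.

(** The Følner limit in integer form, uniform over finitely many shifts, so that later comparisons
    of sizes stay in [nat]. *)
Lemma folner_escape (c : nat) (A : seq G) : exists M, forall N, (M <= N)%N ->
  forall g, g \in A -> (c * escape (F N) g <= #|` F N|)%N.
Proof.
elim: A => [|g A [M IHM]]; first by exists 0%N.
have [_ /(_ g)/cvgr0Pnorm_lt/(_ c.+1%:R^-1)] := F_folner.
rewrite invr_gt0 ltr0n => /(_ isT)[M' _ M'P].
exists (maxn M M') => N; rewrite geq_max => /andP[MN M'N] h.
rewrite in_cons => /orP[/eqP ->|]; last exact: IHM.
have /= := M'P _ M'N; rewrite ger0_norm ?divr_ge0//.
have F0 : (0 < #|` F N|%:R :> R) by rewrite ltr0n folner_gt0.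
rewrite ltr_pdivrMr// mulrC ltr_pdivlMr ?ltr0n// => /ltW.
rewrite -natrM ler_nat; apply: leq_trans.
rewrite mulnC leq_mul//; apply: leq_trans (escape_le _ _) _.
exact/fsubset_leq_card/fsubsetUl.
Qed.

Lemma infinite_fset (n : nat) : exists A : {fset G}, 1%g \in A /\ (n <= #|` A|)%N.
Proof.
have [A _ An] := @infinite_set_fset _ setT n G_infinite.
exists (1%g |` A)%fset; split; first by rewrite !inE eqxx.
by apply: leq_trans An _; apply/fsubset_leq_card/fsubsetUr.
Qed.

(** If [F N] had fewer than [n] elements, the factor [n.+1] would force every escape count for [g]
    in [A] to be 0. Then [A f] lies in [F N] for any [f] in [F N], which is too small for it. *)
Lemma folner_card (n : nat) : exists M, forall N, (M <= N)%N -> (n <= #|` F N|)%N.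
Proof.
have [A [_ An]] := infinite_fset n.
have [M MP] := folner_escape n.+1 A.
exists M => N /MP h; rewrite leqNgt; apply/negP => Fn.
have : (#|` F N| < #|` A|)%N by exact: leq_trans An.
have /fset0Pn[f fF] := F_folner.1 N.
have inv g : g \in A -> (g * f)%g \in F N.
  move=> /h e; apply/negPn/negP => gf.
  have : (0 < escape (F N) g)%N by rewrite /escape -has_count; apply/hasP; exists f.
  by nia.
have : ([fset (g * f)%g | g in A] `<=` F N)%fset.
  by apply/fsubsetP => _ /imfsetP[g gA ->]; exact: inv.
move=> /fsubset_leq_card; rewrite card_imfset//=; last exact: mulIg.
by rewrite leqNgt => /negbTE ->.
Qed.

Definition bdry (V A : {fset G}) : {fset G} :=
  [fset g in fmul (finv V) A | ~~ all (fun v => (v * g)%g \in A) V]%fset.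

Lemma mem_bdry (V A : {fset G}) g v : v \in V -> (v * g)%g \in A ->
  ~~ all (fun v => (v * g)%g \in A) V -> g \in bdry V A.
Proof.
move=> vV vg nall; rewrite !inE/= nall andbT.
by rewrite -[g](mulKg v) mem_fmul// mem_finv invgK.
Qed.

(** A boundary point is [v^-1 f] with [f] in [A], and some [v'] moves it out of [A]; so [f] escapes
    under [v' * v^-1]. *)
Lemma card_bdry (V A : {fset G}) :
  (#|` bdry V A| <= \sum_(v <- V) \sum_(v' <- V) escape A (v' * v^-1)%g)%N.
Proof.
pose T := flatten [seq flatten [seq [seq (v^-1 * f)%g | f <- A & (v' * v^-1 * f)%g \notin A]
  | v' <- V] | v <- V].
have -> : (\sum_(v <- V) \sum_(v' <- V) escape A (v' * v^-1)%g)%N = size T.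
  rewrite /T size_flatten sumnE /shape -map_comp big_map; apply: eq_bigr => v _ /=.
  rewrite size_flatten sumnE /shape -map_comp big_map; apply: eq_bigr => v' _ /=.
  by rewrite size_map size_filter.
apply: uniq_leq_size; first exact: fset_uniq.
move=> g; change (g \in bdry V A -> g \in T); rewrite !inE/= => /andP[gVA].
rewrite -has_predC => /hasP[v' v'V /= v'g].
case/fmulP: gVA => u [f [uV fA gE]]; rewrite mem_finv in uV.
apply/flattenP; exists (flatten [seq [seq (u * f)%g | f <- A & (v' * u * f)%g \notin A] | v' <- V]).
  by apply/mapP; exists u^-1%g => //; rewrite invgK.
apply/flattenP; exists [seq (u * f)%g | f <- A & (v' * u * f)%g \notin A].
  by apply/mapP; exists v'.
by apply/mapP; exists f => //; rewrite mem_filter -mulgA -gE v'g.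
Qed.

Lemma folner_bdry (c : nat) (V : {fset G}) : exists M, forall N, (M <= N)%N ->
  (c * #|` bdry V (F N)| <= #|` F N|)%N.
Proof.
have [M MP] := folner_escape (c * (size V * size V)) [seq (v' * v^-1)%g | v <- V, v' <- V].
exists M => N /MP h; have [V0|V0] := posnP (size V * size V).
  have -> : bdry V (F N) = fset0; last by rewrite cardfs0 muln0.
  apply/fsetP => g; rewrite !inE/=; case: fmulP => //= -[u [f [uV _ _]]].
  rewrite mem_finv in uV; move: V0 => /eqP; rewrite muln_eq0 orbb => /eqP/size0nil V0.
  by move: uV; rewrite -topredE/= V0.
have := card_bdry V (F N).
have : (\sum_(v <- V) \sum_(v' <- V) (c * (size V * size V)) * escape (F N) (v' * v^-1)%g
   <= \sum_(v <- V) \sum_(v' <- V) #|` F N|)%N.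
  rewrite big_seq [leqRHS]big_seq; apply: leq_sum => v vV.
  rewrite big_seq [leqRHS]big_seq; apply: leq_sum => v' v'V.
  by apply: h; apply/allpairsP; exists (v, v').
under eq_bigr do rewrite -big_distrr/=.
rewrite -big_distrr/= !big_const_seq !count_predT !iter_addn_0.
move=> h1 h2; rewrite -(leq_pmul2l V0); apply: leq_trans (leq_trans h1 _).
  by rewrite mulnCA mulnA leq_mul2l h2 orbT.
by rewrite -mulnA [leqLHS]mulnC.
Qed.

End FolnerFacts.

(** * Assignment of levels to the elements of the group *)

Section Levels.
Variables (R : realType) (G : groupType) (F : nat -> {fset G}).
Hypothesis G_infinite : infinite_set [set: G].
Hypothesis F_folner : folner R F.
Variables (S L W : nat -> {fset G}).
Hypothesis S_exhaust : forall g, exists i0, forall i, (i0 <= i)%N -> g \in S i.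

(** [E] will be the set of lower levels. The conditions make boundaries of windows, translations by
    [L i], and the neighbourhoods of [E] negligible in [F N]. In the energy estimate the cube pays
    for the number of scales, for the maximal energy of a window, and for a final factor [1 / i]. *)
Definition levcond i (E : {fset G}) N : Prop :=
  [/\ forall j, (j <= i.+1)%N -> (i.+1 ^ 3 * #|` bdry (W j) (F N)| <= #|` F N|)%N,
      forall l, l \in L i -> (i.+1 * escape (F N) l <= #|` F N|)%N &
      (i.+1 ^ 3 * (#|` W i| + #|` S i| + 1) * (#|` E| + 1) <= #|` F N|)%N].

Lemma levcond_ex i E : exists M, forall N, (M <= N)%N -> levcond i E N.
Proof.
have [M1 M1P] : exists M, forall N, (M <= N)%N -> forall j, (j <= i.+1)%N ->
    (i.+1 ^ 3 * #|` bdry (W j) (F N)| <= #|` F N|)%N.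
  elim: i.+1 (i.+1 ^ 3)%N => [|n IHn] c.
    have [M MP] := folner_bdry F_folner c (W 0); exists M => N MN j.
    by rewrite leqn0 => /eqP ->; exact: MP.
  have [M MP] := folner_bdry F_folner c (W n.+1); have [M' M'P] := IHn c.
  exists (maxn M M') => N; rewrite geq_max => /andP[MN M'N] j.
  by rewrite leq_eqVlt => /orP[/eqP ->|]; [exact: MP|exact: M'P].
have [M2 M2P] := folner_escape F_folner i.+1 (L i).
have [M3 M3P] := folner_card G_infinite F_folner
  (i.+1 ^ 3 * (#|` W i| + #|` S i| + 1) * (#|` E| + 1)).
exists (maxn M1 (maxn M2 M3)) => N; rewrite !geq_max => /and3P[N1 N2 N3].
by split; [exact: M1P|exact: M2P|exact: M3P].
Qed.

(** [E i.+1] adds to [E i] the [S i.+1]-neighbourhoods of all [F N] with [N <= M i.+1], where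
    [M i.+1] is so large that later [F N] dwarf [E i]. Level [i] is [E i.+1] without [E i]; for [N]
    between [M i.+1] and [M i.+2] nearly all of [F N] has level [i] or [i.+1]. *)
Lemma levels_exist : exists (lev : G -> nat) (E : nat -> {fset G}) (M : nat -> nat),
  [/\ forall g i, (g \in E i) = (lev g < i)%N,
      forall i, (M i < M i.+1)%N,
      forall i N, (M i.+1 <= N)%N -> levcond i.+1 (E i) N &
      forall i N s x, (N <= M i.+1)%N -> s \in S i.+1 -> x \in F N ->
        (lev (s * x)%g <= i)%N].
Proof.
have [f fP] := choice (fun p : nat * {fset G} => levcond_ex p.1 p.2).
pose next i (p : {fset G} * nat) := let m := maxn p.2.+1 (f (i.+1, p.1)) in
  ((p.1 `|` \bigcup_(N <- iota 0 m.+1) fmul (S i.+1) (F N))%fset, m).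
pose st := fix st i := if i is j.+1 then next j (st j) else (fset0, 0%N).
pose E i := (st i).1; pose M i := (st i).2.
have E_S i : (E i `<=` E i.+1)%fset by exact: fsubsetUl.
have E_mono i j : (i <= j)%N -> (E i `<=` E j)%fset.
  elim: j => [|j IHj]; first by rewrite leqn0 => /eqP ->.
  rewrite leq_eqVlt => /orP[/eqP -> //|ij]; exact: fsubset_trans (IHj ij) (E_S j).
have E_F i N s x : (N <= M i.+1)%N -> s \in S i.+1 -> x \in F N -> (s * x)%g \in E i.+1.
  move=> NM sS xF.
  have -> : E i.+1 = (E i `|` \bigcup_(N <- iota 0 (M i.+1).+1) fmul (S i.+1) (F N))%fset by [].
  rewrite inE; apply/orP; right.
  by apply/bigfcupP; exists N; [rewrite mem_iota add0n ltnS NM|exact: mem_fmul].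
have E_ex g : exists i, g \in E i.
  have /fset0Pn[x xF] := F_folner.1 0%N.
  have [i iP] := S_exhaust (g * x^-1)%g.
  exists i.+1; have -> : g = (g * x^-1 * x)%g by rewrite -mulgA mulVg mulg1.
  by apply: (@E_F i 0%N) => //; apply: iP.
have /choice[lev levP] : forall g, exists n, forall i, (g \in E i) = (n < i)%N.
  move=> g; case: (ex_minnP (E_ex g)) => -[|m] gE gm; first by rewrite inE in gE.
  exists m => i; apply/idP/idP; last by move=> /E_mono/fsubsetP/(_ _ gE).
  exact: gm.
exists lev, E, M; split=> //.
- by move=> i; rewrite /M /= leq_max leqnn.
- by move=> i N MN; apply: (fP (i.+1, E i)); apply: leq_trans MN; rewrite /M/= leq_max leqnn orbT.
- by move=> i N s x NM sS xF; rewrite -ltnS -levP; exact: E_F NM sS xF.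
Qed.

End Levels.

Lemma sum_le_card (R : realType) (T : eqType) (s t : seq T) (f : T -> R) (c : R) :
  uniq s -> {subset s <= t} -> (forall x, x \in s -> f x <= c) -> 0 <= c ->
  \sum_(x <- s) f x <= c * (size t)%:R.
Proof.
move=> us st fc c0; apply: (@le_trans _ _ (c * (size s)%:R)).
  rewrite mulr_natr -[c *+ _]iter_addr_0 -count_predT -big_const_seq.
  by rewrite big_seq [leRHS]big_seq; apply: ler_sum.
by rewrite ler_wpM2l// ler_nat; exact: uniq_leq_size.
Qed.

(** Terms with [l g] in [A] cancel against the terms they are moved to. The matched parts have equal
    size, so [escape A l] terms remain on either side. *)
Lemma translate_sum (R : realType) (G : groupType) (A : {fset G}) (l : G)
    (phi : G -> R) (c : R) : (forall u, `|phi u| <= c) ->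
  `|\sum_(g <- A) phi (l * g)%g - \sum_(g <- A) phi g| <= 2 * c * (escape A l)%:R.
Proof.
move=> phic.
have c0 : 0 <= c by apply: le_trans (phic 1%g).
pose a g := (l * g)%g \in A; pose b u := (l^-1 * u)%g \in A.
have E : \sum_(g <- A | a g) phi (l * g)%g = \sum_(u <- A | b u) phi u.
  rewrite -big_filter -[RHS]big_filter -(big_map (fun g => l * g)%g xpredT phi).
  apply: perm_big; apply: uniq_perm; first last.
  - move=> u; rewrite mem_filter; apply/mapP/andP => [[g]|[bu uA]].
      by rewrite mem_filter => /andP[ag gA] ->; rewrite /b mulKg.
    by exists (l^-1 * u)%g; rewrite ?mulVKg// mem_filter /a mulVKg uA; exact: bu.
  - by rewrite filter_uniq ?fset_uniq.
  - by rewrite map_inj_uniq ?filter_uniq ?fset_uniq//; exact: mulgI.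
have sz : count (predC b) A = count (predC a) A.
  apply/eqP; rewrite -(eqn_add2l (count b A)) count_predC.
  have -> : count b A = count a A; last by rewrite count_predC.
  rewrite -!sum1_count; apply/eqP; rewrite -(eqr_nat R) !natr_sum; apply/eqP.
  rewrite -big_filter -[RHS]big_filter -[RHS](big_map (fun g => l * g)%g xpredT (fun=> 1)).
  apply: perm_big; apply: uniq_perm; first last.
  - move=> u; rewrite mem_filter; apply/andP/mapP => [[bu uA]|[g]].
      by exists (l^-1 * u)%g; rewrite ?mulVKg// mem_filter /a mulVKg uA; exact: bu.
    by rewrite mem_filter => /andP[ag gA] ->; rewrite /b mulKg.
  - by rewrite map_inj_uniq ?filter_uniq ?fset_uniq//; exact: mulgI.
  - by rewrite filter_uniq ?fset_uniq.
have bound (P : pred G) (psi : G -> R) : (forall u, `|psi u| <= c) ->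
    `|\sum_(g <- A | P g) psi g| <= c * (count P A)%:R.
  move=> psic; apply: (le_trans (ler_norm_sum _ _ _)).
  apply: (@le_trans _ _ (\sum_(g <- A | P g) c)); first by apply: ler_sum.
  by rewrite big_const_seq iter_addr_0 mulr_natr.
rewrite (bigID a)/= [X in _ - X](bigID b)/= E opprD addrACA subrr add0r.
apply: (le_trans (ler_normB _ _)).
have h1 := bound (predC a) (fun g => phi (l * g)%g) (fun g => phic _).
have h2 := bound (predC b) phi phic.
rewrite sz in h2; have -> : 2 * c * (escape A l)%:R =
  c * (count (predC a) A)%:R + c * (count (predC a) A)%:R by rewrite /escape; ring.
exact: lerD.
Qed.

(** * Derandomization *)

Section Derandomize.
Variables (R : realType) (G : groupType) (F : nat -> {fset G}).
Hypothesis F_folner : folner R F.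
Variables (B : eqType) (A : G -> seq B) (a0 : G -> B).
Variables (dev : nat -> G -> (G -> B) -> R) (S L W : nat -> {fset G}).
Variables (lev : G -> nat) (E : nat -> {fset G}) (M : nat -> nat).
Hypothesis a0A : forall g, a0 g \in A g.
Hypothesis dev_max : forall n u x, `|dev n u x| <= 2.
Hypothesis L1 : forall i, 1%g \in L i.
Hypothesis W1 : forall i, 1%g \in W i.
Hypothesis S1 : forall i, 1%g \in S i.

Definition avg i n g x : R := (\sum_(l <- L i) dev n (l * g)%g x) / #|` L i|%:R.
Definition energy i g x : R := \sum_(n < i) avg i n g x ^+ 2.
Definition good i g : Prop :=
  (lev g <= i)%N /\ forall w, w \in W i -> (i.-1 <= lev (w * g)%g)%N.

Hypothesis energy_dep : forall i g x x',
  (forall w, w \in W i -> x (w * g)%g = x' (w * g)%g) -> energy i g x = energy i g x'.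
Hypothesis exists_low_energy : forall (X : {fset G}) (x0 : G -> B) (P : seq (nat * G)),
  (forall p, p \in P -> good p.1 p.2 /\ forall w, w \in W p.1 -> (w * p.2)%g \in X) ->
  exists x, [/\ forall v, v \notin X -> x v = x0 v,
    forall v, v \in X -> x v \in A v &
    \sum_(p <- P) energy p.1 p.2 x <= \sum_(p <- P) 2 * p.1%:R^-1 + 1].
Hypothesis levP : forall g i, (g \in E i) = (lev g < i)%N.
Hypothesis M_lt : forall i, (M i < M i.+1)%N.
Hypothesis M_cond : forall i N, (M i.+1 <= N)%N -> levcond F S L W i.+1 (E i) N.
Hypothesis F_lev : forall i N s x, (N <= M i.+1)%N -> s \in S i.+1 -> x \in F N ->
  (lev (s * x)%g <= i)%N.

Lemma energy_ge0 i g x : 0 <= energy i g x.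
Proof. by apply: sumr_ge0 => n _; exact: sqr_ge0. Qed.

Lemma avg_max i n g x : `|avg i n g x| <= 2.
Proof.
have L0 : (0 < #|` L i|%:R :> R) by rewrite ltr0n cardfs_gt0; apply/fset0Pn; exists 1%g.
rewrite /avg normrM [X in _ * X]gtr0_norm ?invr_gt0//.
rewrite ler_pdivrMr//; apply: (le_trans (ler_norm_sum _ _ _)).
apply: (@le_trans _ _ (\sum_(l <- L i) 2)); first by apply: ler_sum => l _; exact: dev_max.
by rewrite big_const_seq count_predT iter_addr_0 mulr_natr.
Qed.

Lemma energy_max i g x : energy i g x <= 4 * i%:R.
Proof.
apply: (@le_trans _ _ (\sum_(n < i) 4)).
  by apply: ler_sum => n _; have := avg_max i n g x; rewrite ler_norml => /andP[h1 h2]; nra.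
by rewrite big_const_ord iter_addr_0 mulr_natr.
Qed.

Let gb (p : nat * G) : bool := `[< good p.1 p.2 >].
(** Without the cut to good windows, windows of arbitrarily large scale would meet a given site. *)
Let Psi (p : nat * G) x : R := if gb p then energy p.1 p.2 x else 0.
Let Wp (p : nat * G) : {fset G} :=
  if gb p then [fset (w * p.2)%g | w in W p.1]%fset else fset0.
Let grid (m : nat) : {fset nat * G} := [fset p in [seq (j, g) | j <- iota 0 m, g <- E m]]%fset.

Lemma mem_grid m j g : ((j, g) \in grid m) = (j < m)%N && (lev g < m)%N.
Proof.
rewrite !inE/= -levP; apply/allpairsP/andP => [[[j' g'] /= [jm gE [-> ->]]]|[jm gE]].
  by rewrite mem_iota/= in jm.
by exists (j, g); rewrite /= mem_iota.
Qed.

(** Local finiteness: a good window through [v] has scale at most [lev v + 1], and the level of its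
    base point is at most its scale. *)
Lemma window_grid m p v : v \in Wp p -> (lev v < m)%N ->
  [/\ gb p, p \in grid m.+1 & exists2 w, w \in W p.1 & v = (w * p.2)%g].
Proof.
rewrite /Wp; case: ifP => // gp /imfsetP[w /= wW ->] lm.
have [l1 /(_ _ wW) l2] := asboolW gp; split=> //; last by exists w.
by case: p gp wW lm l1 l2 => j g /= *; rewrite mem_grid; apply/andP; split; lia.
Qed.

Lemma fset_lev_bound (X : {fset G}) : exists m, forall v, v \in X -> (lev v < m)%N.
Proof.
exists (\max_(v <- X) lev v).+1 => v vX; rewrite ltnS.
by rewrite (big_rem v)//= leq_maxl.
Qed.

Lemma exists_ground_state : exists t, (forall g, t g \in A g) /\
  forall (X : {fset G}) (U : {fset nat * G}) (t' : G -> B),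
    (forall p v, v \in Wp p -> v \in X -> p \in U) ->
    (forall v, v \notin X -> t' v = t v) -> (forall v, v \in X -> t' v \in A v) ->
    \sum_(p <- U) Psi p t <= \sum_(p <- U) Psi p t' + 1.
Proof.
apply: (@ground_state R G (nat * G)%type B E A a0) => //.
- by move=> g; exists (lev g).+1 => n; rewrite levP.
- by move=> p t; rewrite /Psi; case: ifP => // _; exact: energy_ge0.
- move=> p t t'; rewrite /Psi /Wp; case: ifP => // _ tt'; apply: energy_dep => w wW.
  by apply: tt'; apply/imfsetP; exists w.
- move=> X; have [m mP] := fset_lev_bound X; exists (grid m.+1) => p v vW vX.
  by have [] := window_grid vW (mP _ vX).
Qed.

Variable t : G -> B.
Hypothesis t_ground : forall (X : {fset G}) (U : {fset nat * G}) (t' : G -> B),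
  (forall p v, v \in Wp p -> v \in X -> p \in U) ->
  (forall v, v \notin X -> t' v = t v) -> (forall v, v \in X -> t' v \in A v) ->
  \sum_(p <- U) Psi p t <= \sum_(p <- U) Psi p t' + 1.

(** The ground state is compared with a configuration changed only inside [F N]. After
    multiplication by [i], windows inside [F N] cost 8 times its size (6 for scales [i] and above, 2
    for the lower ones), the two slacks 2 and the boundary 8; this is below 20. *)
Lemma ground_energy i N : (0 < i)%N -> (M i.+1 <= N)%N -> (N < M i.+2)%N ->
  \sum_(g <- F N | gb (i.+1, g)) energy i.+1 g t <= 20 / i%:R * #|` F N|%:R.
Proof.
move=> i0 MN NM; set X := F N; set f : R := #|` X|%:R.
have levX v : v \in X -> (lev v < i.+2)%N.
  by move=> vX; rewrite ltnS -[v]mul1g; apply: (F_lev (ltnW NM)).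
pose touch (p : nat * G) := has (fun w => (w * p.2)%g \in X) (W p.1).
pose inside (p : nat * G) := all (fun w => (w * p.2)%g \in X) (W p.1).
pose U := [fset p in grid i.+3 | gb p && touch p]%fset.
have UE p : (p \in U) = [&& p \in grid i.+3, gb p & touch p] by rewrite !inE.
have Ucov p v : v \in Wp p -> v \in X -> p \in U.
  move=> vW vX; have [gp pg [w wW vE]] := window_grid vW (levX _ vX).
  by rewrite UE pg gp; apply/hasP; exists w => //; rewrite -vE.
have uU : uniq (U : seq _) := fset_uniq U.
pose P := [seq p <- U | inside p].
have PP p : p \in P -> [/\ good p.1 p.2, p \in grid i.+3 & forall w, w \in W p.1 -> (w * p.2)%g \in X].
  rewrite mem_filter => /andP[/allP ip pU]; have := pU; rewrite -/(p \in U) => pU'.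
  have : p \in U by exact: pU.
  by rewrite UE => /and3P[pg /asboolP gp _]; split.
(* Low energy is available only for good windows contained in [F N], the ones collected in [P]. *)
have [t' [t'X t'A low]] := exists_low_energy t (fun p pP => let: And3 a _ b := PP p pP in conj a b).
have gs := t_ground Ucov t'X t'A.
have f0 : 0 <= f by rewrite ler0n.
have [cbdry _ ccard] := M_cond MN.
have fcard c : (c <= i.+2 ^ 3 * (#|` W i.+1| + #|` S i.+1| + 1) * (#|` E i| + 1))%N -> c%:R <= f.
  by move=> h; rewrite ler_nat; exact: leq_trans h ccard.
have j0 : 0 < i%:R :> R by rewrite ltr0n.
have jE : i.+2%:R = i%:R + 2 :> R by rewrite -addn2 natrD.
(* The good windows inside [F N] at the scales i, i+1, i+2, and all lower ones. *)
have SP : \sum_(p <- P) 2 * p.1%:R^-1 <= 2 * i%:R^-1 * (3 * f) + 2 * (i.+1 * #|` E i|)%:R.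
  rewrite (bigID (fun p : nat * G => (i <= p.1)%N))/=; apply: lerD.
    rewrite -big_filter.
    have [T TE] : exists T, T = [seq (j, g) | j <- iota i 3, g <- X] by eexists.
    have -> : 3 * f = (size T)%:R by rewrite TE size_allpairs size_iota natrM.
    apply: sum_le_card; rewrite ?filter_uniq//.
    - move=> [j g]; rewrite mem_filter => /andP[/= ij jP].
      have [_ jg jW] := PP _ jP; rewrite TE; apply: allpairs_f.
        by move: jg; rewrite mem_grid mem_iota => /andP[]; lia.
      by have := jW _ (W1 j); rewrite mul1g.
    - move=> [j g]; rewrite mem_filter => /andP[/= ij _].
      rewrite ler_pM2l// lef_pV2 ?posrE ?ltr0n ?ler_nat//; exact: leq_trans ij.
  rewrite -big_filter.
  have [T TE] : exists T, T = [seq (j, g) | j <- iota 0 i.+1, g <- E i] by eexists.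
  have -> : (i.+1 * #|` E i|)%:R = (size T)%:R :> R.
    by rewrite TE size_allpairs size_iota.
  apply: sum_le_card; rewrite ?filter_uniq//.
  - move=> [j g]; rewrite mem_filter => /andP[/=]; rewrite -ltnNge => ij jP.
    have [[lg _] _ _] := PP _ jP; rewrite TE; apply: allpairs_f.
      by rewrite mem_iota/= add0n ltnS ltnW.
    by change (g \in E i); rewrite levP; exact: leq_ltn_trans lg ij.
  (* At scale 0 the term is 0, because [0^-1 = 0]. *)
  - move=> [[|j] g] _ /=; first by rewrite invr0 mulr0.
    by rewrite ler_piMr// invf_le1 ?ltr0n// ler1n.
(* A window across the boundary of [F N] gets the trivial bound on its energy; such windows are rare
   by [levcond]. *)
have Sout : \sum_(p <- U | ~~ inside p) Psi p t' <= 4 * i.+2%:R * (\sum_(j < i.+3) #|` bdry (W j) X|)%:R.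
  rewrite -big_filter.
  have [T TE] : exists T, T = flatten [seq [seq (j, g) | g <- bdry (W j) X] | j <- iota 0 i.+3].
    by eexists.
  have -> : (\sum_(j < i.+3) #|` bdry (W j) X|)%N = size T.
    rewrite TE size_flatten sumnE /shape -map_comp big_map -[iota 0 _]/(index_iota 0 i.+3) big_mkord.
    by apply: eq_bigr => j _ /=; rewrite size_map.
  apply: sum_le_card; rewrite ?filter_uniq//.
  - move=> [j g]; rewrite mem_filter => /andP[ng jU].
    have : (j, g) \in U by exact: jU.
    rewrite UE mem_grid => /and3P[/andP[ji _] _ /hasP[w wW wX]].
    rewrite TE; apply/flattenP; exists [seq (j, g) | g <- bdry (W j) X].
      by apply/mapP; exists j; rewrite ?mem_iota.
    by apply/mapP; exists g => //; exact: mem_bdry wW wX ng.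
  - move=> [j g]; rewrite mem_filter => /andP[_ jU].
    have : (j, g) \in U by exact: jU.
    rewrite UE mem_grid => /and3P[/andP[ji _] gp _].
    rewrite /Psi gp/=; apply: (le_trans (energy_max _ _ _)).
    by rewrite ler_pM2l// ler_nat.
have Sbd : (i.+2 ^ 3)%:R * (\sum_(j < i.+3) #|` bdry (W j) X|)%:R <= i.+3%:R * f.
  rewrite -natrM -[_ * f]natrM ler_nat big_distrr/=.
  apply: (@leq_trans (\sum_(j < i.+3) #|` X|)); first by
    apply: leq_sum => j _; apply: cbdry; rewrite -ltnS; exact: ltn_ord.
  by rewrite sum_nat_const card_ord.
have low' : \sum_(p <- U) Psi p t' <= \sum_(p <- P) 2 * p.1%:R^-1 + 1 +
    4 * i.+2%:R * (\sum_(j < i.+3) #|` bdry (W j) X|)%:R.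
  rewrite (bigID inside)/=; apply: lerD => //; apply: le_trans low.
  rewrite -big_filter -/P big_seq [leRHS]big_seq; apply: ler_sum => p pP.
  by rewrite /Psi; case: ifP => // _; exact: energy_ge0.
(* The good windows of scale [i.+1] based in [F N] all belong to [U], because [W] contains 1. *)
apply: (@le_trans _ _ (\sum_(p <- U) Psi p t)).
  have -> : \sum_(g <- X | gb (i.+1, g)) energy i.+1 g t =
      \sum_(p <- [seq (i.+1, g) | g <- X & gb (i.+1, g)]) Psi p t.
    rewrite big_map big_filter; apply: eq_bigr => g gg; by rewrite /Psi gg.
  rewrite [leRHS](bigID (mem [seq (i.+1, g) | g <- X & gb (i.+1, g)]))/=.
  rewrite -[leLHS]addr0; apply: lerD; last first.
    by apply: sumr_ge0 => p _; rewrite /Psi; case: ifP => // _; exact: energy_ge0.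
  rewrite -[leRHS]big_filter le_eqVlt; apply/orP; left; apply/eqP; apply: perm_big.
  apply: uniq_perm; rewrite ?filter_uniq//.
    by rewrite map_inj_uniq ?filter_uniq ?fset_uniq// => x y [].
  move=> p; rewrite mem_filter; apply/idP/andP => [pX|[]//]; split=> //.
  move: pX => /mapP[g]; rewrite mem_filter => /andP[gg gX] ->.
  change ((i.+1, g) \in U); rewrite UE gg mem_grid (ltn_trans (levX _ gX))//.
  have -> : (i.+1 < i.+3)%N by rewrite !ltnS leqnSn.
  by apply/hasP; exists 1%g; [exact: W1|rewrite /= mul1g].
apply: (le_trans gs); apply: (@le_trans _ _ ((\sum_(p <- P) 2 * p.1%:R^-1 + 1 +
    4 * i.+2%:R * (\sum_(j < i.+3) #|` bdry (W j) X|)%:R) + 1)); first by rewrite lerD2r.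
set b : R := (\sum_(j < i.+3) _)%:R in Sbd *.
set eE : R := (i.+1 * #|` E i|)%:R in SP *.
have b1 : i%:R * (4 * i.+2%:R * b) <= 8 * f.
  have b0 : 0 <= b by rewrite ler0n.
  move: Sbd; rewrite natrX -[i.+3]addn1 natrD jE => h.
  have p2 : 0 < i%:R + 2 :> R by lra.
  have h2 : (i%:R + 2) ^+ 2 * b <= 2 * f.
    rewrite -(ler_pM2l p2) mulrA -exprS; apply: (le_trans h).
    by rewrite mulrA ler_wpM2r//; lra.
  have h3 : i%:R * ((i%:R + 2) * b) <= (i%:R + 2) ^+ 2 * b.
    by rewrite mulrA expr2 ler_wpM2r// ler_wpM2r// ?lerDl// ltW.
  have -> : i%:R * (4 * (i%:R + 2) * b) = 4 * (i%:R * ((i%:R + 2) * b)) by ring.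
  lra.
have i3 : (i * i.+1 <= i.+2 ^ 3)%N.
  rewrite expnS; apply: leq_mul; first by rewrite -addn2 leq_addr.
  by rewrite (leq_trans (leqnSn _))// expnS leq_pmulr// expn_gt0.
have i3' : (i * i.+1 <= i.+2 ^ 3 * (#|` W i.+1| + #|` S i.+1| + 1))%N.
  by apply: leq_trans i3 _; rewrite leq_pmulr// addn1.
have e1 : i%:R * eE <= f.
  by rewrite -natrM; apply: fcard; rewrite mulnA leq_mul// leq_addr.
have o1 : i%:R <= f.
  apply: fcard; apply: leq_trans (leq_trans i3' _); first by rewrite leq_pmulr.
  by rewrite leq_pmulr// addn1.
have -> : 20 / i%:R * #|` X|%:R = 20 * f / i%:R by rewrite mulrAC.
rewrite ler_pdivlMr//.
have -> : (\sum_(p <- P) 2 * p.1%:R^-1 + 1 + 4 * i.+2%:R * b + 1) * i%:R =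
   i%:R * (\sum_(p <- P) 2 * p.1%:R^-1) + 2 * i%:R + i%:R * (4 * i.+2%:R * b) by ring.
have : i%:R * (\sum_(p <- P) 2 * p.1%:R^-1) <= 6 * f + 2 * (i%:R * eE).
  apply: (le_trans (ler_wpM2l (ltW j0) SP)).
  rewrite mulrDr le_eqVlt; apply/orP; left; apply/eqP; field; lra.
lra.
Qed.

(** Averaging over [L] replaces [F N] by its translates; each costs 4 times an escape count, as
    deviations are bounded by 2. *)
Lemma sum_avg_close n i N : (M i.+1 <= N)%N ->
  `|\sum_(u <- F N) dev n u t - \sum_(g <- F N) avg i.+1 n g t|
  <= 4 / i.+2%:R * #|` F N|%:R.
Proof.
move=> MN; set X := F N; set f : R := #|` X|%:R.
have [_ cesc _] := M_cond MN.
have L0 : 0 < #|` L i.+1|%:R :> R.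
  by rewrite ltr0n cardfs_gt0; apply/fset0Pn; exists 1%g.
have -> : \sum_(u <- X) dev n u t - \sum_(g <- X) avg i.+1 n g t =
   (\sum_(l <- L i.+1) (\sum_(u <- X) dev n u t - \sum_(g <- X) dev n (l * g)%g t))
     / #|` L i.+1|%:R.
  rewrite sumrB mulrBl; congr (_ - _).
    rewrite big_const_seq count_predT iter_addr_0 -(mulr_natr (\sum_(u <- X) dev n u t)).
    by rewrite mulfK// gt_eqF.
  by rewrite exchange_big/= mulr_suml.
rewrite normrM [X in _ * X]gtr0_norm ?invr_gt0// ler_pdivrMr//.
apply: (le_trans (ler_norm_sum _ _ _)).
apply: (@le_trans _ _ (\sum_(l <- L i.+1) (4 / i.+2%:R * f))); last first.
  by rewrite big_const_seq count_predT iter_addr_0 -(mulr_natr (4 / i.+2%:R * f)).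
rewrite big_seq [leRHS]big_seq; apply: ler_sum => l lL; rewrite distrC.
have := translate_sum X l (fun u => dev_max n u t); move=> /le_trans; apply.
have := cesc _ lL; rewrite -(ler_nat R) natrM -/X -/f => h.
have -> : 4 / i.+2%:R * f = 4 * f / i.+2%:R by rewrite mulrAC.
by rewrite ler_pdivlMr ?ltr0n//; lra.
Qed.

(** On good base points the inequality [|a| <= eps + a^2 / eps] stands in for Cauchy-Schwarz. A base
    point in [F N] that is not good has a window meeting [E i], so it lies in [W^-1 E i], which is
    small by [levcond]. *)
Lemma sum_avg_small n i N eps : 0 < eps -> (n < i.+1)%N -> (0 < i)%N ->
  (M i.+1 <= N)%N -> (N < M i.+2)%N ->
  `|\sum_(g <- F N) avg i.+1 n g t| <= (eps + 20 / (eps * i%:R) + 2 / i%:R) * #|` F N|%:R.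
Proof.
move=> e0 ni i0 MN NM; set X := F N; set f : R := #|` X|%:R.
have [_ _ ccard] := M_cond MN.
have j0 : 0 < i%:R :> R by rewrite ltr0n.
apply: (le_trans (ler_norm_sum _ _ _)).
rewrite (bigID (fun g => gb (i.+1, g)))/=.
have h1 : \sum_(g <- X | gb (i.+1, g)) `|avg i.+1 n g t| <= eps * f + 20 / (eps * i%:R) * f.
  apply: (@le_trans _ _ (\sum_(g <- X | gb (i.+1, g)) (eps + energy i.+1 g t / eps))).
    apply: ler_sum => g _; set a := avg _ _ _ _.
    have : a ^+ 2 <= energy i.+1 g t.
      rewrite /energy (bigD1 (Ordinal ni))//= lerDl; apply: sumr_ge0 => *; exact: sqr_ge0.
    move=> ae; have a2 : `|a| <= eps + a ^+ 2 / eps.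
      rewrite -(ler_pM2r e0) mulrDl divfK ?gt_eqF// -real_normK ?num_real//.
      have := normr_ge0 a; nra.
    by apply: (le_trans a2); rewrite lerD2l ler_pM2r// invr_gt0.
  rewrite big_split/= -mulr_suml; apply: lerD.
    rewrite big_const_seq iter_addr_0 -(mulr_natr eps) ler_pM2l// ler_nat.
    exact: count_size.
  rewrite ler_pdivrMr//; apply: (le_trans (ground_energy i0 MN NM)).
  rewrite le_eqVlt; apply/orP; left; apply/eqP; field.
  by rewrite !gt_eqF.
have h2 : \sum_(g <- X | ~~ gb (i.+1, g)) `|avg i.+1 n g t| <= 2 / i%:R * f.
  rewrite -big_filter.
  pose T := [seq (w^-1 * v)%g | w <- W i.+1, v <- E i].
  apply: (@le_trans _ _ (2 * (size T)%:R)).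
    apply: sum_le_card => //; first by rewrite filter_uniq.
      move=> g; rewrite mem_filter => /andP[ng gX].
      have lg : (lev g <= i.+1)%N.
        by rewrite -[g]mul1g; apply: (F_lev (ltnW NM)).
      have [w wW wg] : exists2 w, w \in W i.+1 & (lev (w * g)%g < i)%N.
        apply: contrapT => h; move/asboolP: ng; apply; split=> // w wW.
        by rewrite leqNgt; apply/negP => wg; apply: h; exists w.
      have -> : g = (w^-1 * (w * g))%g by rewrite mulKg.
      apply: allpairs_f => //; change ((w * g)%g \in E i); by rewrite levP.
    by move=> g _; exact: avg_max.
  rewrite -mulrA ler_pM2l// mulrC ler_pdivlMr//.
  rewrite -natrM ler_nat size_allpairs; apply: leq_trans ccard.
  rewrite mulnC mulnA; apply: leq_mul; last by rewrite leq_addr.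
  rewrite -addnA mulnDr; apply: leq_trans (leq_addr _ _).
  apply: leq_mul => //; rewrite expnS; apply: (@leq_trans i.+2); first by rewrite -addn2 leq_addr.
  by rewrite leq_pmulr// expn_gt0.
rewrite 2!mulrDl; exact: lerD.
Qed.

Lemma M_interval i0 N : (M i0 <= N)%N -> exists2 i, (i0 <= i)%N & (M i <= N < M i.+1)%N.
Proof.
move=> MN; have Mk k : (k <= M (i0 + k))%N.
  by elim: k => // k IHk; rewrite addnS; exact: leq_ltn_trans IHk (M_lt _).
have ex : exists k, (N < M (i0 + k))%N by exists N.+1; exact: leq_trans (Mk _).
case: (ex_minnP ex) => -[|k] Nk kmin; first by rewrite addn0 ltnNge MN in Nk.
exists (i0 + k)%N; first exact: leq_addr.
rewrite -addnS Nk andbT leqNgt; apply/negP => /kmin; by rewrite ltnn.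
Qed.

Lemma derandomized n :
  (fun N => (#|` F N|%:R)^-1 * \sum_(u <- F N) dev n u t : R) @ \oo --> (0 : R).
Proof.
apply/cvgr0Pnorm_le => eps e0.
have e4 : 0 < eps / 4 by lra.
(* Collects all terms of order [1 / i]: 20 over [eps / 4] from the energy, 2 from base points that
   are not good, and 4 from averaging over [L]. *)
pose c := 20 / (eps / 4) + 6.
have c0 : 0 < c by rewrite /c ltr_wpDl// divr_ge0// ltW.
have [i1 i1E] : exists i1, i1 = (Num.truncn (c / (eps / 4)) + n).+1 by eexists.
have bnd i : (i1 <= i)%N -> c / i%:R <= eps / 4.
  move=> ii; have i0 : 0 < i%:R :> R by rewrite ltr0n; apply: leq_trans ii; rewrite i1E.
  rewrite ler_pdivrMr// mulrC -ler_pdivrMr//; apply: ltW.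
  have := truncnS_gt (c / (eps / 4)); move=> /lt_le_trans; apply.
  by rewrite ler_nat; apply: leq_trans ii; rewrite i1E ltnS leq_addr.
exists (M i1.+1) => // N /= MN.
have [[|i] // /[!ltnS] ii /andP[iM iN]] := M_interval MN.
have f0 : 0 < #|` F N|%:R :> R by rewrite ltr0n (folner_gt0 F_folner).
have i0 : (0 < i)%N by apply: leq_trans ii; rewrite i1E.
have ni : (n < i.+1)%N.
  by rewrite ltnS; apply: leq_trans ii; rewrite i1E ltnW// ltnS leq_addl.
have h1 := sum_avg_close n iM.
have h2 := sum_avg_small e4 ni i0 iM iN.
rewrite normrM gtr0_norm ?invr_gt0// mulrC ler_pdivrMr//.
set s := \sum_(u <- F N) _ in h1 *; set a := \sum_(g <- F N) _ in h1 h2.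
have -> : s = (s - a) + a by rewrite subrK.
apply: (le_trans (ler_normD _ _)); apply: (le_trans (lerD h1 h2)).
rewrite -mulrDl ler_pM2r//.
have j0 : 0 < i%:R :> R by rewrite ltr0n.
have := bnd i ii; rewrite /c mulrDl => h3.
have : 4 / i.+2%:R <= 4 / i%:R :> R.
  by rewrite ler_pM2l// lef_pV2 ?posrE ?ltr0n// ler_nat -addn2 leq_addr.
have -> : 20 / (eps / 4 * i%:R) = 20 / (eps / 4) / i%:R.
  by field; rewrite !gt_eqF.
move: h3; rewrite -[20 / _ / _]/(20 / (eps / 4) * i%:R^-1).
move: (20 / (eps / 4) * i%:R^-1) (i%:R^-1) (i.+2%:R^-1) => x y z h3 h4; lra.
Qed.

End Derandomize.

Lemma countable_surj (G : groupType) : countable [set: G] ->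
  exists e : nat -> G, forall g, exists n, e n = g.
Proof.
move=> /countable_injP[f finj].
have /choice[e eP] : forall n, exists g : G, forall g', f g' = n -> g = g'.
  move=> n; have [[g gn]|h] := pselect (exists g, f g = n).
    by exists g => g' g'n; apply: finj; rewrite ?inE// gn.
  by exists 1%g => g' g'n; case: h; exists g'.
by exists e => g; exists (f g); exact: eP.
Qed.

(** * Choice of the parameters and the resulting sequence *)

Section Construct.
Variables (R : realType) (G : groupType) (F : nat -> {fset G}) (H : set G).
Variable C : bool -> R.
Hypothesis G_countable : countable [set: G].
Hypothesis G_infinite : infinite_set [set: G].
Hypothesis F_folner : folner R F.
Hypothesis H1 : ~ H 1%g.
Hypothesis C_max : forall b, `|C b| <= 1.

(** All that the construction needs from a dynamical system: a finitely supported random function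
    imitating [k => f (T_k w)] on [K], with mean [C] and small correlations along [H]. *)
Definition sample_law (K : {fset G}) (delta : R) (lam : seq (R * (G -> disc R))) : Prop :=
  [/\ forall w, List.In w lam -> 0 <= w.1,
      \sum_(w <- lam) w.1 = 1,
      forall b k, k \in K -> `|\sum_(w <- lam) w.1 * part b (w.2 k) - C b| <= delta &
      forall h b k, H h -> k \in K -> (h * k)%g \in K ->
        `|\sum_(w <- lam) w.1 * corr b (w.2 (h * k)%g) (w.2 k)| <= delta].

Hypothesis sample_law_ex : forall (K : {fset G}) delta, 0 < delta ->
  exists lam, sample_law K delta lam.

Section Enumerated.
Variable e : nat -> G.
Hypothesis e_surj : forall g, exists n, e n = g.

Definition obs_shift (o : option Obs) : G :=
  if o is Some (inr (j, _, _)) then e j else 1%g.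

Definition shifts i : seq G := flatten
  [seq [:: obs_shift (choice.unpickle n); (obs_shift (choice.unpickle n))^-1%g] | n <- iota 0 i.+1].

Lemma mem_shifts i a : upto i.+1 a ->
  obs_shift (Some a) \in shifts i /\ (obs_shift (Some a))^-1%g \in shifts i.
Proof.
move=> [n ni na]; split; apply/flattenP;
  exists [:: obs_shift (Some a); (obs_shift (Some a))^-1%g];
  try (by apply/mapP; exists n; [rewrite mem_iota | rewrite na]);
  by rewrite !inE eqxx ?orbT.
Qed.

(** The factor 4 leaves a proportion [1 / (2 * i.+1)] for the escapes of a shift and its inverse
    together. *)
Definition Kprop i K := forall g, g \in shifts i -> (4 * i.+1 * escape K g <= #|` K|)%N.

Lemma K_ex i : exists K : {fset G}, (0 < #|` K|)%N /\ Kprop i K.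
Proof.
have [M MP] := folner_escape F_folner (4 * i.+1) (shifts i).
exists (F M); split; first exact: (folner_gt0 F_folner).
exact: MP.
Qed.

Lemma L_ex i (S : {fset G}) : exists L : {fset G}, 1%g \in L /\
  (4 * i.+1 ^ 2 * #|` fmul (finv (fmul S S)) (fmul S S)| <= #|` L|)%N.
Proof. exact: infinite_fset. Qed.

(** The sum of the frequencies bounds each of them; [.+3] leaves room for [k.+1 < Q] and [1 < Q]. *)
Definition freq_sum i : nat :=
  (\sum_(n < i.+1) (if choice.unpickle n is Some a then obs_freq a else 0)).+3.

Lemma freq_sum_gt i a : upto i.+1 a -> ((obs_freq a).+1 < freq_sum i)%N.
Proof.
move=> [n ni na]; rewrite /freq_sum (bigD1 (Ordinal ni))//= na.
by rewrite !ltnS leqW// leq_addr.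
Qed.

Lemma construct_enumerated : exists x : G -> torus R,
  (forall h b k, H h -> (0 < k)%N ->
    (fun N => (#|` F N|%:R)^-1 * \sum_(g <- F N) trig b k (x (h * g)%g - x g) : R)
      @ \oo --> (0 : R)) /\
  (forall b, C b != 0 ->
    ~ ((fun N => (#|` F N|%:R)^-1 * \sum_(g <- F N) trig b 1 (x g) : R)
      @ \oo --> (0 : R))).
Proof.
have [K KP] := choice K_ex.
have K0 i := (KP i).1; have KE i := (KP i).2.
(* Used for both [delta] and [beta], so that their sum is [1 / i.+1]. *)
pose dl i : R := (2 * i.+1%:R)^-1.
have dl0 i : 0 < dl i by rewrite invr_gt0 mulr_gt0 ?ltr0n.
have [lam lamP] := choice (fun i => sample_law_ex (K i) (dl0 i)).
have [Lf LfP] := choice (fun p : nat * {fset G} => L_ex p.1 p.2).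
pose bS i : {fset G} := [fset g in (1%g :: shifts i) ++ [seq k^-1%g | k <- K i]]%fset.
(* [L i] must be large compared with [S i], while [S i.+1] must contain the inverses of [S i L i] to
   separate the levels; hence one recursion. *)
pose S := fix S i : {fset G} := if i is j.+1
  then ((S j `|` bS i) `|` finv (fmul (S j) (Lf (j, S j))))%fset else bS 0%N.
pose L i := Lf (i, S i).
have bSE i g : (g \in bS i) = (g \in (1%g :: shifts i) ++ [seq k^-1%g | k <- K i]).
  by rewrite /bS in_fset.

have bSS i : (bS i `<=` S i)%fset.
  case: i => [|i]//; apply: fsubset_trans (fsubsetUl _ _); exact: fsubsetUr.
have S_S i : (S i `<=` S i.+1)%fset.
  by apply: fsubset_trans (fsubsetUl _ _); exact: fsubsetUl.
have S_mono i j : (i <= j)%N -> (S i `<=` S j)%fset.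
  elim: j => [|j IHj]; first by rewrite leqn0 => /eqP ->.
  rewrite leq_eqVlt => /orP[/eqP -> //|ij]; exact: fsubset_trans (IHj ij) (S_S j).
have S1 i : 1%g \in S i by apply: (fsubsetP (bSS i)); rewrite bSE mem_head.
have S_K i k : k \in K i -> k^-1%g \in S i.
  move=> kK; apply: (fsubsetP (bSS i)); rewrite bSE.
  by rewrite mem_cat; apply/orP; right; apply/mapP; exists k.
have S_sh i g : g \in shifts i -> g \in S i.
  move=> gs; apply: (fsubsetP (bSS i)); rewrite bSE.
  by rewrite mem_cat in_cons gs orbT.
have S_L i s l : s \in S i -> l \in L i -> (s * l)^-1%g \in S i.+1.
  move=> sS lL; rewrite inE; apply/orP; right.
  by rewrite mem_finv invgK mem_fmul.
have S_obs i a u v : upto i.+1 a -> v \in obs_sites e a u -> (v * u^-1)%g \in S i.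
  move=> ua; have [ha _] := mem_shifts ua; move: ha => /S_sh.
  case: a {ua} => [b|[[j k] b]]/= eS; rewrite !inE.
    by move=> /eqP ->; rewrite mulgV S1.
  by move=> /orP[|] /eqP ->; rewrite ?mulgV ?S1// -mulgA mulgV mulg1.
have delta_beta i : dl i + dl i <= i.+1%:R^-1.
  by rewrite /dl invfM -mulrDl (_ : 2^-1 + 2^-1 = 1) ?mul1r//; lra.
have K_esc i j k b : upto i.+1 (inr (j, k, b)) -> H (e j) ->
    (escape (K i) (e j) + escape (K i) (e j)^-1)%:R <= dl i * #|` K i|%:R.
  move=> ua _; have [h1 h2] := mem_shifts ua.
  have e1 := KE _ _ h1; have e2 := KE _ _ h2.
  rewrite /dl mulrC ler_pdivlMr ?mulr_gt0 ?ltr0n//.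
  rewrite -!natrM ler_nat; move: e1 e2 => /=; lia.
have L1 i : 1%g \in L i by exact: (LfP (i, S i)).1.
have Lnear i := (LfP (i, S i)).2.
(* The observable with shift [e j = g] and frequency 0 puts [g] into [shifts i] as soon as its code
   is reached. *)
have S_ex g : exists i0, forall i, (i0 <= i)%N -> g \in S i.
  have [j jg] := e_surj g; pose a : Obs := inr (j, 0%N, true).
  exists (choice.pickle a) => i ai; apply: S_sh.
  have ua : upto i.+1 a by exists (choice.pickle a); rewrite ?ltnS// choice.pickleK.
  by have [] := mem_shifts ua; rewrite /= jg.
pose W' i := fmul (fmul (S i) (S i)) (L i).
have W1 i : 1%g \in W' i.
  by rewrite -[1%g]mulg1 mem_fmul// -[1%g]mulg1 mem_fmul.
have [lev [E [M [levP M_lt M_cond F_lev]]]] :=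
  levels_exist G_infinite F_folner L W' S_ex.
pose Qn := freq_sum.
have Qn1 i : (1 < Qn i)%N by [].
have low := @exists_low_energy R G e H K S L lam Qn C dl dl lev H1 K0 S1 S_mono S_K
  S_obs S_L Qn1 freq_sum_gt C_max (fun i => ltW (dl0 i)) (fun i => ltW (dl0 i))
  delta_beta (fun i => let: And4 a _ _ _ := lamP i in a)
  (fun i => let: And4 _ a _ _ := lamP i in a) (fun i => let: And4 _ _ a _ := lamP i in a)
  (fun i => let: And4 _ _ _ a := lamP i in a) K_esc Lnear.
pose dv n u x : R := if choice.unpickle n is Some a
  then obs_dev e H K S C lev a u x else 0.
have dvE i g x : energy dv L i g x = obs_energy e H K S L C lev i g x.
  apply: eq_bigr => n _; rewrite /avg /dv; case: (choice.unpickle n) => [a|]//.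
  by rewrite big1 ?mul0r ?expr0n.
have dv_max n u x : `|dv n u x| <= 2.
  by rewrite /dv; case: choice.unpickle => [a|]; [exact: obs_dev_max|rewrite normr0].
pose A v : seq (torus R) := [seq wb.2 | wb <- site_law (Qs Qn lev v) ((0, 0) : R * R)].
have A_ne v : exists t : torus R, t \in A v.
  exists (torus_pi (0%:R / (Qs Qn lev v)%:R)); 
  rewrite /A /site_law -map_comp; apply/mapP.
  by exists 0%N; rewrite ?mem_index_iota.
have [a0 a0A] := choice A_ne.
have dep i g x x' : (forall w, w \in W' i -> x (w * g)%g = x' (w * g)%g) ->
    energy dv L i g x = energy dv L i g x'.
  by move=> xx'; rewrite !dvE; exact: (obs_energy_dep _ _ _ _ S1 S_obs).
have [t [_ tP]] := @exists_ground_state R G _ A a0 dv L W' lev E a0A dep levP.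
have drd := @derandomized R G F F_folner _ A dv S L W' lev E M dv_max L1 W1 S1 _
  levP M_lt M_cond F_lev t tP.
have {}drd := drd _.
have {}drd n := drd (fun X x0 P PX => let: ex_intro x (And3 p1 p2 p3) := low X x0 P PX in
  ex_intro _ x (And3 p1 p2 (eq_ind_r (fun z => z <= _) p3 (eq_bigr _ (fun p _ => dvE p.1 p.2 x))))) n.
exists t; split.
  move=> h b k Hh k0; have [j jh] := e_surj h.
  rewrite (_ : (fun N => _) = (fun N => (#|` F N|%:R)^-1 *
      \sum_(g <- F N) dv (choice.pickle (inr (j, k, b) : Obs)) g t)); first exact: drd.
  apply/funext => N; congr (_ * _); apply: eq_bigr => g _.
  rewrite /dv choice.pickleK /obs_dev /= subr0 jh k0 andbT.
  by move/asboolP: Hh => ->.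
move=> b Cb trig0.
have := drd (choice.pickle (inl b : Obs)) => /(cvgB trig0).
(* 1/16 is the product of 1/4 (lower bound of [density]), 1/2 (proportion of deep sites) and 1/2
   (Fourier coefficient). *)
rewrite subrr => /cvgr0Pnorm_lt/(_ (`|C b| / 16)).
rewrite divr_gt0 ?normr_gt0// => /(_ isT)[N0 _ N0P].
have Mge k : (k <= M k)%N by elim: k => // k IHk; exact: leq_ltn_trans IHk (M_lt _).
(* For this [N] even the [S N0.+1]-neighbourhood of [F N] has level at most [N0], so only sites near
   [E N0] can fail to be deep. *)
have := N0P (M N0.+1) (leq_trans (leqnSn _) (Mge _)).
set N := M N0.+1; set f : R := #|` F N|%:R.
have f0 : 0 < f by rewrite ltr0n (folner_gt0 F_folner).
rewrite !fctE /= -mulrBr -sumrB.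
under eq_bigr do rewrite /dv choice.pickleK /obs_dev /= opprB addrC subrK.
rewrite -big_mkcond/= ltNge => /negP; apply.
have dens u : 4^-1 <= density R (K (lev u)) by exact: density_ge.
rewrite -mulr_suml -mulr_suml !normrM [X in _ <= X * _]gtr0_norm ?invr_gt0//.
have S4 : 4^-1 * (f / 2) <= \sum_(u <- F N | deep S lev u) density R (K (lev u)).
  apply: (@le_trans _ _ (\sum_(u <- F N | deep S lev u) 4^-1)); last first.
    by apply: ler_sum => u _; exact: dens.
  rewrite big_const_seq iter_addr_0 -(mulr_natr 4^-1) ler_pM2l ?invr_gt0//.
  rewrite ler_pdivrMr// -natrM ler_nat.
  have [_ _ cc] := M_cond N0 N (leqnn _).
  have cnt : (count (predC (deep S lev)) (F N) <= #|` S N0.+1| * #|` E N0|)%N.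
    have [T TE] : exists T, T = [seq (s^-1 * v)%g | s <- S N0.+1, v <- E N0] by eexists.
    have -> : (#|` S N0.+1| * #|` E N0| = size T)%N by rewrite TE size_allpairs.
    rewrite -size_filter; apply: uniq_leq_size; first by rewrite filter_uniq ?fset_uniq.
    move=> u; rewrite mem_filter => /andP[/= nd uF].
    (* Otherwise the whole neighbourhood of [u], including [u] itself, has level exactly [N0], and
       [u] is deep. *)
    have [s0 s0S s0u] : exists2 s0, s0 \in S N0.+1 & (s0 * u)%g \in E N0.
      apply: contrapT => h; move/negP: nd; apply.
      have lv s0 : s0 \in S N0.+1 -> lev (s0 * u)%g = N0.
        move=> s0S; apply/eqP; rewrite eqn_leq (F_lev N0 N)//=.
        by rewrite leqNgt -levP; apply/negP => s0u; apply: h; exists s0.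
      have lu : lev u = N0 by have := lv _ (S1 _); rewrite mul1g.
      apply/allP => s0 s0S; rewrite lu lv ?eqxx//.
      by apply: (fsubsetP (S_S _)); rewrite -lu.
    have -> : u = (s0^-1 * (s0 * u))%g by rewrite mulKg.
    by rewrite TE; apply: allpairs_f.
  have tot := count_predC (deep S lev) (F N).
  have : (#|` S N0.+1| * #|` E N0| * 2 <= #|` F N|)%N.
    apply: leq_trans cc; rewrite mulnC mulnA; apply: leq_mul; last by rewrite leq_addr.
    apply: leq_mul; last by rewrite addnAC leq_addl.
    by rewrite expnS (leq_trans _ (leq_pmulr _ _))// expn_gt0.
  move: tot cnt; set c1 := count _ _; set c2 := count _ _.
  by move: (#|` F N|) (#|` S N0.+1| * #|` E N0|)%N c1 c2 => x y z w; lia.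
have S0 : 0 <= \sum_(u <- F N | deep S lev u) density R (K (lev u)).
  by apply: le_trans S4; rewrite mulr_ge0 ?invr_ge0// divr_ge0// ltW.
rewrite (ger0_norm S0) [X in _ <= _ * (_ * X)]gtr0_norm ?invr_gt0//.
rewrite [leRHS]mulrC ler_pdivlMr//.
have := ler_wpM2r (normr_ge0 (C b)) S4; lra.
Qed.

End Enumerated.

Lemma exists_bad_sequence : exists x : G -> torus R,
  (forall h b k, H h -> (0 < k)%N ->
    (fun N => (#|` F N|%:R)^-1 * \sum_(g <- F N) trig b k (x (h * g)%g - x g) : R)
      @ \oo --> (0 : R)) /\
  (forall b, C b != 0 ->
    ~ ((fun N => (#|` F N|%:R)^-1 * \sum_(g <- F N) trig b 1 (x g) : R)
      @ \oo --> (0 : R))).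
Proof. by have [e eP] := countable_surj G_countable; exact: construct_enumerated eP. Qed.

End Construct.

(** * Finite sample laws of a measure preserving system *)

Section BoundedMeasurable.
Variables (R : realType) (d : measure_display) (X : measurableType d).
Variable mu : probability X R.
Implicit Types (u v : X -> R).

Definition bmeas u : Prop :=
  measurable_fun setT u /\ exists M : R, forall x, `|u x| <= M.

Lemma bmeas_integrable u : bmeas u -> mu.-integrable setT (EFin \o u).
Proof.
move=> [mu' [M uM]]; apply: measurable_bounded_integrable => //.
  by rewrite (le_lt_trans (probability_le1 mu _))// ltry.
by exists M; split; rewrite ?num_real// => r Mr x _; apply: le_trans (uM x) (ltW Mr).
Qed.

Lemma bmeas_cst c : bmeas (fun=> c).
Proof. by split; [exact: measurable_cst|exists `|c|]. Qed.

Lemma bmeasD u v : bmeas u -> bmeas v -> bmeas (fun x => u x + v x).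
Proof.
move=> [mu' [M uM]] [mv [N vN]]; split; first exact: measurable_funD.
by exists (M + N) => x; apply: (le_trans (ler_normD _ _)); exact: lerD.
Qed.

Lemma bmeasN u : bmeas u -> bmeas (fun x => - u x).
Proof.
move=> [mu' [M uM]]; split; first exact: measurableT_comp.
by exists M => x; rewrite normrN.
Qed.

Lemma bmeasB u v : bmeas u -> bmeas v -> bmeas (fun x => u x - v x).
Proof. by move=> bu bv; apply: bmeasD => //; exact: bmeasN. Qed.

Lemma bmeasM u v : bmeas u -> bmeas v -> bmeas (fun x => u x * v x).
Proof.
move=> [mu' [M uM]] [mv [N vN]]; split; first exact: measurable_funM.
by exists (M * N) => x; rewrite normrM; exact: ler_pM.
Qed.

Lemma bmeas_sum (J : Type) (r : seq J) (P : pred J) (u : J -> X -> R) :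
  (forall j, bmeas (u j)) -> bmeas (fun x => \sum_(j <- r | P j) u j x).
Proof.
move=> bu; elim: r => [|j r IHr].
  by under eq_fun do rewrite big_nil; exact: bmeas_cst.
by under eq_fun do rewrite big_cons; case: (P j) => //; exact: bmeasD.
Qed.

Lemma bmeas_comp u (T : X -> X) : measurable_fun setT T -> bmeas u ->
  bmeas (fun x => u (T x)).
Proof.
move=> mT [mu' [M uM]]; split; first exact: measurableT_comp.
by exists M => x; exact: uM.
Qed.

Definition Rint u : R := Rintegral mu setT u.

Lemma RintD u v : bmeas u -> bmeas v -> Rint (fun x => u x + v x) = Rint u + Rint v.
Proof. by move=> bu bv; rewrite /Rint RintegralD//; exact: bmeas_integrable. Qed.

Lemma RintZ c u : bmeas u -> Rint (fun x => c * u x) = c * Rint u.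
Proof. by move=> bu; rewrite /Rint RintegralZl//; exact: bmeas_integrable. Qed.

Lemma RintB u v : bmeas u -> bmeas v -> Rint (fun x => u x - v x) = Rint u - Rint v.
Proof. by move=> bu bv; rewrite /Rint RintegralB//; exact: bmeas_integrable. Qed.

Lemma Rint_cst c : Rint (fun=> c) = c.
Proof.
have mu1 : fine (mu setT) = 1 by rewrite probability_setT.
by rewrite /Rint Rintegral_cst// mu1 mulr1.
Qed.

Lemma Rint_sum (J : Type) (r : seq J) (u : J -> X -> R) : (forall j, bmeas (u j)) ->
  Rint (fun x => \sum_(j <- r) u j x) = \sum_(j <- r) Rint (u j).
Proof.
move=> bu; elim: r => [|j r IHr].
  by under eq_fun do rewrite big_nil; rewrite Rint_cst big_nil.
under eq_fun do rewrite big_cons.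
by rewrite RintD ?IHr ?big_cons//; exact: bmeas_sum.
Qed.

Lemma ler_Rint u v : bmeas u -> bmeas v -> (forall x, u x <= v x) -> Rint u <= Rint v.
Proof.
by move=> bu bv uv; apply: le_Rintegral => //; exact: bmeas_integrable.
Qed.

Lemma Rint_close u v eps : bmeas u -> bmeas v -> (forall x, `|u x - v x| <= eps) ->
  `|Rint u - Rint v| <= eps.
Proof.
move=> bu bv uv; have bc := bmeas_cst; have buv := bmeasB bu bv.
have {}uv x : - eps <= u x - v x <= eps by rewrite -ler_norml.
rewrite -RintB// ler_norml; apply/andP; split.
  by rewrite -[leLHS]Rint_cst; apply: ler_Rint => // x; case/andP: (uv x).
by rewrite -[leRHS]Rint_cst; apply: ler_Rint => // x; case/andP: (uv x).
Qed.

Lemma Rint_ae u v : measurable_fun setT u -> measurable_fun setT v ->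
  {ae mu, forall x, u x = v x} -> Rint u = Rint v.
Proof.
move=> mu' mv uv; rewrite /Rint /Rintegral; congr fine.
apply: ae_eq_integral => //; [exact/measurable_EFinP|exact/measurable_EFinP|].
by apply: filterS uv => x /= uvx _; rewrite uvx.
Qed.

Lemma Rint_indic (A : set X) : measurable A -> Rint (\1_A : X -> R) = fine (mu A).
Proof. by move=> mA; rewrite /Rint /Rintegral integral_indic// setIT. Qed.

Lemma bmeas_indic (A : set X) : measurable A -> bmeas (\1_A).
Proof.
move=> mA; split; first exact: measurable_indic.
by exists 1 => x; rewrite indicE ger0_norm// lern1 leq_b1.
Qed.

Lemma Rint_finite (Omega : finType) (tau : X -> Omega) (phi : Omega -> R) :
  (forall w, measurable (tau @^-1` [set w])) ->
  bmeas (fun x => phi (tau x)) /\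
  Rint (fun x => phi (tau x)) = \sum_(w : Omega) fine (mu (tau @^-1` [set w])) * phi w.
Proof.
move=> mtau.
have E : (fun x => phi (tau x)) = fun x => \sum_(w : Omega) phi w * \1_(tau @^-1` [set w]) x.
  apply/funext => x; rewrite (bigD1 (tau x))//= big1 => [|w wx].
    by rewrite indicE mem_set// mulr1 addr0.
  by rewrite indicE memNset ?mulr0// => /= xw; rewrite xw eqxx in wx.
have bi w : bmeas (fun x => phi w * \1_(tau @^-1` [set w]) x).
  by apply: bmeasM; [exact: bmeas_cst|exact: bmeas_indic].
rewrite E; split; first exact: bmeas_sum.
rewrite Rint_sum//; apply: eq_bigr => w _.
by rewrite RintZ ?Rint_indic 1?mulrC//; exact: bmeas_indic.
Qed.

Lemma Rint_pres (T : X -> X) u : measurable_fun setT T ->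
  (forall A, measurable A -> mu (T @^-1` A) = mu A) -> bmeas u ->
  Rint (fun x => u (T x)) = Rint u.
Proof.
move=> mT pT bu; rewrite /Rint /Rintegral; congr fine.
have mu' : measurable_fun setT (EFin \o u) by apply/measurable_EFinP; exact: bu.1.
transitivity (\int[pushforward mu T]_x (EFin \o u) x)%E; last first.
  by apply: eq_measure_integral => A mA _; exact: pT.
rewrite integral_pushforward//.
by apply: bmeas_integrable; exact: bmeas_comp.
Qed.

End BoundedMeasurable.

Section ComplexParts.
Variable R : realType.
Implicit Types z w : Cplx R.

Definition cpart (b : bool) z : R := if b then complex.Re z else complex.Im z.

Definition ccorr (b : bool) z w : R :=
  if b then cpart true z * cpart true w + cpart false z * cpart false w
  else cpart false z * cpart true w - cpart true z * cpart false w.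

Lemma cpart_mulconj b z w : cpart b (z * w^*) = ccorr b z w.
Proof.
case: z w => [x y] [x' y']; rewrite /cpart /ccorr/=.
by case: b => /=; rewrite mulrN ?opprK// addrC.
Qed.

Lemma cpart_max b z (M : R) : `|z| <= (M%:C)%C -> `|cpart b z| <= M.
Proof.
case: z => x y; rewrite normc_def lecR /= => h.
by case: b; apply: le_trans h; rewrite -sqrtr_sqr ler_sqrt ?addr_ge0 ?sqr_ge0//=;
  rewrite ?lerDl ?lerDr sqr_ge0.
Qed.

End ComplexParts.

(** * Quantisation by thresholds *)

Section Staircase.
Variable R : realType.

(* Values are kept in [-1/2, 1/2] so that a pair of them lies in the unit disc,
   as [site_law] requires. *)
Definition clip (r : R) : R := Num.max (- 2^-1) (Num.min r 2^-1).

Lemma clip_max r : `|clip r| <= 2^-1.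
Proof.
rewrite ler_norml le_max lexx/= ge_max ge_min lexx orbT andbT.
by lra.
Qed.

Lemma clip_id r : `|r| <= 2^-1 -> clip r = r.
Proof.
rewrite ler_norml => /andP[h1 h2].
by rewrite /clip min_l// max_r.
Qed.

(** A number in [-1/2, 1/2] is encoded by [m] threshold bits. This reduces bounded functions to
    indicators, both for the sample laws and for integrals over ultrafilters. *)
Definition staircase (m : nat) (bit : 'I_m -> bool) : R :=
  (\sum_(j < m) (bit j)%:R) / m%:R - 2^-1.

Definition threshold m (r : R) (j : 'I_m) : bool := j.+1%:R / m%:R - 2^-1 <= r.

Lemma staircase_max m bit : `|@staircase m bit| <= 2^-1.
Proof.
rewrite /staircase; set s := \sum_(j < m) _.
have s0 : 0 <= s by apply: sumr_ge0.
have s1 : s <= m%:R.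
  rewrite -[m in m%:R]card_ord -sumr_const; apply: ler_sum => j _.
  by rewrite lern1 leq_b1.
have [->|m0] := posnP m; first by rewrite invr0 mulr0 sub0r normrN gtr0_norm ?invr_gt0.
have m0' : 0 < m%:R :> R by rewrite ltr0n.
have q0 : 0 <= s / m%:R by rewrite divr_ge0// ltW.
have q1 : s / m%:R <= 1 by rewrite ler_pdivrMr// mul1r.
by rewrite ler_norml; apply/andP; split; lra.
Qed.

Lemma sum_ltn (m n : nat) : (\sum_(j < m) (j < n) = minn m n)%N.
Proof.
elim: m => [|m IHm]; first by rewrite big_ord0 min0n.
rewrite big_ord_recr/= IHm; case: (ltnP m n) => h.
  by rewrite (minn_idPl h) addn1.
by rewrite (minn_idPr (leqW h)) addn0.
Qed.

(** The number of thresholds passed is the integer part of [(r + 1/2) * m]. *)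
Lemma staircase_close m r : (0 < m)%N -> `|r| <= 2^-1 ->
  `|staircase (threshold (m := m) r) - r| <= m%:R^-1.
Proof.
move=> m0; rewrite ler_norml => /andP[r1 r2].
have m0' : 0 < m%:R :> R by rewrite ltr0n.
pose y := (r + 2^-1) * m%:R.
have y0 : 0 <= y by rewrite /y mulr_ge0//; lra.
have ym : y <= m%:R by rewrite /y ler_piMl//; lra.
have /andP[n1 n2] := truncn_itv y0.
set n := Num.truncn y in n1 n2.
have nm : (n <= m)%N by rewrite -(ler_nat R) (le_trans n1 ym).
have -> : staircase (threshold (m := m) r) = n%:R / m%:R - 2^-1.
  rewrite /staircase; congr (_ / _ - _).
  have E (j : 'I_m) : threshold r j = (j < n)%N.
    rewrite /threshold lerBlDr ler_pdivrMr// -/y; apply/idP/idP => h.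
      by rewrite -ltnS -(ltr_nat R) (le_lt_trans h n2).
    by apply: le_trans n1; rewrite ler_nat.
  under eq_bigr do rewrite E.
  by rewrite -natr_sum sum_ltn (minn_idPr nm).
have rE : r = y / m%:R - 2^-1 by rewrite /y mulfK ?gt_eqF// addrK.
have -> : n%:R / m%:R - 2^-1 - r = - ((y - n%:R) / m%:R).
  by rewrite {1}rE mulrBl; ring.
have q0 : 0 <= (y - n%:R) / m%:R by rewrite divr_ge0// subr_ge0.
rewrite normrN ger0_norm//.
rewrite ler_pdivrMr// mulVf ?gt_eqF// lerBlDr; apply: ltW; apply: lt_le_trans n2 _.
by rewrite -natr1 addrC.
Qed.

End Staircase.

Definition mk_disc (R : realType) (z : R * R) (h : z.1 ^+ 2 + z.2 ^+ 2 <= 1) : disc R :=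
  exist _ z h.

Section SampleLaw.
Variables (R : realType) (G : groupType) (H : set G).
Variables (d : measure_display) (X : measurableType d) (mu : probability X R).
Variables (T : G -> X -> X) (f : X -> Cplx R).
Hypothesis muT : mp_action mu T.
Hypothesis f_Linfty : Linfty mu f.
Hypothesis f_corr : forall h, H h -> cintegral mu (fun x => f (T h x) * (f x)^*) = 0.
Variables (c : R) (c_gt0 : 0 < c).
Hypothesis f_bound : {ae mu, forall x b, `|cpart b (f x)| <= c / 2}.

Let mT g : measurable_fun setT (T g). Proof. by case: muT => _ _ + _; exact. Qed.
Let pT g A : measurable A -> mu (T g @^-1` A) = mu A.
Proof. by case: muT => _ _ _; exact. Qed.

Let mf b : measurable_fun setT (fun x => cpart b (f x)).
Proof. by case: f_Linfty => m1 m2 _; case: b. Qed.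

(** Clipping gives a representative of [f / c] bounded at every point, so that every sample lies in
    the disc and not merely almost every one. *)
Definition bounded_part (b : bool) (x : X) : R := clip (cpart b (f x) / c).

Lemma bmeas_bounded_part b : bmeas (bounded_part b).
Proof.
split; last by exists 2^-1 => x; exact: clip_max.
apply: (@measurable_maxr _ _ _ _ (fun=> - 2^-1)); first exact: measurable_cst.
apply: (@measurable_minr _ _ _ _ _ (fun=> 2^-1)); last exact: measurable_cst.
by apply: measurable_funM; [exact: mf|exact: measurable_cst].
Qed.

Lemma bounded_part_ae : {ae mu, forall x b, c * bounded_part b x = cpart b (f x)}.
Proof.
apply: filterS f_bound => x fx b; rewrite /bounded_part clip_id.
  by rewrite mulrC divfK// gt_eqF.
rewrite normrM [X in _ * X]gtr0_norm ?invr_gt0// ler_pdivrMr// mulrC.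
exact: fx.
Qed.

Lemma ae_comp g (P : X -> Prop) : {ae mu, forall x, P x} -> {ae mu, forall x, P (T g x)}.
Proof.
move=> [A [mA A0 PA]]; exists (T g @^-1` A); split.
- by rewrite -[X in measurable X]setTI; exact: mT.
- by rewrite pT.
- by move=> x /= nP; exact: PA.
Qed.

Definition bcorr b x y : R :=
  if b then bounded_part true x * bounded_part true y
            + bounded_part false x * bounded_part false y
  else bounded_part false x * bounded_part true y
       - bounded_part true x * bounded_part false y.

Lemma Rint_bounded_part b : c * Rint mu (bounded_part b) = cpart b (cintegral mu f).
Proof.
have bb := bmeas_bounded_part b.
transitivity (Rint mu (fun x => cpart b (f x))); last by case: b {bb}.
have cb : bmeas (fun x => c * bounded_part b x) by apply: bmeasM => //; exact: bmeas_cst.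
rewrite -RintZ//; apply: Rint_ae; first exact: cb.1.
  exact: mf.
by apply: filterS bounded_part_ae => x; exact.
Qed.

Lemma bmeas_bcorr b g : bmeas (fun x => bcorr b (T g x) x).
Proof.
have bp b' := bmeas_bounded_part b'.
have bT b' : bmeas (fun x => bounded_part b' (T g x)) by exact: bmeas_comp.
by rewrite /bcorr; case: b; [apply: bmeasD|apply: bmeasB]; exact: bmeasM.
Qed.

Lemma Rint_bcorr b h : H h -> Rint mu (fun x => bcorr b (T h x) x) = 0.
Proof.
move=> Hh; have bb := bmeas_bcorr b h.
suff : c ^+ 2 * Rint mu (fun x => bcorr b (T h x) x) = 0.
  by move=> /eqP; rewrite mulf_eq0 expf_eq0/= gt_eqF//= => /eqP.
transitivity (cpart b (cintegral mu (fun x => f (T h x) * (f x)^*))); last first.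
  by rewrite f_corr//; case: b {bb}.
transitivity (Rint mu (fun x => cpart b (f (T h x) * (f x)^*))); last by case: b {bb}.
have cb : bmeas (fun x => c ^+ 2 * bcorr b (T h x) x).
  by apply: bmeasM => //; exact: bmeas_cst.
rewrite -RintZ//; apply: Rint_ae; first exact: cb.1.
  under eq_fun do rewrite cpart_mulconj.
  have mfT b' : measurable_fun setT (fun x => cpart b' (f (T h x))).
    exact: (measurableT_comp (mf b') (mT h)).
  by rewrite /ccorr; case: b {bb cb}; [apply: measurable_funD|apply: measurable_funB];
    exact: measurable_funM.
apply: filterS2 bounded_part_ae (ae_comp h bounded_part_ae) => x e1 e2.
rewrite cpart_mulconj /ccorr /bcorr; case: b {bb cb}; rewrite -!e1 -!e2 expr2; ring.
Qed.

Section Discretize.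
Variables (K : {fset G}) (m : nat).
Hypothesis m_gt0 : (0 < m)%N.

Let Omega := {ffun K * bool * 'I_m -> bool}.

(** The bit pattern of the piece of orbit indexed by [K]. There are finitely many patterns, and
    their probabilities form the sample law. *)
Let tau (x : X) : Omega :=
  [ffun p => threshold (bounded_part p.1.2 (T (val p.1.1) x)) p.2].

Let sample_value (w : Omega) (k : K) (b : bool) : R := staircase R (fun j => w (k, b, j)).

Lemma sample_value_disc w k :
  (sample_value w k true, sample_value w k false).1 ^+ 2
  + (sample_value w k true, sample_value w k false).2 ^+ 2 <= 1.
Proof.
rewrite /=; have := staircase_max R (fun j => w (k, true, j)).
have := staircase_max R (fun j => w (k, false, j)).
rewrite -/(sample_value w k true) -/(sample_value w k false) !ler_norml.
by move=> /andP[h1 h2] /andP[h3 h4]; nra.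
Qed.

Let sample (w : Omega) (g : G) : disc R :=
  if insub g is Some k then mk_disc (sample_value_disc w k) else disc0 R.

Let mu_sample : seq (R * (G -> disc R)) :=
  [seq (fine (mu (tau @^-1` [set w])), sample w) | w <- index_enum Omega].

Lemma measurable_tau w : measurable (tau @^-1` [set w]).
Proof.
have -> : tau @^-1` [set w] = \bigcap_(p in [set: K * bool * 'I_m])
    ((fun x => threshold (bounded_part p.1.2 (T (val p.1.1) x)) p.2) @^-1` [set w p]).
  apply/seteqP; split => [x /= <- p _ /=|x /= h]; first by rewrite ffunE.
  by apply/ffunP => p; rewrite ffunE; exact: h.
apply: fin_bigcap_measurable; first exact: finite_finset.
move=> p _; rewrite -[X in measurable X]setTI.
apply: (@measurable_fun_ler _ _ R setT (fun=> p.2.+1%:R / m%:R - 2^-1)) => //.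
exact: (bmeas_comp (mT _) (bmeas_bounded_part _)).1.
Qed.

Lemma mu_sampleE (phi : (G -> disc R) -> R) :
  bmeas (fun x => phi (sample (tau x))) /\
  \sum_(w <- mu_sample) w.1 * phi w.2 = Rint mu (fun x => phi (sample (tau x))).
Proof.
have [b ->] := Rint_finite mu (fun w => phi (sample w)) measurable_tau.
by split=> //; rewrite big_map.
Qed.

Lemma sample_part b k x : k \in K ->
  part b (sample (tau x) k) = staircase R (threshold (m := m) (bounded_part b (T k x))).
Proof.
move=> kK; rewrite /sample insubT /=.
have E b' : sample_value (tau x) (Sub k kK) b' =
    staircase R (threshold (m := m) (bounded_part b' (T k x))).
  congr (_ / _ - _); apply: eq_bigr => j _; by rewrite ffunE.
by case: b; rewrite /part/= E.
Qed.

Lemma sample_part_close b k x : k \in K ->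
  `|part b (sample (tau x) k) - bounded_part b (T k x)| <= m%:R^-1.
Proof. by move=> kK; rewrite sample_part// staircase_close// clip_max. Qed.

Lemma sample_part_max b k x : k \in K -> `|part b (sample (tau x) k)| <= 2^-1.
Proof. by move=> kK; rewrite sample_part// staircase_max. Qed.

Lemma prod_close (a a' b b' e : R) : `|a - a'| <= e -> `|b - b'| <= e ->
  `|a| <= 2^-1 -> `|b'| <= 2^-1 -> `|a * b - a' * b'| <= e.
Proof.
move=> h1 h2 h3 h4.
have -> : a * b - a' * b' = a * (b - b') + (a - a') * b' by ring.
apply: (le_trans (ler_normD _ _)); rewrite !normrM.
have := normr_ge0 (b - b'); have := normr_ge0 (a - a').
have := normr_ge0 a; have := normr_ge0 b'; nra.
Qed.

(** Invariance under [T k] makes means and correlations independent of [k], since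
    [T (h k) x = T h (T k x)]. Factors bounded by 1/2 make a product accurate to [1 / m], and a
    correlation consists of two products. *)
Lemma mu_sample_law : sample_law H (fun b => Rint mu (bounded_part b)) K (2 * m%:R^-1) mu_sample.
Proof.
have m1 : 0 <= m%:R^-1 :> R by rewrite invr_ge0.
have actT g h x : T g (T h x) = T (g * h)%g x by case: muT.
split.
- move=> w; rewrite /mu_sample; elim: (index_enum Omega) => //= w' s IHs [<-|]//=.
  exact: fine_ge0.
- have [_] := mu_sampleE (fun=> 1); rewrite Rint_cst => <-.
  by apply: eq_bigr => w _; rewrite mulr1.
- move=> b k kK; have [bs ->] := mu_sampleE (fun z => part b (z k)).
  rewrite -(Rint_pres (mT k) (pT k) (bmeas_bounded_part b)).
  apply: Rint_close => //; first exact: (bmeas_comp (mT k) (bmeas_bounded_part b)).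
  by move=> x; apply: (le_trans (sample_part_close _ _ _)) => //; lra.
move=> h b k Hh kK hkK; have [bs ->] := mu_sampleE (fun z => corr b (z (h * k)%g) (z k)).
rewrite -[X in `|X|]subr0 -(Rint_bcorr b Hh).
rewrite -(Rint_pres (mT k) (pT k) (bmeas_bcorr b h)).
apply: Rint_close => //; first exact: (bmeas_comp (mT k) (bmeas_bcorr b h)).
move=> x; rewrite actT /bcorr /corr.
have p1 b' := sample_part_close b' x kK; have p2 b' := sample_part_close b' x hkK.
have p3 b' := sample_part_max b' x hkK.
have p4 b' : `|bounded_part b' (T k x)| <= 2^-1 by exact: clip_max.
have pc b1 b2 := prod_close (p2 b1) (p1 b2) (p3 b1) (p4 b2).
have dB (p q r s : R) : `|p - q - (r - s)| <= `|p - r| + `|q - s|.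
  have -> : p - q - (r - s) = (p - r) - (q - s) by ring.
  exact: ler_normB.
have dD (p q r s : R) : `|p + q - (r + s)| <= `|p - r| + `|q - s|.
  by rewrite opprD addrACA; exact: ler_normD.
case: b {bs}.
  by apply: (le_trans (dD _ _ _ _)); have := pc true true; have := pc false false; lra.
by apply: (le_trans (dB _ _ _ _)); have := pc true false; have := pc false true; lra.
Qed.

End Discretize.
End SampleLaw.

Lemma ultra_cvg (R : realType) (T : Type) (U : set_system T) (f : T -> R) (a b : R) :
  UltraFilter U -> U [set x | a <= f x <= b] -> exists2 l, a <= l <= b & f @ U --> l.
Proof.
move=> UU fab; have FU : ProperFilter U by exact: ultra_proper.
have [|l [/= lab lcl]] := @segment_compact R a b (f @ U) (fmap_proper_filter f FU).
  change (U (f @^-1` `[a, b])); apply: filterS fab => x /= fx.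
  by rewrite in_itv.
exists l; first by rewrite in_itv in lab.
move=> A Al; have [//|nA] := in_ultra_setVsetC (f @^-1` A) UU.
by have [y []] := lcl (~` A) A nA Al.
Qed.

(** * Weyl's criterion *)

Section TorusFunctions.
Variable R : realType.
Implicit Types (x y : torus R) (phi : torus R -> R).

Lemma torus_continuous (Z : topologicalType) (phi : torus R -> Z) :
  continuous phi <-> continuous (fun r : R => phi (torus_pi r)).
Proof. exact: quotient_continuous. Qed.

Lemma continuous_trig b k : continuous (trig b k : torus R -> R).
Proof.
apply/torus_continuous.
have ca : continuous (fun r : R => ang k r).
  by move=> r; apply: cvgM; [exact: cvg_cst|apply: cvgM; [exact: cvg_cst|exact: cvg_id]].
case: b.
  rewrite [X in continuous X](_ : _ = fun r => cos (ang k r)).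
    by move=> r; apply: continuous_comp; [exact: ca|exact: continuous_cos].
  by apply/funext => r; rewrite /trig tcosE.
rewrite [X in continuous X](_ : _ = fun r => sin (ang k r)).
  by move=> r; apply: continuous_comp; [exact: ca|exact: continuous_sin].
by apply/funext => r; rewrite /trig tsinE.
Qed.

Lemma measurable_torus_continuous phi : continuous phi -> measurable_fun setT phi.
Proof.
move=> cphi; apply: (measurability _ (RGenOpens.measurableE R)).
move=> _ [_ [a [b ->]] <-]; rewrite setTI; apply: sub_sigma_algebra.
move/continuousP: cphi; apply; exact: interval_open.
Qed.

Lemma torus_bounded phi : continuous phi -> exists M : R, forall x, `|phi x| <= M.
Proof.
move=> cphi; have c' : {within `[0, 1 : R], continuous (fun r : R => phi (torus_pi r))}.
  by apply: continuous_subspaceT; apply/torus_continuous.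
have [M [_ MP]] := compact_bounded (continuous_compact c' (@segment_compact R 0 1)).
exists (M + 1) => x; rewrite -(torus_piK x).
set r := repr x; have fr : torus_pi r = torus_pi (r - (Num.floor r)%:~R).
  by apply/torus_pi_eq; rewrite opprB addrC subrK; exact: intr_int.
rewrite fr; apply: (MP (M + 1)); first by rewrite ltrDl.
exists (r - (Num.floor r)%:~R) => //=.
have /andP[h1 h2] := floor_itv r; rewrite in_itv/= subr_ge0 h1/= lerBlDl.
by rewrite ltW// (lt_le_trans h2)// intrD.
Qed.

(** Uniform continuity in the form that matches [fejer_bound]. If no [C] works, pairs violating the
    bound for [C = n] have [cos] of their difference tending to 1, hence a common limit along an
    ultrafilter, against the gap [eps]. *)
Lemma torus_modulus phi (eps : R) : continuous phi -> 0 < eps ->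
  exists2 C : R, 0 <= C &
    forall x y, `|phi x - phi y| <= eps + C * (1 - tcos 1 (x - y)).
Proof.
move=> cphi e0; have [M phiM] := torus_bounded cphi.
have M0 : 0 <= M by apply: le_trans (phiM 0).
apply: contrapT => h.
have /choice[p pP] : forall n : nat, exists p : R * R,
    [/\ -1 <= p.1 <= 2, -1 <= p.2 <= 2, `|p.1 - p.2| <= 2^-1 &
      eps + n%:R * (1 - cos (ang 1 (p.1 - p.2))) < `|phi (torus_pi p.1) - phi (torus_pi p.2)|].
  move=> n; apply: contrapT => hn; apply: h; exists n%:R => // x y.
  rewrite leNgt; apply/negP => lt; apply: hn.
  pose a := repr x; pose b := repr y; pose r := a - (Num.floor a)%:~R.
  have ra : torus_pi r = x.
    by rewrite -[RHS]torus_piK; apply/torus_pi_eq; rewrite addrAC subrr add0r rpredN intr_int.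
  have /andP[r0 r1] : 0 <= r <= 1.
    have /andP[h1 h2] := floor_itv a; rewrite subr_ge0 h1/= lerBlDl.
    by rewrite ltW// (lt_le_trans h2)// intrD.
  (* The representative of [y] nearest to [r]: at distance at most 1/2, a limiting cosine of 1
     forces equal limits. *)
  pose m := Num.floor (b - r + 2^-1); pose s := b - m%:~R.
  have sb : torus_pi s = y.
    by rewrite -[RHS]torus_piK; apply/torus_pi_eq; rewrite addrAC subrr add0r rpredN intr_int.
  have /andP[s0 s1] := floor_itv (b - r + 2^-1).
  rewrite intrD -/m in s0 s1.
  have rs : - 2^-1 <= r - s <= 2^-1 by rewrite /s; lra.
  exists (r, s); split => /=; [lra|lra|by rewrite ler_norml|].
  by move: lt; rewrite -ra -sb -torus_piB tcosE.
have [U [UU Uoo]] := ultraFilterLemma (eventually_filter).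
have FU : ProperFilter U by exact: ultra_proper.
have [l1 _ p1] : exists2 l : R, -1 <= l <= 2 & (fun n => (p n).1) @ U --> l.
  by apply: ultra_cvg; apply: filterS (@filterT _ U _) => n _ /=; case: (pP n).
have [l2 _ p2] : exists2 l : R, -1 <= l <= 2 & (fun n => (p n).2) @ U --> l.
  by apply: ultra_cvg; apply: filterS (@filterT _ U _) => n _ /=; case: (pP n).
have cphi' := (torus_continuous phi).1 cphi.
have d12 : (fun n => (p n).1 - (p n).2) @ U --> l1 - l2 by exact: cvgB.
have ccos : continuous (fun r : R => cos (ang 1 r)).
  move=> r; apply: continuous_comp; last exact: continuous_cos.
  by apply: cvgM; [exact: cvg_cst|apply: cvgM; [exact: cvg_cst|exact: cvg_id]].
have cos1 : cos (ang 1 (l1 - l2)) = 1.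
  apply/eqP; rewrite eq_le cos_le1/=; apply/ler_addgt0Pr => e e1.
  have cc : (fun n => cos (ang 1 ((p n).1 - (p n).2))) @ U --> cos (ang 1 (l1 - l2)).
    exact: (continuous_cvg _ (ccos _) d12).
  have small n : 2 * M < n.+1%:R * e -> 1 - e <= cos (ang 1 ((p n.+1).1 - (p n.+1).2)).
    move=> ne; rewrite lerBlDr -lerBlDl leNgt; apply/negP => le1.
    have [_ _ _] := pP n.+1; apply/negP; rewrite -leNgt.
    apply: (le_trans (ler_normB _ _)); have := phiM (torus_pi (p n.+1).1).
    have := phiM (torus_pi (p n.+1).2).
    have : n.+1%:R * e < n.+1%:R * (1 - cos (ang 1 ((p n.+1).1 - (p n.+1).2))).
      by rewrite ltr_pM2l ?ltr0n.
    lra.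
  rewrite -lerBlDr; apply: (cvgr_to_ge cc).
  have : U [set n | (Num.truncn (2 * M / e) < n)%N] by apply: Uoo; exists (Num.truncn (2 * M / e)).+1.
  apply: filterS => -[//|n] /= ltn; apply: small.
  rewrite -ltr_pdivrMr//; apply: (lt_le_trans (truncnS_gt _)); by rewrite ler_nat.
have l12 : l1 = l2.
  have ab : `|l1 - l2| <= 2^-1.
    have c : (fun n => `|(p n).1 - (p n).2|) @ U --> `|l1 - l2| by exact: cvg_norm.
    apply: (cvgr_to_le c).
    by apply: filterS (@filterT _ U _) => n _ /=; case: (pP n).
  apply/eqP; rewrite -subr_eq0 -normr_eq0; apply/negPn/negP => n0.
  have n0' : 0 < `|l1 - l2| by rewrite lt_def n0 normr_ge0.
  have : cos (ang 1 `|l1 - l2|) < 1.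
    apply: cos_lt1; rewrite /ang mul1r; have := pi_gt0 R => pi0.
    by apply/andP; split; nra.
  suff -> : cos (ang 1 `|l1 - l2|) = cos (ang 1 (l1 - l2)) by rewrite cos1 ltxx.
  rewrite /ang !mul1r; have [_|_] := ler0P (l1 - l2) => //.
  by rewrite mulrN cosN.
have c0 : (fun n => `|phi (torus_pi (p n).1) - phi (torus_pi (p n).2)|) @ U --> (0 : R).
  rewrite -[X in _ --> X](normr0 R) -(subrr (phi (torus_pi l1))).
  apply: cvg_norm; apply: cvgB; first exact: (continuous_cvg _ (cphi' _) p1).
  by rewrite l12; exact: (continuous_cvg _ (cphi' _) p2).
have : U [set n | `|phi (torus_pi (p n).1) - phi (torus_pi (p n).2)| < eps].
  move/cvgr0Pnorm_lt : c0 => /(_ _ e0); apply: filterS => n /=.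
  by rewrite normr_id.
move=> /filter_ex[n /=]; apply/negP; rewrite -leNgt.
have [_ _ _ h1] := pP n; apply: ltW; apply: le_lt_trans h1.
rewrite lerDl mulr_ge0// subr_ge0; exact: cos_le1.
Qed.

End TorusFunctions.

Section HaarIntegral.
Variable R : realType.
Implicit Types (phi : torus R -> R).

Lemma bmeas_continuous phi : continuous phi -> bmeas phi.
Proof.
by move=> c; split; [exact: measurable_torus_continuous|exact: torus_bounded].
Qed.

Lemma Rint_haar phi (f F : R -> R) : continuous phi -> (forall x, 0 <= phi x) ->
  (forall r, phi (torus_pi r) = f r) -> (forall r : R, is_derive r 1 F (f r)) ->
  Rint (haar R) phi = F 1 - F 0.
Proof.
move=> cphi phi0 phiE dF.
have mphi := measurable_torus_continuous cphi.
rewrite /Rint /Rintegral ge0_integral_distribution//; last exact/measurable_EFinP.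
rewrite integral_uniform/=; first last.
- by move=> y; rewrite lee_fin.
- apply: measurableT_comp; last exact: measurable_torus_pi.
  exact/measurable_EFinP.
rewrite subr0 invr1 mul1e.
under eq_integral do rewrite phiE.
have cf : continuous f.
  rewrite (_ : f = fun r => phi (torus_pi r)); first exact: (torus_continuous phi).1.
  by apply/funext => r; rewrite phiE.
have cF : continuous F.
  by move=> r; apply: differentiable_continuous; apply/derivable1_diffP; exact: @ex_derive.
rewrite (@continuous_FTC2 R f F 0 1)//.
- exact: continuous_subspaceT.
- split; [by move=> r _; exact: @ex_derive| |].
    by apply: cvg_at_right_filter; exact: cF.
  by apply: cvg_at_left_filter; exact: cF.
- by move=> r _; rewrite derive1E; exact: derive_val.
Qed.

Lemma Rint_haar_trig b k : (0 < k)%N -> Rint (haar R) (trig b k) = 0.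
Proof.
move=> k0; have ct := @continuous_trig R b k.
have bt := bmeas_continuous ct.
have t1 (x : torus R) : 0 <= 1 + trig b k x.
  by have := trig_max b k x; rewrite ler_norml -lerBlDl sub0r => /andP[].
pose w : R := pi *+ 2 * k%:R.
have w0 : w != 0.
  by rewrite gt_eqF// mulr_gt0 ?ltr0n// pmulrn_rgt0 ?pi_gt0.
have angE (r : R) : ang k r = w * r by rewrite /ang mulrA.
(* Adding 1 makes the integrand nonnegative, as [Rint_haar] asks. *)
suff : Rint (haar R) (fun x => 1 + trig b k x) = 1.
  by rewrite RintD ?Rint_cst//; [lra|exact: bmeas_cst].
have c1 : continuous (fun x : torus R => 1 + trig b k x).
  by move=> x; apply: continuousD; [apply: cst_continuous|exact: ct].
have dw (r : R) : is_derive r 1 (fun r : R => w * r) (w *: 1) by exact: is_deriveZ.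
have w1 : w * 1 = 0 + pi *+ 2 * (k%:Z)%:~R by rewrite mulr1 add0r.
case: b ct bt t1 c1 => ct bt t1 c1.
  have dF (r : R) : is_derive r 1 (fun r => r + w^-1 * sin (w * r)) (1 + cos (w * r)).
    have ds := is_derive1_comp (is_derive_sin (w * r)) (dw r).
    have := is_deriveD (is_derive_id r 1) (is_deriveZ w^-1 ds).
    move=> /is_derive_eq; apply.
    by rewrite /GRing.scale/= mulr1 mulrCA mulVf// mulr1.
  have E r : 1 + trig true k (torus_pi r) = 1 + cos (w * r) by rewrite /trig tcosE angE.
  rewrite (Rint_haar c1 t1 E dF) w1 sinD_int !mulr0 sin0 !mulr0; lra.
have dF (r : R) : is_derive r 1 (fun r => r - w^-1 * cos (w * r)) (1 + sin (w * r)).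
  have ds := is_derive1_comp (is_derive_cos (w * r)) (dw r).
  have := is_deriveB (is_derive_id r 1) (is_deriveZ w^-1 ds).
  move=> /is_derive_eq; apply.
  by rewrite /GRing.scale/= mulr1 mulNr mulrN opprK mulrCA mulVf// mulr1.
have E r : 1 + trig false k (torus_pi r) = 1 + sin (w * r) by rewrite /trig tsinE angE.
rewrite (Rint_haar c1 t1 E dF) w1 cosD_int !mulr0 cos0; lra.
Qed.

End HaarIntegral.

(** * The Fejér kernel *)

Section Fejer.
Variable R : realType.
Implicit Types (x y : torus R).

Lemma tcos0 y : tcos 0 y = 1.
Proof. by rewrite /tcos /ang mul0r mulr0 cos0. Qed.

(* The Fejér kernel as the square of a Dirichlet sum, which makes its positivity
   and its decay away from 0 immediate. *)
Definition fejer n y : R :=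
  ((\sum_(k < n) tcos k y) ^+ 2 + (\sum_(k < n) tsin k y) ^+ 2) / n%:R.

Lemma fejer_ge0 n y : 0 <= fejer n y.
Proof. by rewrite divr_ge0// addr_ge0// sqr_ge0. Qed.

(** For the character [e], the squared modulus of [sum_{k<n} e(ky)] times that of [1 - e(y)] is that
    of [1 - e(ny)], at most 4; and [|1 - e(y)|^2 = 2 (1 - cos)]. *)
Lemma fejer_bound n y : (0 < n)%N -> fejer n y * (1 - tcos 1 y) <= 2 / n%:R.
Proof.
move=> n0; have n0' : 0 < n%:R :> R by rewrite ltr0n.
rewrite /fejer mulrAC ler_pM2r ?invr_gt0//.
set A := \sum_(k < n) tcos k y; set B := \sum_(k < n) tsin k y.
set c := tcos 1 y; set s := tsin 1 y.
have cS k : tcos k.+1 y = tcos k y * c - tsin k y * s.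
  by rewrite /c /s /tcos /tsin -addn1 angD cosD.
have sS k : tsin k.+1 y = tsin k y * c + tcos k y * s.
  by rewrite /c /s /tcos /tsin -addn1 angD sinD.
have tA : A * c - B * s = A - 1 + tcos n y.
  rewrite /A /B !mulr_suml -sumrB; under eq_bigr do rewrite -cS.
  have := big_ord_recr n (fun k : 'I_n.+1 => tcos k y) (op := +%R) (idx := 0).
  rewrite big_ord_recl /= tcos0.
  by move=> /(congr1 (fun t => t - 1)); rewrite addrAC subrr add0r => ->; rewrite addrAC.
have tB : B * c + A * s = B + tsin n y.
  rewrite /A /B !mulr_suml -big_split/=; under eq_bigr do rewrite -sS.
  have := big_ord_recr n (fun k : 'I_n.+1 => tsin k y) (op := +%R) (idx := 0).
  by rewrite big_ord_recl /= {1}/tsin /ang mul0r mulr0 sin0 add0r => h.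
have cs : c ^+ 2 + s ^+ 2 = 1 by exact: tcos2Dtsin2.
have CS : tcos n y ^+ 2 + tsin n y ^+ 2 = 1 by exact: tcos2Dtsin2.
have e1 : A * (1 - c) + B * s = 1 - tcos n y by rewrite mulrBr mulr1; lra.
have e2 : B * (1 - c) - A * s = - tsin n y by rewrite mulrBr mulr1; lra.
have : (A ^+ 2 + B ^+ 2) * (2 * (1 - c)) = 2 * (1 - tcos n y).
  transitivity ((A * (1 - c) + B * s) ^+ 2 + (B * (1 - c) - A * s) ^+ 2).
    have -> : 2 * (1 - c) = (1 - c) ^+ 2 + s ^+ 2 by rewrite -[s ^+ 2](addKr (c ^+ 2)) cs; ring.
    by ring.
  by rewrite e1 e2 sqrrN; rewrite sqrrB expr1n mul1r; lra.
have := trig_max true n y; rewrite /trig ler_norml => /andP[h1 h2] h3; lra.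
Qed.

(** With truncated subtraction, [(k - l) + (l - k)] is the distance of [k] and [l]. *)
Lemma tcos_dist k l y :
  tcos k y * tcos l y + tsin k y * tsin l y = tcos ((k - l) + (l - k))%N y.
Proof.
wlog lk : k l / (l <= k)%N => [H|].
  have [/H//|/ltnW/H kl] := leqP l k.
  by rewrite addnC -kl; congr (_ + _); rewrite mulrC.
have -> : ((k - l) + (l - k) = k - l)%N by lia.
have : ang k (repr y) - ang l (repr y) = ang (k - l) (repr y).
  by rewrite -[k in LHS](subnK lk) angD addrK.
by rewrite /tcos => <-; rewrite cosB.
Qed.

Lemma fejerE n y : fejer n y =
  (\sum_(k < n) \sum_(l < n) tcos ((k - l) + (l - k))%N y) / n%:R.
Proof.
rewrite /fejer; congr (_ / _); rewrite !expr2 !mulr_suml -big_split/=.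
apply: eq_bigr => k _; rewrite !mulr_sumr -big_split/=.
by apply: eq_bigr => l _; rewrite tcos_dist.
Qed.

Definition node Q (q : nat) : torus R := torus_pi (q%:R / Q%:R).

Lemma tcos_mean d Q y : (d < Q)%N ->
  \sum_(0 <= q < Q) tcos d (y - node Q q) = (d == 0%N)%:R * Q%:R.
Proof.
move=> dQ; have [->|d0] := posnP d.
  under eq_bigr do rewrite tcos0.
  by rewrite sumr_const_nat subn0 mul1r.
rewrite mul0r; have [|c0 s0] := @sum_cos_sin0 R d Q; first by rewrite d0.
under eq_bigr do rewrite tcosB /node tcosE tsinE.
by rewrite big_split/= -!mulr_sumr c0 s0 !mulr0 addr0.
Qed.

(* Averaging over the nodes [q/Q] replaces the convolution integral by a finite
   sum of translates. *)
Lemma fejer_mean n Q y : (0 < n <= Q)%N ->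
  \sum_(0 <= q < Q) fejer n (y - node Q q) = Q%:R.
Proof.
move=> /andP[n0 nQ]; under eq_bigr do rewrite fejerE.
rewrite -mulr_suml exchange_big/=.
under eq_bigr => k _.
  rewrite exchange_big/= (eq_bigr (fun l : 'I_n => (l == k)%:R * Q%:R)); last first.
    move=> l _; rewrite tcos_mean; last by have := ltn_ord k; have := ltn_ord l; lia.
    congr ((nat_of_bool _)%:R * _); apply/eqP/eqP => [h|->]; last by rewrite subnn.
    by apply: val_inj => /=; lia.
  rewrite -mulr_suml (bigD1 k)//= eqxx big1 ?addr0 ?mul1r; last by move=> l /negbTE ->.
  over.
by rewrite big_const_ord iter_addr_0 -(mulr_natr Q%:R) mulfK// pnatr_eq0 -lt0n.
Qed.

End Fejer.

Section Weyl.
Variables (R : realType) (G : groupType) (F : nat -> {fset G}) (x : G -> torus R).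
Hypothesis F_neq0 : forall N, (0 < #|` F N|)%N.
Hypothesis trig0 : forall b k, (0 < k)%N ->
  (fun N => (#|` F N|%:R)^-1 * \sum_(g <- F N) trig b k (x g) : R) @ \oo --> (0 : R).

Definition equid (P : torus R -> R) : Prop := bmeas P /\
  (fun N => (#|` F N|%:R)^-1 * \sum_(g <- F N) P (x g) : R) @ \oo --> Rint (haar R) P.

Lemma equid_cst c : equid (fun=> c).
Proof.
split; first exact: bmeas_cst.
rewrite Rint_cst (_ : (fun N => _) = fun=> c); first exact: cvg_cst.
apply/funext => N; rewrite big_const_seq count_predT iter_addr_0 -(mulr_natl c).
by rewrite mulKf// pnatr_eq0 -lt0n.
Qed.

Lemma equidD P P' : equid P -> equid P' -> equid (fun y => P y + P' y).
Proof.
move=> [b c] [b' c']; split; first exact: bmeasD.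
rewrite RintD// (_ : (fun N => _) = fun N => (#|` F N|%:R)^-1 * \sum_(g <- F N) P (x g)
  + (#|` F N|%:R)^-1 * \sum_(g <- F N) P' (x g)); first exact: cvgD.
by apply/funext => N; rewrite big_split/= mulrDr.
Qed.

Lemma equidZ a P : equid P -> equid (fun y => a * P y).
Proof.
move=> [b c]; split; first by apply: bmeasM => //; exact: bmeas_cst.
rewrite RintZ// (_ : (fun N => _) = fun N => a * ((#|` F N|%:R)^-1 * \sum_(g <- F N) P (x g))).
  by apply: cvgM => //; exact: cvg_cst.
by apply/funext => N; rewrite -mulr_sumr mulrCA.
Qed.

Lemma equid_sum (J : Type) (r : seq J) (P : J -> torus R -> R) :
  (forall j, equid (P j)) -> equid (fun y => \sum_(j <- r) P j y).
Proof.
move=> eP; elim: r => [|j r IHr].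
  by under eq_fun do rewrite big_nil; exact: equid_cst.
by under eq_fun do rewrite big_cons; exact: equidD.
Qed.

Lemma equid_trig b k : (0 < k)%N -> equid (trig b k).
Proof.
move=> k0; split; first exact/bmeas_continuous/continuous_trig.
by rewrite Rint_haar_trig//; exact: trig0.
Qed.

Lemma equid_tcos d z : equid (fun y => tcos d (y - z)).
Proof.
have [->|d0] := posnP d; first by under eq_fun do rewrite tcos0; exact: equid_cst.
under eq_fun do rewrite tcosB mulrC [X in _ + X]mulrC.
by apply: equidD; apply: equidZ; [exact: (@equid_trig true)|exact: (@equid_trig false)].
Qed.

Lemma equid_fejer n z : equid (fun y => fejer n (y - z)).
Proof.
under eq_fun do rewrite fejerE mulrC.
apply: equidZ; apply: equid_sum => k; apply: equid_sum => l; exact: equid_tcos.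
Qed.

Lemma equid_limit phi : continuous phi ->
  (forall eps, 0 < eps -> exists2 P, equid P & forall y, `|phi y - P y| <= eps) ->
  equid phi.
Proof.
move=> cphi ap; have bphi := bmeas_continuous cphi; split=> //.
apply/cvgrPdist_le => eps e0; have e3 : 0 < eps / 3 by lra.
have [P [bP cP] phiP] := ap _ e3.
move/cvgrPdist_le: cP => /(_ _ e3); apply: filterS => N h.
have h1 := Rint_close (haar R) bphi bP phiP.
have h2 : `|(#|` F N|%:R)^-1 * \sum_(g <- F N) phi (x g)
    - (#|` F N|%:R)^-1 * \sum_(g <- F N) P (x g)| <= eps / 3.
  rewrite -mulrBr -sumrB normrM gtr0_norm ?invr_gt0 ?ltr0n//.
  rewrite mulrC ler_pdivrMr ?ltr0n//; apply: (le_trans (ler_norm_sum _ _ _)).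
  apply: (@le_trans _ _ (\sum_(g <- F N) eps / 3)); first by apply: ler_sum => g _.
  by rewrite big_const_seq count_predT iter_addr_0 -(mulr_natr (eps / 3)).
move: (Rint _ phi) (Rint _ P) h h1 h2 => a b.
move: (_ * \sum_(g <- _) phi _) (_ * \sum_(g <- _) P _) => u v.
rewrite !ler_norml => /andP[? ?] /andP[? ?] /andP[? ?]; apply/andP; split; lra.
Qed.

(** The approximant is a discrete convolution of [phi] with the Fejér kernel. By [torus_modulus] and
    [fejer_bound] its error is at most [eps / 2 + C * 2 / n], and [n] is chosen accordingly. *)
Lemma weyl phi : continuous phi -> equid phi.
Proof.
move=> cphi; apply: equid_limit => // eps e0.
have e2 : 0 < eps / 2 by lra.
have [C C0 phiC] := torus_modulus cphi e2.
pose n := (Num.truncn (4 * C / eps)).+1.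
have n0 : 0 < n%:R :> R by rewrite ltr0n.
have nC : C * (2 / n%:R) <= eps / 2.
  have := truncnS_gt (4 * C / eps); rewrite ltr_pdivrMr// -/n => h.
  rewrite mulrA ler_pdivrMr//; lra.
exists (fun y => \sum_(0 <= q < n) phi (node R n q) / n%:R * fejer n (y - node R n q)).
  by apply: equid_sum => q; apply: equidZ; exact: equid_fejer.
move=> y; have fm := @fejer_mean R n n y (leqnn n).
have -> : phi y = \sum_(0 <= q < n) phi y / n%:R * fejer n (y - node R n q).
  by rewrite -mulr_sumr fm divfK// gt_eqF.
rewrite -sumrB; apply: (le_trans (ler_norm_sum _ _ _)).
apply: (@le_trans _ _ (\sum_(0 <= q < n)
   (eps / 2 * (fejer n (y - node R n q) / n%:R) + C * (2 / n%:R) / n%:R))).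
  apply: ler_sum => q _; rewrite -mulrBl -mulrBl normrM [X in _ * X <= _]ger0_norm ?fejer_ge0//.
  rewrite normrM [X in `|_| * X * _]gtr0_norm ?invr_gt0//.
  have f0 := fejer_ge0 n (y - node R n q).
  have fb := @fejer_bound R n (y - node R n q) isT.
  rewrite [leLHS]mulrAC [eps / 2 * _]mulrA -mulrDl ler_pM2r ?invr_gt0//.
  apply: (le_trans (ler_wpM2r f0 (phiC _ _))).
  rewrite mulrDl lerD2l -mulrA ler_wpM2l// mulrC; exact: fb.
rewrite big_split/= -mulr_sumr -mulr_suml fm divff ?gt_eqF// sumr_const_nat subn0.
by rewrite -(mulr_natr (C * _ / _)) divfK ?gt_eqF//; lra.
Qed.

End Weyl.

Section ComplexConvergence.
Variable R : realType.
Implicit Types (z w : Cplx R).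

Lemma cpartB b z w : cpart b (z - w) = cpart b z - cpart b w.
Proof. by case: z w b => [x y] [x' y'] []. Qed.

Lemma cpartD b z w : cpart b (z + w) = cpart b z + cpart b w.
Proof. by case: z w b => [x y] [x' y'] []. Qed.

Lemma cpart_sum b (J : Type) (s : seq J) (z : J -> Cplx R) :
  cpart b (\sum_(j <- s) z j) = \sum_(j <- s) cpart b (z j).
Proof.
elim: s => [|j s IHs]; first by rewrite !big_nil; case: b.
by rewrite !big_cons cpartD IHs.
Qed.

Lemma cpart_scale b (n : nat) z : cpart b (n%:R^-1 * z) = n%:R^-1 * cpart b z.
Proof.
rewrite -(rmorph_nat (real_complex R)) -fmorphV; move: (n%:R^-1) => r.
by case: z b => x y []/=; rewrite mul0r ?subr0 ?addr0.
Qed.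

Lemma norm_le_cpart z : `|z| <= ((`|cpart true z| + `|cpart false z|)%:C)%C.
Proof.
case: z => x y; rewrite normc_def lecR /= -[leRHS]ger0_norm ?addr_ge0//.
rewrite -sqrtr_sqr ler_sqrt ?sqr_ge0// sqrrD !real_normK ?num_real//.
by rewrite lerD2r lerDl mulrn_wge0// mulr_ge0.
Qed.

Lemma cvg_cpart (T : Type) (U : set_system T) (f : T -> Cplx R) z : Filter U ->
  f @ U --> z <-> forall b, (fun t => cpart b (f t)) @ U --> cpart b z.
Proof.
move=> FU; split=> [cf b|cf]; apply/cvgrPdist_le => eps e0.
  have e0' : 0 < (eps%:C)%C :> Cplx R by rewrite ltcR.
  move/cvgrPdist_le: cf => /(_ _ e0'); apply: filterS => t.
  by rewrite -cpartB; exact: cpart_max.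
have [r r0 ->] : exists2 r : R, 0 < r & eps = (r%:C)%C.
  by case: eps e0 => r s; rewrite ltcE/= => /andP[/eqP -> r0]; exists r.
have r2 : 0 < r / 2 by lra.
move/cvgrPdist_le: (cf true) => /(_ _ r2) ct; move/cvgrPdist_le: (cf false) => /(_ _ r2) cf'.
apply: filterS2 ct cf' => t; rewrite -!cpartB => h1 h2.
by apply: (le_trans (norm_le_cpart _)); rewrite lecR; lra.
Qed.

Lemma continuous_cpart (T : topologicalType) (phi : T -> Cplx R) :
  continuous phi <-> forall b, continuous (fun x => cpart b (phi x)).
Proof.
split=> [c b x|c x]; first by have /cvg_cpart := c x; exact.
by apply/cvg_cpart => b; exact: c.
Qed.

Lemma cpart_cintegral (d : measure_display) (X : measurableType d)
    (mu : probability X R) (f : X -> Cplx R) b :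
  cpart b (cintegral mu f) = Rint mu (fun x => cpart b (f x)).
Proof. by case: b. Qed.

End ComplexConvergence.

Section WeylCriterion.
Variables (R : realType) (G : groupType) (F : nat -> {fset G}) (x : G -> torus R).
Hypothesis F_gt0 : forall N, (0 < #|` F N|)%N.

Let cpart_avg b (phi : torus R -> Cplx R) N :
  cpart b ((#|` F N|%:R)^-1 * \sum_(g <- F N) phi (x g)) =
  (#|` F N|%:R)^-1 * \sum_(g <- F N) cpart b (phi (x g)).
Proof. by rewrite cpart_scale cpart_sum. Qed.

Lemma weyl_criterion : ud_mod1 F x <-> forall b k, (0 < k)%N ->
  (fun N => (#|` F N|%:R)^-1 * \sum_(g <- F N) trig b k (x g) : R) @ \oo --> (0 : R).
Proof.
split=> [ud b k k0|t0 phi /continuous_cpart cphi].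
  pose phi (y : torus R) : Cplx R := (trig b k y +i* 0)%C.
  have /ud : continuous phi.
    apply/continuous_cpart => -[]; first exact: continuous_trig.
    by move=> y; apply: cst_continuous.
  move=> /cvg_cpart /(_ true); rewrite cpart_cintegral Rint_haar_trig//.
  by under [X in X @ _ --> _]eq_fun do rewrite cpart_avg.
apply/cvg_cpart => b; rewrite cpart_cintegral.
under [X in X @ _ --> _]eq_fun do rewrite cpart_avg.
by have [] := weyl F_gt0 t0 (cphi b).
Qed.

End WeylCriterion.

(** * Invariant measures on the space of ultrafilters *)

Lemma ultraP (T : Type) (U : set_system T) : ProperFilter U ->
  (forall A, U A \/ U (~` A)) -> UltraFilter U.
Proof.
move=> PU dich; split=> // V PV UV; apply/seteqP; split=> // A VA.
have [//|UA] := dich A.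
by have := @filter_ex _ _ PV _ (filterI VA (UV _ UA)) => -[x []].
Qed.

Definition stone (G : Type) : Type := {U : set_system G | UltraFilter U}.

Section StoneSpace.
Variable G : groupType.
Implicit Types (A B : set G) (U : stone G).

Lemma stone_ultra U : UltraFilter (sval U). Proof. exact: svalP U. Qed.
Lemma stone_proper U : ProperFilter (sval U).
Proof. exact: (@ultra_proper _ _ (stone_ultra U)). Qed.

Lemma ultra_principal (x : G) : UltraFilter [set A | A x].
Proof.
apply: ultraP; first by split; [exact|split=> // A B AB; exact: AB].
by move=> A; have [Ax|Ax] := pselect (A x); [left|right].
Qed.

Definition principal (x : G) : stone G := exist _ _ (ultra_principal x).

Lemma ultra_fmap (h : G -> G) U : UltraFilter (h @ sval U).
Proof.
apply: ultraP; first by apply: fmap_proper_filter; exact: stone_proper.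
move=> A; exact: (in_ultra_setVsetC (h @^-1` A) (stone_ultra U)).
Qed.

Definition stone_map (h : G -> G) U : stone G := exist _ _ (ultra_fmap h U).

Definition clopen_of A : set (stone G) := [set U | sval U A].

Lemma clopen_of0 : clopen_of set0 = set0.
Proof.
by rewrite -subset0 => U /= U0; have := @filter_ex _ _ (stone_proper U) _ U0 => -[].
Qed.

Lemma clopen_ofT : clopen_of setT = setT.
Proof.
apply/seteqP; split=> // U _; have PU := stone_proper U.
exact: (@filterT _ (sval U)).
Qed.

Lemma clopen_ofI A B : clopen_of A `&` clopen_of B = clopen_of (A `&` B).
Proof.
apply/seteqP; split=> U /=; have PU := stone_proper U; first by case; exact: filterI.
by move=> UAB; split; apply: filterS UAB => x [].
Qed.

Lemma clopen_ofC A : ~` clopen_of A = clopen_of (~` A).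
Proof.
apply/seteqP; split=> U /=; first by case: (in_ultra_setVsetC A (stone_ultra U)).
move=> UA' UA; have PU := stone_proper U.
by have := filter_ex (filterI UA UA') => -[x []].
Qed.

Lemma clopen_ofU A B : clopen_of A `|` clopen_of B = clopen_of (A `|` B).
Proof.
apply/seteqP; split=> U /=; have PU := stone_proper U.
  by case; apply: filterS => x; [left|right].
move=> UAB; have [UA|UA] := in_ultra_setVsetC A (stone_ultra U); [by left|right].
by apply: filterS (filterI UAB UA) => x [[]].
Qed.

Lemma principal_clopen A : principal @^-1` clopen_of A = A.
Proof. by []. Qed.

(* Countable additivity on clopen sets reduces to finite additivity. *)
Lemma clopen_compact A (B : nat -> set G) :
  clopen_of A `<=` \bigcup_n clopen_of (B n) ->
  exists n, A `<=` \bigcup_(i < n) B i.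
Proof.
move=> AB; apply: contrapT => h.
(* If no finite union covers [A], these remainders generate a proper filter; an ultrafilter above it
   contains [A] but no [B n]. *)
pose C n := A `\` \bigcup_(i < n) B i.
have C0 n : C n !=set0.
  by apply/set0P/negP => /eqP An; apply: h; exists n; rewrite -setD_eq0.
have PC : ProperFilter (filter_from setT C).
  apply: filter_from_proper => //; apply: filter_fromT_filter; first by exists 0%N.
  move=> i j; exists (maxn i j) => x [Ax nB].
  by split; split=> // -[k /= kn Bk]; apply: nB; exists k => //=;
    apply: leq_trans kn _; rewrite ?leq_maxl ?leq_maxr.
have [V [UV CV]] := ultraFilterLemma PC.
pose U : stone G := exist _ _ UV.
have PV := stone_proper U.
have [|n _ /= VB] := AB U; first by apply: CV; exists 0%N => // x [].
have VC : V (C n.+1) by apply: CV; exists n.+1.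
have [x [Bx [_ []]]] := filter_ex (filterI VB VC).
by exists n => /=.
Qed.

End StoneSpace.

Definition clopen_display : measure_display. Proof. exact: default_measure_display. Qed.

Section ClopenAlgebra.
Variable G : groupType.

HB.instance Definition _ := gen_eqMixin (stone G).
HB.instance Definition _ := gen_choiceMixin (stone G).
HB.instance Definition _ := isPointed.Build (stone G) (principal 1%g).

Definition clopen : set (set (stone G)) := range (@clopen_of G).

Lemma clopen0 : clopen set0. Proof. by exists set0 => //; exact: clopen_of0. Qed.
Lemma clopenU : setU_closed clopen.
Proof. by move=> _ _ [A _ <-] [B _ <-]; rewrite clopen_ofU; exists (A `|` B). Qed.
Lemma clopenC : setC_closed clopen.
Proof. by move=> _ [A _ <-]; rewrite clopen_ofC; exists (~` A). Qed.

HB.instance Definition _ :=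
  isAlgebraOfSets.Build clopen_display (stone G) clopen0 clopenU clopenC.

End ClopenAlgebra.

Definition stone_space (G : groupType) := g_sigma_algebraType (@measurable _ (stone G)).

Section StoneMeasure.
Variables (R : realType) (G : groupType) (dens : set G -> R).
Hypothesis dens_ge0 : forall A, 0 <= dens A.
Hypothesis densU : forall A B, A `&` B = set0 -> dens (A `|` B) = dens A + dens B.
Hypothesis densT : dens setT = 1.

(** A clopen set is recovered from its trace on principal ultrafilters. The three properties are
    arguments so that the measure structure declared on this function can depend on them. *)
Definition premeasure of (forall A, 0 <= dens A) & 
    (forall A B, A `&` B = set0 -> dens (A `|` B) = dens A + dens B) & dens setT = 1 :=
  fun S : set (stone G) => (dens (@principal G @^-1` S))%:E.

Local Notation m0 := (premeasure dens_ge0 densU densT).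

Let dens0 : dens set0 = 0.
Proof. by have := densU (setI0 (set0 : set G)); rewrite setU0; lra. Qed.

Let m00 : m0 set0 = 0%E. Proof. by rewrite /m0 preimage_set0 dens0. Qed.
Let m0_ge0 S : (0 <= m0 S)%E. Proof. by rewrite lee_fin. Qed.

Let dens_bigcup (B : nat -> set G) n : trivIset setT B ->
  dens (\bigcup_(i < n) B i) = \sum_(i < n) dens (B i).
Proof.
move=> tB; elim: n => [|n IHn].
  by rewrite big_ord0 bigcup_mkord big_ord0 dens0.
rewrite bigcup_mkord !big_ord_recr/= -bigcup_mkord densU ?IHn//.
rewrite setI_bigcupl; apply: bigcup0 => i /= ltin.
by move/trivIsetP: tB; apply=> //; rewrite ltn_eqF.
Qed.

Let m0_sigma : semi_sigma_additive m0.
Proof.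
move=> S mS tS mUS.
pose B n := @principal G @^-1` S n.
have SB n : S n = clopen_of (B n) by rewrite /B; case: (mS n) => A _ <-.
have [A _ AE] := mUS.
have BA i x : B i x -> A x.
  by move=> Bix; suff : clopen_of A (principal x) by []; rewrite AE; exists i.
have tB : trivIset setT B by move=> i j _ _ [x [xi xj]]; apply: tS => //; exists (principal x).
have [n An] : exists n, A `<=` \bigcup_(i < n) B i.
  apply: clopen_compact; rewrite AE; apply: subset_bigcup => i _; by rewrite SB.
have AB : A = \bigcup_(i < n) B i.
  by apply/seteqP; split=> // x [i /= _]; exact: BA.
have Bn i : (n <= i)%N -> B i = set0.
  move=> ni; rewrite -subset0 => x Bix.
  have := BA _ _ Bix; rewrite AB => -[j /= jn Bjx].
  have ij : i != j by rewrite gtn_eqF// (leq_trans jn ni).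
  move/trivIsetP: (tB) => /(_ i j I I ij)/seteqP[+ _].
  by apply; split; [exact: Bix|exact: Bjx].
rewrite -AE; apply: cvg_near_cst; exists n => // k /= nk.
rewrite /m0 principal_clopen AB.
rewrite dens_bigcup// -sumEFin -(big_mkord xpredT (fun i => (dens (B i))%:E)).
have tl : (\sum_(n <= i < k) (dens (B i))%:E = 0)%E.
  by rewrite big_nat big1// => i /andP[/Bn -> _]; rewrite dens0.
by rewrite (big_cat_nat (leq0n n) nk)/= tl adde0.
Qed.

HB.instance Definition _ := isMeasure.Build _ _ _ m0 m00 m0_ge0 m0_sigma.


Local Notation mu0 := (measure_extension m0).

Lemma stone_extE A : mu0 (clopen_of A) = (dens A)%:E.
Proof. by rewrite /measure_extension measurable_mu_extE//; exists A. Qed.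

Let mu0T : mu0 setT = 1%E.
Proof. by rewrite -densT -stone_extE clopen_ofT. Qed.

HB.instance Definition _ := Measure_isProbability.Build _ _ _ mu0 mu0T.

Lemma stone_measure : exists mu : probability (stone_space G) R,
  forall A, mu (clopen_of A) = (dens A)%:E.
Proof. by exists mu0; exact: stone_extE. Qed.

End StoneMeasure.

Section StoneAction.
Variables (R : realType) (G : groupType).

Lemma measurable_clopen_of (A : set G) : measurable (clopen_of A : set (stone_space G)).
Proof. by apply: sub_sigma_algebra; exists A. Qed.

Lemma measurable_stone_map (h : G -> G) :
  measurable_fun setT (stone_map h : stone_space G -> stone_space G).
Proof.
apply: (@measurability _ _ (stone_space G) (stone_space G) setT (stone_map h)
  (@clopen G)) => // _ [_ [A _ <-] <-]; rewrite setTI.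
exact: (measurable_clopen_of (h @^-1` A)).
Qed.

Lemma stone_measure_map (mu : probability (stone_space G) R) (h : G -> G) :
  (forall A, mu (clopen_of (h @^-1` A)) = mu (clopen_of A)) ->
  forall S : set (stone_space G), measurable S -> mu (stone_map h @^-1` S) = mu S.
Proof.
move=> hmu S mS; have mh := measurable_stone_map h.
pose t : stone_space G -> stone_space G := stone_map h.
have : pushforward mu t S = mu S; last exact.
apply: (@measure_unique _ R (stone_space G) (@clopen G) (fun=> setT) _ _ _ _
  (pushforward mu t) mu) => //.
- by move=> _ _ [A _ <-] [B _ <-]; rewrite clopen_ofI; exists (A `&` B).
- by move=> _; exists setT => //; exact: clopen_ofT.
- exact: bigcup_const.
- by move=> _ [A _ <-]; exact: hmu.
- by move=> _; apply: le_lt_trans (probability_le1 mu _) (ltry 1); exact: measurableT.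
Qed.

End StoneAction.

(** A neighbourhood preimage missing from [E] has a complement compatible with [E]; an ultrafilter
    containing both would not converge to [l]. *)
Lemma cvg_ultra (R : realType) (T : Type) (E : set_system T) (f : T -> R) (l : R) :
  ProperFilter E ->
  (forall U : set_system T, UltraFilter U -> E `<=` U -> f @ U --> l) -> f @ E --> l.
Proof.
move=> PE h A Al; change (E (f @^-1` A)).
apply: contrapT => nE; pose B := ~` (f @^-1` A).
have PB : ProperFilter (within B E).
  split; last exact: within_filter.
  rewrite /within/= => E0; apply: nE; apply: filterS E0 => t /=.
  by move=> Bt; apply: contrapT => /Bt.
have [U [UU BU]] := ultraFilterLemma PB.
have PU : ProperFilter U by exact: ultra_proper.
have UB : U B by apply: BU; apply: filterS (@filterT _ E _).
have UA : U (f @^-1` A).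
  apply: (h U UU) Al => C EC; apply: BU; apply: filterS EC => t Ct _; exact: Ct.
by have := filter_ex (filterI UA UB) => -[t []].
Qed.

Section BoundedLimits.
Variable R : realType.

Definition bounded_fun_on (T : Type) (u : T -> R) : Prop := exists M : R, forall x, `|u x| <= M.

Lemma bounded_lim (T : Type) (U : set_system T) (u : T -> R) :
  UltraFilter U -> bounded_fun_on u -> u @ U --> lim (u @ U).
Proof.
move=> UU [M uM]; have PU : ProperFilter U by exact: ultra_proper.
have [|l _ ul] := @ultra_cvg R T U u (- M) M UU.
  by apply: filterS (@filterT _ U _) => x _ /=; rewrite -ler_norml.
by apply/cvg_ex; exists l.
Qed.

Lemma bounded_funD (T : Type) (u v : T -> R) :
  bounded_fun_on u -> bounded_fun_on v -> bounded_fun_on (fun x => u x + v x).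
Proof.
move=> [M uM] [N vN]; exists (M + N) => x; apply: (le_trans (ler_normD _ _)); exact: lerD.
Qed.

Lemma bounded_funM (T : Type) (u v : T -> R) :
  bounded_fun_on u -> bounded_fun_on v -> bounded_fun_on (fun x => u x * v x).
Proof.
by move=> [M uM] [N vN]; exists (M * N) => x; rewrite normrM; exact: ler_pM.
Qed.

Lemma bounded_fun_cst (T : Type) (c : R) : bounded_fun_on (fun _ : T => c).
Proof. by exists `|c|. Qed.

Lemma bounded_fun_indic (T : Type) (A : set T) : bounded_fun_on (\1_A : T -> R).
Proof. by exists 1 => x; rewrite indicE ger0_norm// lern1 leq_b1. Qed.

Lemma bounded_fun_sum (T J : Type) (s : seq J) (u : J -> T -> R) :
  (forall j, bounded_fun_on (u j)) -> bounded_fun_on (fun x => \sum_(j <- s) u j x).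
Proof.
move=> bu; elim: s => [|j s IHs].
  by under eq_fun do rewrite big_nil; exact: bounded_fun_cst.
by under eq_fun do rewrite big_cons; exact: bounded_funD.
Qed.

End BoundedLimits.

(** * The invariant mean along an ultrafilter *)

Section Mean.
Variables (R : realType) (G : groupType) (F : nat -> {fset G}).
Hypothesis F_folner : folner R F.
Variable V : set_system nat.
Hypotheses (V_ultra : UltraFilter V) (V_oo : \oo `<=` V).
Implicit Types (u v : G -> R).

Let V_proper : ProperFilter V. Proof. exact: ultra_proper. Qed.

Definition favg u (N : nat) : R := (#|` F N|%:R)^-1 * \sum_(g <- F N) u g.

Definition fmean u : R := lim (favg u @ V).

Let F_gt0 N : 0 < #|` F N|%:R :> R. Proof. by rewrite ltr0n; exact: (folner_gt0 F_folner). Qed.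

Lemma favg_close u v eps N : (forall g, `|u g - v g| <= eps) -> `|favg u N - favg v N| <= eps.
Proof.
move=> h; rewrite -mulrBr -sumrB normrM gtr0_norm ?invr_gt0//.
rewrite mulrC ler_pdivrMr//; apply: (le_trans (ler_norm_sum _ _ _)).
apply: (@le_trans _ _ (\sum_(g <- F N) eps)); first by apply: ler_sum => g _.
by rewrite big_const_seq count_predT iter_addr_0 -(mulr_natr eps).
Qed.

Lemma favg_bounded u : bounded_fun_on u -> bounded_fun_on (favg u).
Proof.
move=> [M uM]; exists M => N; have := @favg_close u (fun=> 0) M N.
rewrite {2}/favg big1 ?mulr0 ?subr0//; apply=> g; by rewrite subr0.
Qed.

Lemma fmean_cvg u : bounded_fun_on u -> favg u @ V --> fmean u.
Proof. by move=> bu; apply: bounded_lim => //; exact: favg_bounded. Qed.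

Lemma fmean_unique u l : favg u @ V --> l -> fmean u = l.
Proof. by move=> ul; apply: cvg_lim. Qed.

Lemma fmean_cst c : fmean (fun=> c) = c.
Proof.
apply: fmean_unique; rewrite (_ : favg _ = fun=> c); first exact: cvg_cst.
apply/funext => N; rewrite /favg big_const_seq count_predT iter_addr_0 -(mulr_natl c).
by rewrite mulKf// gt_eqF.
Qed.

Lemma fmeanD u v : bounded_fun_on u -> bounded_fun_on v ->
  fmean (fun g => u g + v g) = fmean u + fmean v.
Proof.
move=> bu bv; apply: fmean_unique.
rewrite (_ : favg _ = fun N => favg u N + favg v N); first by apply: cvgD; exact: fmean_cvg.
by apply/funext => N; rewrite /favg big_split/= mulrDr.
Qed.

Lemma fmeanZ a u : bounded_fun_on u -> fmean (fun g => a * u g) = a * fmean u.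
Proof.
move=> bu; apply: fmean_unique.
rewrite (_ : favg _ = fun N => a * favg u N); first by apply: cvgM; [exact: cvg_cst|exact: fmean_cvg].
by apply/funext => N; rewrite /favg -mulr_sumr mulrCA.
Qed.

Lemma fmean_sum (J : Type) (s : seq J) (u : J -> G -> R) : (forall j, bounded_fun_on (u j)) ->
  fmean (fun g => \sum_(j <- s) u j g) = \sum_(j <- s) fmean (u j).
Proof.
move=> bu; elim: s => [|j s IHs].
  by under eq_fun do rewrite big_nil; rewrite fmean_cst big_nil.
under eq_fun do rewrite big_cons.
by rewrite fmeanD ?IHs ?big_cons//; exact: bounded_fun_sum.
Qed.

Lemma fmean_close u v eps : bounded_fun_on u -> bounded_fun_on v ->
  (forall g, `|u g - v g| <= eps) -> `|fmean u - fmean v| <= eps.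
Proof.
move=> bu bv h.
have c : (fun N => `|favg u N - favg v N|) @ V --> `|fmean u - fmean v|.
  by apply: cvg_norm; apply: cvgB; exact: fmean_cvg.
by apply: (cvgr_to_le c); apply: filterS (@filterT _ V _) => N _; exact: favg_close.
Qed.

Lemma fmean_ge0 u : bounded_fun_on u -> (forall g, 0 <= u g) -> 0 <= fmean u.
Proof.
move=> bu u0; apply: (cvgr_to_ge (fmean_cvg bu)).
apply: filterS (@filterT _ V _) => N _; by rewrite mulr_ge0 ?invr_ge0//; exact: sumr_ge0.
Qed.

Lemma fmean_shift u h : bounded_fun_on u -> fmean (fun g => u (h * g)%g) = fmean u.
Proof.
move=> bu; have [M uM] := bu; apply: fmean_unique.
have M0 : 0 <= M by apply: le_trans (uM 1%g).
have d0 : (fun N => favg (fun g => u (h * g)%g) N - favg u N) @ V --> (0 : R).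
  apply/cvgr0Pnorm_le => eps e0.
  pose c := (Num.truncn (2 * M / eps)).+1.
  have [K KP] := folner_escape F_folner c [:: h].
  apply: V_oo; exists K => // N /= KN; have := KP N KN h (mem_head _ _).
  rewrite -(ler_nat R) natrM => esc.
  rewrite -mulrBr normrM gtr0_norm ?invr_gt0// mulrC ler_pdivrMr//.
  apply: (le_trans (translate_sum (F N) h uM)).
  have := truncnS_gt (2 * M / eps); rewrite -/c ltr_pdivrMr// => /ltW Mc.
  apply: le_trans (ler_wpM2l (ltW e0) esc).
  by rewrite mulrA (mulrC eps) ler_wpM2r// ler0n.
rewrite -[fmean u]add0r.
rewrite (_ : favg _ = fun N => (favg (fun g => u (h * g)%g) N - favg u N) + favg u N).
  by apply: cvgD => //; exact: fmean_cvg.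
by apply/funext => N; rewrite subrK.
Qed.

Definition fdens A : R := fmean \1_A.

Lemma fdens_ge0 A : 0 <= fdens A.
Proof. by apply: fmean_ge0 => [|g]; [exact: bounded_fun_indic|rewrite indicE]. Qed.

Lemma fdensU A B : A `&` B = set0 -> fdens (A `|` B) = fdens A + fdens B.
Proof.
move=> AB; rewrite -fmeanD; [|exact: bounded_fun_indic|exact: bounded_fun_indic].
congr fmean; apply/funext => g; rewrite !indicE in_setU.
have [gA|gA] := boolP (g \in A); have [gB|gB] := boolP (g \in B); rewrite ?addr0 ?add0r//.
have : (A `&` B) g by split; exact: set_mem.
by rewrite AB.
Qed.

Lemma fdensT : fdens setT = 1.
Proof. by rewrite /fdens indicT fmean_cst. Qed.

Lemma fdens_shift A h : fdens ((fun g => h * g)%g @^-1` A) = fdens A.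
Proof. exact: (fmean_shift h (bounded_fun_indic R A)). Qed.

End Mean.

Section StoneExtension.
Variables (R : realType) (G : groupType).
Implicit Types (u v : G -> R) (U : stone_space G).

Definition stone_ext u U : R := lim (u @ sval U).

Lemma stone_ext_cvg u U : bounded_fun_on u -> u @ sval U --> stone_ext u U.
Proof. by apply: bounded_lim; exact: stone_ultra. Qed.

Lemma stone_ext_unique u U l : u @ sval U --> l -> stone_ext u U = l.
Proof. by have PU := stone_proper U; move=> ul; apply: cvg_lim. Qed.

Lemma stone_ext_cst c U : stone_ext (fun=> c) U = c.
Proof. by have PU := stone_proper U; apply: stone_ext_unique; exact: cvg_cst. Qed.

Lemma stone_extD u v U : bounded_fun_on u -> bounded_fun_on v ->
  stone_ext (fun g => u g + v g) U = stone_ext u U + stone_ext v U.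
Proof.
have PU := stone_proper U.
by move=> bu bv; apply: stone_ext_unique; apply: cvgD; exact: stone_ext_cvg.
Qed.

Lemma stone_extM u v U : bounded_fun_on u -> bounded_fun_on v ->
  stone_ext (fun g => u g * v g) U = stone_ext u U * stone_ext v U.
Proof.
have PU := stone_proper U.
by move=> bu bv; apply: stone_ext_unique; apply: cvgM; exact: stone_ext_cvg.
Qed.

Lemma stone_ext_sum (J : Type) (s : seq J) (u : J -> G -> R) U :
  (forall j, bounded_fun_on (u j)) ->
  stone_ext (fun g => \sum_(j <- s) u j g) U = \sum_(j <- s) stone_ext (u j) U.
Proof.
move=> bu; elim: s => [|j s IHs].
  by under eq_fun do rewrite big_nil; rewrite stone_ext_cst big_nil.
under eq_fun do rewrite big_cons.
by rewrite stone_extD ?IHs ?big_cons//; exact: bounded_fun_sum.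
Qed.

Lemma stone_ext_close u v eps U : bounded_fun_on u -> bounded_fun_on v ->
  (forall g, `|u g - v g| <= eps) -> `|stone_ext u U - stone_ext v U| <= eps.
Proof.
have PU := stone_proper U; move=> bu bv h.
have c : (fun g => `|u g - v g|) @ sval U --> `|stone_ext u U - stone_ext v U|.
  by apply: cvg_norm; apply: cvgB; exact: stone_ext_cvg.
by apply: (cvgr_to_le c); apply: filterS (@filterT _ (sval U) _) => g _; exact: h.
Qed.

Lemma stone_ext_indic (A : set G) U : stone_ext \1_A U = \1_(clopen_of A) U.
Proof.
have PU := stone_proper U.
apply: stone_ext_unique; apply: cvg_near_cst.
have [UA|UA] := in_ultra_setVsetC A (stone_ultra U).
  by apply: (@filterS _ (sval U) PU _ _ _ UA) => g Ag; rewrite !indicE !mem_set.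
apply: (@filterS _ (sval U) PU _ _ _ UA) => g Ag; rewrite !indicE !memNset//= => UA'.
by have := filter_ex (filterI UA' UA) => -[x []].
Qed.

Lemma bmeas_stone_ext u : bounded_fun_on u -> bmeas (stone_ext u).
Proof.
move=> bu; split; last first.
  have [M uM] := bu; exists M => U.
  have := @stone_ext_close u (fun=> 0) M U bu (bounded_fun_cst G 0).
  by rewrite stone_ext_cst subr0; apply => g; rewrite subr0.
apply: (measurability _ (RGenOInfty.measurableE R)).
move=> _ [_ [a ->] <-]; rewrite setTI.
(* The margin [n.+1%:R^-1] keeps the inequality strict in the limit. *)
rewrite [X in measurable X](_ : _ =
    \bigcup_n clopen_of [set g | a + n.+1%:R^-1 < u g]); last first.
  apply/seteqP; split=> U; have PU := stone_proper U; rewrite /= in_itv/= andbT.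
    move=> aU; pose e := stone_ext u U - a.
    have e0 : 0 < e by rewrite subr_gt0.
    have [n ne] : exists n : nat, n.+1%:R^-1 < e.
      exists (Num.truncn e^-1); rewrite invf_plt ?posrE ?ltr0n//.
      exact: truncnS_gt.
    have lt : a + n.+1%:R^-1 < stone_ext u U by rewrite -ltrBrDl.
    exists n => //=; have := cvgr_gt _ (stone_ext_cvg (U := U) bu) _ lt; exact.
  move=> [n _ /= Un]; apply: (@lt_le_trans _ _ (a + n.+1%:R^-1)).
    by rewrite ltrDl invr_gt0.
  by apply: (cvgr_to_ge (stone_ext_cvg (U := U) bu)); apply: (@filterS _ (sval U) PU _ _ _ Un) => g /ltW.
by apply: bigcup_measurable => n _; exact: measurable_clopen_of.
Qed.

End StoneExtension.

Section Correspondence.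
Variables (R : realType) (G : groupType) (F : nat -> {fset G}).
Hypothesis F_folner : folner R F.
Variable V : set_system nat.
Hypotheses (V_ultra : UltraFilter V) (V_oo : \oo `<=` V).
Variable mu : probability (stone_space G) R.
Hypothesis muE : forall A, mu (clopen_of A) = (fdens R F V A)%:E.
Implicit Types (u : G -> R).

Lemma stone_mp_action : mp_action mu (fun h => stone_map (fun g => h * g)%g).
Proof.
split.
- move=> [U UU]; apply: eq_exist => /=.
  by rewrite (_ : (fun g => _) = id)//; apply/funext => g; rewrite mul1g.
- move=> g h [U UU]; apply: eq_exist => /=.
  rewrite [in RHS](_ : (fun x => _) = (fun x => g * (h * x))%g)//.
  by apply/funext => x; rewrite mulgA.
- by move=> g; exact: measurable_stone_map.
- move=> g; apply: stone_measure_map => A.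
  by rewrite !muE; congr _%:E; exact: fdens_shift.
Qed.

(** For indicators this is [muE]; staircases are combinations of indicators, and both sides respect
    uniform approximation. Halving [u] brings it into the range of the staircase. *)
Lemma Rint_stone_ext u : (forall g, `|u g| <= 1) -> Rint mu (stone_ext u) = fmean F V u.
Proof.
move=> u1; have bu : bounded_fun_on u by exists 1.
pose A (m : nat) (j : 'I_m) := [set g | threshold (u g / 2) j].
pose v m g : R := 2 * (m%:R^-1 * (\sum_(j < m) \1_(A m j) g) + - 2^-1).
have bA m j : bounded_fun_on (\1_(A m j) : G -> R) by exact: bounded_fun_indic.
have bsA m : bounded_fun_on (fun g => \sum_(j < m) \1_(A m j) g : R) by exact: bounded_fun_sum.
have bc c : bounded_fun_on (fun _ : G => c : R) by exact: bounded_fun_cst.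
have bv m : bounded_fun_on (v m).
  by apply: bounded_funM => //; apply: bounded_funD => //; apply: bounded_funM.
have vu m g : (0 < m)%N -> `|u g - v m g| <= 2 / m%:R.
  move=> m0; have -> : v m g = 2 * staircase R (threshold (m := m) (u g / 2)).
    rewrite /v /staircase mulrC [m%:R^-1 * _]mulrC mulrC; congr (2 * (_ / _ - _)); apply: eq_bigr => j _; rewrite indicE.
    by congr (nat_of_bool _)%:R; apply/idP/idP => [/set_mem|/mem_set].
  have {1}-> : u g = 2 * (u g / 2) by rewrite mulrC divfK.
  rewrite -mulrBr normrM gtr0_norm// ler_wpM2l//.
  rewrite distrC; apply: staircase_close => //.
  by rewrite normrM [X in _ * X]gtr0_norm ?invr_gt0// ler_pdivrMr// mulVf.
have E m : Rint mu (stone_ext (v m)) = fmean F V (v m).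
  transitivity (2 * (m%:R^-1 * (\sum_(j < m) fdens R F V (A m j)) + - 2^-1)).
    have -> : stone_ext (v m) =
        fun U => 2 * (m%:R^-1 * (\sum_(j < m) \1_(clopen_of (A m j)) U) + - 2^-1).
      apply/funext => U.
      rewrite stone_extM//; last by apply: bounded_funD => //; exact: bounded_funM.
      rewrite stone_ext_cst stone_extD//; last exact: bounded_funM.
      rewrite stone_extM// stone_ext_sum// !stone_ext_cst.
      by under eq_bigr do rewrite stone_ext_indic.
    have mA j := measurable_clopen_of (A m j).
    have biA j := bmeas_indic R (mA j).
    have bS := bmeas_sum (index_enum 'I_m) xpredT biA.
    have bc' c := bmeas_cst (stone_space G) (c : R).
    rewrite RintZ; last by apply: bmeasD => //; exact: bmeasM.
    rewrite RintD//; last exact: bmeasM.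
    rewrite RintZ// Rint_sum// Rint_cst; congr (2 * (_ * _ + _)).
    by apply: eq_bigr => j _; rewrite Rint_indic// muE.
  rewrite fmeanZ//; last by apply: bounded_funD => //; exact: bounded_funM.
  rewrite fmeanD//; last exact: bounded_funM.
  by rewrite fmeanZ// fmean_sum// fmean_cst.
apply/eqP; rewrite -subr_eq0 -normr_le0; apply/ler_addgt0Pr => e e0; rewrite add0r.
pose m := (Num.truncn (4 / e)).+1.
have m0 : 0 < m%:R :> R by rewrite ltr0n.
have me : 4 / m%:R <= e.
  rewrite ler_pdivrMr// mulrC -ler_pdivrMr// ltW//; exact: truncnS_gt.
have h1 : `|Rint mu (stone_ext u) - Rint mu (stone_ext (v m))| <= 2 / m%:R.
  apply: Rint_close; [exact: bmeas_stone_ext|exact: bmeas_stone_ext|].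
  by move=> U; apply: stone_ext_close => // g; exact: vu.
have h2 : `|fmean F V u - fmean F V (v m)| <= 2 / m%:R.
  by apply: fmean_close => // g; exact: vu.
move: h1 h2 me; rewrite E; move: (Rint _ _) (fmean F V u) (fmean F V (v m)) (m%:R^-1).
move=> a b c r; rewrite !ler_norml => /andP[? ?] /andP[? ?] ?; apply/andP; split; lra.
Qed.

End Correspondence.

(** * The two implications *)

Definition dynamical_vdC (R : realType) (G : groupType) (H : set G) : Prop :=
  forall (d : measure_display) (X : measurableType d) (mu : probability X R)
    (T : G -> X -> X), mp_action mu T ->
  forall f : X -> Cplx R, Linfty mu f ->
    (forall h : G, H h -> cintegral mu (fun x => f (T h x) * (f x)^*) = 0) ->
    cintegral mu f = 0.

Section VanDerCorput.
Variables (R : realType) (G : groupType) (F : nat -> {fset G}) (H : set G).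
Hypothesis F_folner : folner R F.

Lemma trigB b k (x y : torus R) : trig b k (x - y) =
  ccorr b (tcos k x +i* tsin k x)%C (tcos k y +i* tsin k y)%C.
Proof. by case: b; [exact: tcosB|exact: tsinB]. Qed.

Section Recurrent.
Hypothesis H_dyn : dynamical_vdC R H.
Variable x : G -> torus R.
Hypothesis x_diff : forall h b k, H h -> (0 < k)%N ->
  favg F (fun g => trig b k (x (h * g)%g - x g)) @ \oo --> (0 : R).

(** Convergence is tested along every ultrafilter finer than [\oo], each of which yields its own
    invariant measure. *)
Lemma dynamical_vdC_trig b k : (0 < k)%N -> favg F (fun g => trig b k (x g)) @ \oo --> (0 : R).
Proof.
move=> k0; apply: cvg_ultra => V UV Voo; have PV : ProperFilter V by exact: ultra_proper.
have [mu muE] := stone_measure (fdens_ge0 F_folner UV) (fdensU F_folner UV) (fdensT F_folner UV).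
have act := stone_mp_action F_folner UV Voo muE.
pose u b g := trig b k (x g).
have u1 b' g : `|u b' g| <= 1 by exact: trig_max.
have bu b' : bounded_fun_on (u b') by exists 1.
have buh b' h : bounded_fun_on (fun g => u b' (h * g)%g) by exists 1.
pose f (U : stone_space G) : Cplx R := (stone_ext (u true) U +i* stone_ext (u false) U)%C.
have mf b' : bmeas (fun U => cpart b' (f U)) by case: b'; exact: bmeas_stone_ext.
have f_max U b' : `|cpart b' (f U)| <= 1.
  have -> : cpart b' (f U) = stone_ext (u b') U by case: b'.
  have := @stone_ext_close R G (u b') (fun=> 0) 1 U (bu b') (bounded_fun_cst G 0).
  by rewrite stone_ext_cst subr0; apply => g; rewrite subr0.
have Lf : Linfty mu f.
  split; [exact: (mf true).1|exact: (mf false).1|exists 2].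
  apply: aeW => U; apply: (le_trans (norm_le_cpart _)).
  by rewrite lecR (_ : 2 = 1 + 1)// lerD.
have f_corr h : H h ->
    cintegral mu (fun U => f (stone_map (fun g => h * g)%g U) * (f U)^*) = 0.
  move=> Hh; suff E b' : cpart b' (cintegral mu
      (fun U => f (stone_map (fun g => h * g)%g U) * (f U)^*)) = 0.
    by move: (E true) (E false); case: (cintegral _ _) => r s /= -> ->.
  rewrite cpart_cintegral.
  rewrite (_ : (fun U => _) = stone_ext (fun g => trig b' k (x (h * g)%g - x g))).
    rewrite (Rint_stone_ext F_folner UV muE); last by move=> g; exact: trig_max.
    apply: fmean_unique => //; apply: cvg_trans (x_diff b' Hh k0).
    by move=> A xA; exact: Voo.
  apply/funext => U; rewrite cpart_mulconj.
  have PU := stone_proper U; apply/esym/stone_ext_unique.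
  rewrite (_ : (fun g => _) = (fun g => ccorr b' (u true (h * g)%g +i* u false (h * g)%g)%C
     (u true g +i* u false g)%C)); last by apply/funext => g; rewrite trigB.
  have c1 b1 := @stone_ext_cvg R G (u b1) U (bu b1).
  have c2 b1 := @stone_ext_cvg R G (fun g => u b1 (h * g)%g) U (buh b1 h).
  rewrite /ccorr; case: b' => /=.
    exact: (cvgD (cvgM (c2 true) (c1 true)) (cvgM (c2 false) (c1 false))).
  exact: (cvgB (cvgM (c2 false) (c1 true)) (cvgM (c2 true) (c1 false))).
have : cpart b (cintegral mu f) = 0 by rewrite (H_dyn act Lf f_corr); case: b.
rewrite cpart_cintegral (_ : (fun U => _) = stone_ext (u b)); last by apply/funext; case: b.
rewrite (Rint_stone_ext F_folner UV muE)// => <-.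
exact: (fmean_cvg F_folner UV (bu b)).
Qed.

End Recurrent.

Lemma sample_law_le (C : bool -> R) K (delta delta' : R) lam : delta <= delta' ->
  sample_law H C K delta lam -> sample_law H C K delta' lam.
Proof.
move=> dd [p1 p2 p3 p4]; split=> // [b k kK|h b k Hh kK hkK].
  by apply: le_trans dd; exact: p3.
by apply: le_trans dd; exact: p4.
Qed.

Lemma bad_sequence (d : measure_display) (X : measurableType d) (mu : probability X R)
    (T : G -> X -> X) (f : X -> Cplx R) :
  countable [set: G] -> infinite_set [set: G] -> ~ H 1%g ->
  mp_action mu T -> Linfty mu f ->
  (forall h, H h -> cintegral mu (fun x => f (T h x) * (f x)^*) = 0) ->
  cintegral mu f != 0 ->
  exists x : G -> torus R,
    (forall h b k, H h -> (0 < k)%N ->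
       favg F (fun g => trig b k (x (h * g)%g - x g)) @ \oo --> (0 : R)) /\
    exists b, ~ (favg F (fun g => trig b 1 (x g)) @ \oo --> (0 : R)).
Proof.
move=> cG iG H1 act Lf f_corr f0.
(* This [c] is positive whatever the sign of [M], and [c / 2] bounds both parts of [f] almost
   everywhere. *)
have [_ _ [M fM]] := Lf; pose c := 2 * (`|M| + 1).
have c0 : 0 < c by rewrite mulr_gt0// ltr_wpDl.
have f_bound : {ae mu, forall x b, `|cpart b (f x)| <= c / 2}.
  apply: filterS fM => y fy b; apply: (le_trans (cpart_max b fy)).
  by rewrite /c mulrAC divff// mul1r (le_trans (ler_norm M))// lerDl.
pose C b := Rint mu (bounded_part f c b).
have C_max b : `|C b| <= 1.
  have := @Rint_close _ _ _ mu _ (fun=> 0) 2^-1 (bmeas_bounded_part Lf c b) (bmeas_cst X 0).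
  rewrite Rint_cst subr0 => h; apply: le_trans (h _) _; last by lra.
  by move=> y; rewrite subr0; exact: clip_max.
have law K delta : 0 < delta -> exists lam, sample_law H C K delta lam.
  move=> delta0; pose m := (Num.truncn (2 / delta)).+1.
  have md : 2 * m%:R^-1 <= delta.
    by rewrite ler_pdivrMr ?ltr0n// mulrC -ler_pdivrMr// ltW// truncnS_gt.
  eexists; apply: sample_law_le md _.
  exact: (mu_sample_law act Lf f_corr c0 f_bound).
have [x [x1 x2]] := exists_bad_sequence cG iG F_folner H1 C_max law.
exists x; split=> //.
suff [b Cb] : exists b, C b != 0 by exists b; exact: x2.
apply: contrapT => nC; move/eqP: f0; apply.
have E b : cpart b (cintegral mu f) = 0.
  rewrite -(Rint_bounded_part Lf c0 f_bound); apply/eqP; rewrite mulf_eq0.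
  by apply/orP; right; apply/negPn/negP => Cb; apply: nC; exists b.
by move: (E true) (E false); case: (cintegral _ _) => r s /= -> ->.
Qed.

End VanDerCorput.

Theorem theorem1p12 (R : realType) (G : groupType)
    (G_countable : countable [set: G]) (G_infinite : infinite_set [set: G])
    (F : nat -> {fset G}) (F_folner : folner R F)
    (H : set G) (H_e : ~ H 1%g) :
  vdC R F H <->
  forall (d : measure_display) (X : measurableType d) (mu : probability X R)
    (T : G -> X -> X), mp_action mu T ->
  forall f : X -> Cplx R, Linfty mu f ->
    (forall h : G, H h -> cintegral mu (fun x => f (T h x) * (f x)^*) = 0) ->
    cintegral mu f = 0.
Proof.
have F0 := folner_gt0 F_folner.
split=> [H_vdC d X mu T act f Lf f_corr|H_dyn x x_diff].
  apply/eqP/negPn/negP => f0.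
  have [x [x_diff [b]]] := bad_sequence F_folner G_countable G_infinite H_e act Lf f_corr f0.
  apply; have /H_vdC/(weyl_criterion _ F0) : forall h, H h -> ud_mod1 F (fun g => x (h * g)%g - x g).
    by move=> h Hh; apply/(weyl_criterion _ F0) => b' k k0; exact: x_diff.
  exact.
apply/(weyl_criterion _ F0) => b k k0.
apply: (dynamical_vdC_trig F_folner H_dyn) => // h b' k' Hh k'0.
have /(weyl_criterion _ F0) := x_diff h Hh; exact.
Qed.
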